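(* For $n\in\{1,2\}$, there are no solutions $u$ to $$(-\Delta)^{n/2}u=-e^{nu}\quad\text{on }\mathbb{R}^n\setminus\{0\},\qquad \Lambda:=\int_{\mathbb{R}^n}e^{nu}\,dx<\infty .$$
   Context: Notion of solution. For $n$ even: $u\in L^1_{loc}(\mathbb{R}^n)$, $e^{nu}\in L^1(\mathbb{R}^n)$ and $\int_{\mathbb{R}^n}u\,(-\Delta)^{n/2}\psi\,dx=-\int_{\mathbb{R}^n}e^{nu}\psi\,dx$ for every $\psi\in C_c^\infty(\mathbb{R}^n\setminus\{0\})$. For $n$ odd: the same identity holds for every $\psi\in C_c^\infty(\mathbb{R}^n\setminus\{0\})$, with $e^{nu}\in L^1(\mathbb{R}^n)$ and $u\in L_{n/2}(\mathbb{R}^n):=\{u\in L^1_{loc}(\mathbb{R}^n):\int_{\mathbb{R}^n}\frac{|u(x)|}{1+|x|^{2n}}dx<\infty\}$, where $(-\Delta)^{n/2}\psi$ is defined through the Fourier transform by $\mathcal{F}((-\Delta)^{n/2}\psi)(\xi)=|\xi|^n\mathcal{F}\psi(\xi)$. *)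

(* Defs.v *)
From HB Require Import structures.
From mathcomp Require Import all_boot all_order all_algebra.
From mathcomp Require Import all_classical all_reals all_analysis.
From mathcomp Require Import complex.
Set Implicit Arguments.
Unset Strict Implicit.
Unset Printing Implicit Defensive.
Import Order.TTheory GRing.Theory Num.Theory.
Import numFieldNormedType.Exports.
Local Open Scope classical_set_scope.
Local Open Scope ring_scope.

Section TestFunctions.
Context {R : realType} {V : normedModType R}.

(* For finite-dimensional V this is the class C^k: all iterated directional
   derivatives of order at most k exist and are continuous. *)
Fixpoint is_Ck (k : nat) (f : V -> R) : Prop :=
  continuous f /\
  if k is k'.+1 then
    forall v : V, (forall x, derivable f x v) /\ is_Ck k' ('D_v f)
  else True.

Definition smooth (f : V -> R) : Prop := forall k, is_Ck k f.

Definition supp (f : V -> R) : set V := closure [set x | f x != 0].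

(* C_c^oo (V \ {0}) *)
Definition test_function_off0 (psi : V -> R) : Prop :=
  [/\ smooth psi, compact (supp psi) & ~ supp psi 0].

End TestFunctions.

Section DimensionOne.
Context {R : realType}.
Notation mu := (@lebesgue_measure R).

(* \int f(x) e^{- i x xi} dx for real-valued f. A multiplicative normalisation
   such as (2 pi)^(-1/2) is immaterial below; the frequency convention is the
   one for which - d^2/dx^2 has symbol |xi|^2. *)
Definition fourier (f : R -> R) (xi : R) : R[i] :=
  ((\int[mu]_x (f x * cos (x * xi)))
   +i* - (\int[mu]_x (f x * sin (x * xi))))%C.

(* g is (-Delta)^(1/2) psi. This determines g almost everywhere, by injectivity
   of the Fourier transform on L^1; when psi is smooth with compact support
   such a g exists, because (-Delta)^(1/2) psi is O(|x|^-2) at infinity. *)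
Definition is_half_laplacian (psi g : R -> R) : Prop :=
  mu.-integrable setT (EFin \o g) /\
  forall xi : R, fourier g xi = (`|xi|%:C)%C * fourier psi xi.

(* The space L_{n/2}(R^n) for n = 1. *)
Definition L_half (u : R -> R) : Prop :=
  locally_integrable setT u /\
  (\int[mu]_x (`|u x| / (1 + `|x| ^+ 2))%:E < +oo)%E.

Definition is_solution1 (u : R -> R) : Prop :=
  [/\ L_half u,
      mu.-integrable setT (fun x => (expR (u x))%:E) &
      forall psi g : R -> R,
        test_function_off0 psi -> is_half_laplacian psi g ->
        \int[mu]_x (u x * g x) = - \int[mu]_x (expR (u x) * psi x)].

End DimensionOne.

Section DimensionTwo.
Context {R : realType}.

Notation lebesgue2 := (@lebesgue_measure R \x @lebesgue_measure R)%E.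

Definition locally_integrable2 (u : R * R -> R) : Prop :=
  measurable_fun setT u /\
  forall K : set (R * R), compact K ->
    (\int[lebesgue2]_(x in K) `|u x|%:E < +oo)%E.

Definition laplacian (psi : R * R -> R) (x : R * R) : R :=
  'D_((1, 0) : R * R) ('D_((1, 0) : R * R) psi) x +
  'D_((0, 1) : R * R) ('D_((0, 1) : R * R) psi) x.

Definition is_solution2 (u : R * R -> R) : Prop :=
  [/\ locally_integrable2 u,
      lebesgue2.-integrable setT (fun x => (expR (2 * u x))%:E) &
      forall psi : R * R -> R,
        test_function_off0 psi ->
        \int[lebesgue2]_x (u x * - laplacian psi x) =
        - \int[lebesgue2]_x (expR (2 * u x) * psi x)].

End DimensionTwo.

(* Main.v *)
From HB Require Import structures.
Require Import Defs.
From mathcomp Require Import all_boot all_order all_algebra.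
From mathcomp Require Import all_classical all_reals all_analysis.
From mathcomp Require Import complex measurable_realfun.
From mathcomp Require Import ring lra.
Set Implicit Arguments.
Unset Strict Implicit.
Unset Printing Implicit Defensive.
Import Order.TTheory GRing.Theory Num.Theory.
Import numFieldNormedType.Exports.
Local Open Scope classical_set_scope.
Local Open Scope ring_scope.

(** Write q = |x|^2 and t = ln q. The logarithm of |x| is annihilated by the
    operator (-Delta)^(n/2) away from the origin, so V = n u + n ln |x| satisfies
    the same equation as n u there, and exp V dx / |x|^n = exp (n u) dx is a finite
    measure. Its density with respect to t is the mean of exp V over the sphere,
    up to a constant, and the sign of the equation makes the mean of V convex in
    t. But a convex function on the line cannot have an integrable exponential.

    To run this argument on weak solutions, and for n = 1 on a nonlocal operator,
    let F be a smooth convex ramp, equal to 0 for t <= -1 and to t for t >= 1, and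
    test the equation against the nonnegative radial function with profile
    tent F L t = L F(t / L) - F(t). Up to a positive factor the operator maps it
    to N - P_L, where N and P_L are nonnegative densities, attached to F and to
    its dilate L F(t / L); they have the same mass m > 0 and the same logarithmic
    moment, and |x|^n P_L is O(1/L). The equation then says that the integral of
    V N is at most that of V P_L. Since v <= L exp v - ln L - 1, the latter is at
    most a constant minus m ln L, which is absurd for large L: this is log_blowup.

    In the plane P_L is F_L''(t) / q up to a constant (laplacian_radial), and the
    masses and moments agree because such densities are divergences
    (plane_integral0).

    On the line the half Laplacian of the test function is the integral of its
    second differences (is_half_laplacian_hlap, by Fourier transform). For a step
    h = x s the points x + h and x - h become t + lg (1 + s) and t + lg (1 - s).
    Expanding the profile at t, the first order terms integrate to 0, because the
    half Laplacian of the logarithm vanishes (klog_integral), and the remainders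
    are Bregman divergences of F and F_L, which are nonnegative by convexity and
    at most a constant over L for F_L: this gives P_L as a Bregman density
    (hlap_bregman). The masses agree because the symbol |xi| vanishes at 0, the
    moments by exchanging the integrals in x and s (hlap_lg_moment), where
    klog_integral applies again. *)

(** * Smoothness on open sets *)

Section SmoothOn.
Context {R : realType}.

(** The class of functions that are k times continuously differentiable at the
    points of U. Localising is_Ck allows glueing, and composition with functions
    such as the logarithm that are smooth on part of the line only. *)
Fixpoint CkOn {V : normedModType R} (U : set V) (k : nat) (f : V -> R) : Prop :=
  (forall x, U x -> {for x, continuous f}) /\
  if k is k'.+1 then
    forall v : V, (forall x, U x -> derivable f x v) /\ CkOn U k' ('D_v f)
  else True.

Lemma CkOn_setT {V : normedModType R} k (f : V -> R) : CkOn setT k f -> is_Ck k f.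
Proof.
elim: k f => [|k IH] f /= [cf df]; first by split=> // x; exact: cf.
split; first by move=> x; exact: cf.
by move=> v; split; [move=> x; exact: (df v).1|exact: IH (df v).2].
Qed.

Lemma CkOn_S {V : normedModType R} (U : set V) k f : CkOn U k.+1 f -> CkOn U k f.
Proof.
elim: k f => [|k IH] f; first by move=> [].
move=> [cf df]; split=> // v; have [d1 d2] := df v.
by split=> //; exact: IH.
Qed.

Lemma CkOn_cont {V : normedModType R} (U : set V) k f x : CkOn U k f -> U x ->
  {for x, continuous f}.
Proof. by case: k => [|k] [cf _] Ux; exact: cf. Qed.

Lemma continuous_near_eq {V : normedModType R} (f g : V -> R) x :
  (\forall y \near x, f y = g y) -> {for x, continuous f} ->
  {for x, continuous g}.
Proof.
move=> fg; rewrite /prop_for /continuous_at -(nbhs_singleton fg) => h.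
by apply: cvg_trans h; exact: near_eq_cvg.
Qed.

Lemma CkOn_ext {V : normedModType R} (U : set V) k f g : open U ->
  (forall x, U x -> f x = g x) -> CkOn U k f -> CkOn U k g.
Proof.
move=> oU; elim: k f g => [|k IH] f g fg.
  move=> [cf _]; split=> // x Ux; apply: continuous_near_eq (cf _ Ux).
  exact: filterS (open_nbhs_nbhs (conj oU Ux)).
move=> [cf df].
have near x : U x -> \forall y \near x, f y = g y.
  by move=> Ux; apply: filterS (open_nbhs_nbhs (conj oU Ux)) => y /fg.
split.
  by move=> x Ux; apply: continuous_near_eq (cf _ Ux); exact: near.
move=> v; have [d1 d2] := df v; split.
  by move=> x Ux; apply: near_eq_derivable (d1 _ Ux); exact: near.
by apply: IH d2 => x Ux; exact/near_eq_derive/near.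
Qed.

Lemma CkOn_setU {V : normedModType R} (U W : set V) k f :
  CkOn U k f -> CkOn W k f -> CkOn (U `|` W) k f.
Proof.
elim: k f => [|k IH] f [cf df] [cg dg]; split=> //.
- by move=> x []; [exact: cf|exact: cg].
- by move=> x []; [exact: cf|exact: cg].
- move=> v; have [d1 d2] := df v; have [e1 e2] := dg v; split; last exact: IH.
  by move=> x []; [exact: d1|exact: e1].
Qed.

(** Introduction rule in terms of a computed candidate for each derivative. *)
Lemma CkOn_succ {V : normedModType R} (U : set V) k (f : V -> R)
    (df : V -> V -> R) : open U ->
  (forall x, U x -> {for x, continuous f}) ->
  (forall v x, U x -> is_derive x v f (df v x)) ->
  (forall v, CkOn U k (df v)) -> CkOn U k.+1 f.
Proof.
move=> oU cf fdf dfk; split=> // v; split=> [x /(fdf v)[]//|].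
by apply: CkOn_ext (dfk v) => // x /(fdf v)[].
Qed.

Lemma CkOn_cst {V : normedModType R} (U : set V) k c :
  open U -> CkOn U k (fun _ => c).
Proof.
move=> oU; elim: k c => [|k IH] c; first by split=> // x _; exact: cvg_cst.
apply: (CkOn_succ (df := fun _ _ => 0)) => //.
by move=> x _; exact: cvg_cst.
Qed.

Lemma CkOnD {V : normedModType R} (U : set V) k f g : open U ->
  CkOn U k f -> CkOn U k g -> CkOn U k (fun x => f x + g x).
Proof.
move=> oU; elim: k f g => [|k IH] f g [cf df] [cg dg].
  by split=> // x Ux; apply: cvgD; [exact: cf|exact: cg].
apply: (CkOn_succ (df := fun v x => 'D_v f x + 'D_v g x)) => //.
- by move=> x Ux; apply: cvgD; [exact: cf|exact: cg].
- move=> v x Ux; have [d1 _] := df v; have [e1 _] := dg v.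
  by apply: is_deriveD; apply: derivableP; [exact: d1|exact: e1].
- by move=> v; apply: IH; [exact: (df v).2|exact: (dg v).2].
Qed.

Lemma CkOnM {V : normedModType R} (U : set V) k f g : open U ->
  CkOn U k f -> CkOn U k g -> CkOn U k (fun x => f x * g x).
Proof.
move=> oU; elim: k f g => [|k IH] f g Cf Cg.
  case: Cf Cg => [cf _] [cg _].
  by split=> // x Ux; apply: cvgM; [exact: cf|exact: cg].
have [cf df] := Cf; have [cg dg] := Cg.
apply: (CkOn_succ (df := fun v x => f x * 'D_v g x + g x * 'D_v f x)) => //.
- by move=> x Ux; apply: cvgM; [exact: cf|exact: cg].
- move=> v x Ux; have [d1 _] := df v; have [e1 _] := dg v.
  by apply: is_deriveM; apply: derivableP; [exact: d1|exact: e1].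
- move=> v; apply: CkOnD => //; apply: IH; first exact: CkOn_S.
  + exact: (dg v).2.
  + exact: CkOn_S.
  + exact: (df v).2.
Qed.

Lemma CkOnV {V : normedModType R} (U : set V) k f : open U ->
  (forall x, U x -> f x != 0) -> CkOn U k f -> CkOn U k (fun x => (f x)^-1).
Proof.
move=> oU f0; elim: k f f0 => [|k IH] f f0 Cf.
  by case: Cf => [cf _]; split=> // x Ux; apply: cvgV; [exact: f0|exact: cf].
have [cf df] := Cf.
apply: (CkOn_succ
  (df := fun v x => (-1) * (((f x)^-1 * (f x)^-1) * 'D_v f x))) => //.
- by move=> x Ux; apply: cvgV; [exact: f0|exact: cf].
- move=> v x Ux; have [d1 _] := df v.
  have d := derivableP (d1 _ Ux).
  apply: DeriveDef; first by apply: derivableV; [exact: f0|exact: d1].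
  rewrite deriveV; [|exact: f0|exact: d1].
  by rewrite expr2 invfM mulN1r scaleNr.
- move=> v; apply: CkOnM => //; first exact: CkOn_cst.
  apply: CkOnM => //; last exact: (df v).2.
  by apply: CkOnM => //; apply: IH => //; exact: CkOn_S.
Qed.

Lemma is_derive_comp_dir {V : normedModType R} (G : R -> R) (f : V -> R) x v a b :
  is_derive x v f b -> is_derive (f x) 1 G a -> is_derive x v (G \o f) (a * b).
Proof.
move=> [df <-] dG.
have E (h : V -> R) : 'D_v h x = 'D_1 (fun t : R => h (t *: v + x)) 0.
  rewrite /derive; congr (lim (_ @ 0^')).
  by apply/funext => t /=; rewrite addr0 scale0r add0r [_%:A]mulr1.
have dfx : is_derive (0 : R) 1 (fun t : R => f (t *: v + x)) ('D_v f x).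
  by rewrite E; apply: derivableP; exact: (derivable1P f x v).1 df.
have dG' : is_derive (f (0 *: v + x)) 1 G a by rewrite scale0r add0r.
have [d1 d2] := is_derive1_comp dG' dfx.
by apply: DeriveDef; [exact: (derivable1P _ x v).2 d1|rewrite E].
Qed.

Lemma CkOn_comp {V : normedModType R} (U : set V) (W : set R) k
    (f : V -> R) (G : R -> R) : open U -> open W ->
  (forall x, U x -> W (f x)) -> CkOn U k f -> CkOn W k G -> CkOn U k (G \o f).
Proof.
move=> oU oW fW; elim: k G => [|k IH] G Cf CG.
  split=> // x Ux; apply: continuous_comp; first exact: CkOn_cont Cf Ux.
  by apply: CkOn_cont CG _; exact: fW.
have [cf df] := Cf; have [cG dG] := CG.
apply: (CkOn_succ (df := fun v x => 'D_1 G (f x) * 'D_v f x)) => //.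
- move=> x Ux; apply: continuous_comp; first exact: cf.
  by apply: cG; exact: fW.
- move=> v x Ux; have [d1 _] := df v; have [e1 _] := dG 1.
  apply: is_derive_comp_dir; apply: derivableP; first exact: d1.
  by apply: e1; exact: fW.
- move=> v; apply: CkOnM => //; last exact: (df v).2.
  by apply: (IH ('D_1 G)); [exact: CkOn_S|exact: (dG 1).2].
Qed.

(** On the line the derivative in direction 1 determines all the others. *)
Lemma CkOn_succ1 (U : set R) k (f g : R -> R) : open U ->
  (forall x, U x -> is_derive x 1 f (g x)) ->
  CkOn U k g -> CkOn U k.+1 f.
Proof.
move=> oU fg Cg.
apply: (@CkOn_succ _ U k f (fun v x => v * g x)) => //.
- move=> x Ux; apply/differentiable_continuous/derivable1_diffP.
  by have [] := fg _ Ux.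
- move=> v x Ux; have [/derivable1_diffP d1 <-] := fg _ Ux.
  apply: DeriveDef; first exact: diff_derivable.
  rewrite !deriveE// -[X in 'd f x X = _]mulr1.
  by rewrite [LHS]linearZ.
- by move=> v; apply: CkOnM => //; exact: CkOn_cst.
Qed.

Lemma CkOn_id (U : set R) k : open U -> CkOn U k (fun x : R => x).
Proof.
move=> oU; case: k => [|k]; first by split=> // x _; exact: cvg_id.
apply: (@CkOn_succ1 U k _ (fun=> 1)) => //; exact: CkOn_cst.
Qed.

Lemma CkOn_ln k : CkOn [set x : R | 0 < x] k (@ln R).
Proof.
have oU : open [set x : R | 0 < x] by exact: open_gt.
have {}dln x : [set x : R | 0 < x] x -> is_derive x 1 (@ln R) x^-1.
  exact: is_derive1_ln.
apply: CkOn_S; apply: (CkOn_succ1 oU dln).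
apply: CkOnV => //; first by move=> x /lt0r_neq0.
exact: CkOn_id.
Qed.

End SmoothOn.

(** * A smooth convex ramp *)

Section Flat.
Context {R : realType}.

Lemma poly_le_expR (p : {poly R}) (a : R) : 0 < a ->
  exists C, forall y, 0 <= y -> `|p.[y]| <= C * expR (a * y).
Proof.
move: a; elim/poly_ind: p => [|p c IH] a a0.
  by exists 0 => y _; rewrite horner0 normr0 mul0r.
have a20 : 0 < a / 2 by rewrite divr_gt0.
have [C HC] := IH _ a20.
exists (C * (a / 2)^-1 + `|c|) => y y0.
rewrite hornerMXaddC (le_trans (ler_normD _ _))// mulrDl lerD//; last first.
  by rewrite ler_peMr// -expR0 ler_expR mulr_ge0// ltW.
rewrite normrM (ger0_norm y0).
have -> : a * y = (a / 2 * y) + (a / 2 * y) by field.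
rewrite expRD.
have -> : C * (a / 2)^-1 * (expR (a / 2 * y) * expR (a / 2 * y)) =
  (C * expR (a / 2 * y)) * ((a / 2)^-1 * expR (a / 2 * y)) by ring.
apply: ler_pM => //; first exact: HC.
rewrite -ler_pdivrMl ?invr_gt0// invrK.
by rewrite (le_trans _ (expR_ge1Dx _))// lerDr.
Qed.

(** The functions p(1/x) exp(-1/x), extended by 0: this family is stable under
    differentiation, hence consists of smooth functions. *)
Definition flat (p : {poly R}) (x : R) : R :=
  if 0 < x then p.[x^-1] * expR (- x^-1) else 0.

Lemma flatX p x : flat p x = flat (p * 'X) x * x.
Proof.
rewrite /flat; case: ifPn => [x0|]; last by rewrite mul0r.
by rewrite hornerMX; field; exact: lt0r_neq0.
Qed.

Lemma flat0 p : flat p 0 = 0. Proof. by rewrite /flat ltxx. Qed.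

Lemma flat_bounded p : exists C, forall x, `|flat p x| <= C.
Proof.
have [C HC] := poly_le_expR p (@ltr01 R).
have C0 : 0 <= C.
  by have := HC 0 (lexx _); rewrite mulr0 expR0 mulr1; apply: le_trans.
exists C => x; rewrite /flat; case: ifPn => [x0|_]; last by rewrite normr0.
rewrite normrM (ger0_norm (expR_ge0 _)) expRN ler_pdivrMr ?expR_gt0//.
by rewrite -[X in expR X]mul1r; apply: HC; rewrite invr_ge0 ltW.
Qed.

Lemma flat_continuous0 p : {for 0, continuous (flat p)}.
Proof.
rewrite /prop_for /continuous_at flat0.
have [C HC] := flat_bounded (p * 'X).
have C0 : 0 <= C by exact: le_trans (normr_ge0 _) (HC 0).
apply/cvgr0Pnorm_le => e e0.
near=> x.
rewrite flatX normrM (le_trans (ler_wpM2r _ (HC x)))//.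
have : `|x| <= e / (C + 1).
  near: x; apply: (@cvgr0_norm_le _ _ _ _ _ id) => //.
  by rewrite divr_gt0// ltr_wpDl.
rewrite ler_pdivlMr ?ltr_wpDl// => xe.
by rewrite (le_trans _ xe)// mulrC ler_wpM2l// lerDl.
Unshelve. all: by end_near. Qed.

Lemma is_derive_flat (p : {poly R}) (x : R) :
  is_derive x 1 (flat p) (flat ('X^2 * (p - deriv p)) x).
Proof.
have [x0|x0|->] := ltrgt0P x.
- apply: (@near_eq_is_derive _ R R
    (fun y : R => p.[y^-1] * expR (- y^-1))).
    near=> y; rewrite /flat ifT//; near: y.
    exact: lt_nbhsr.
  have dV : is_derive x 1 (fun y : R => y^-1) (- x^-2).
    apply: is_derive_eq; first exact: is_deriveV (lt0r_neq0 x0) (is_derive_id x 1).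
    by rewrite scaler1.
  have dp : is_derive (x^-1) 1 (horner p) ((deriv p).[x^-1]).
    apply: DeriveDef; first exact: derivable_horner.
    by rewrite -derive1E -derivE.
  have d1 := is_derive1_comp dp dV.
  have dN : is_derive x 1 (fun y : R => - y^-1) (- - x ^- 2) by exact: is_deriveN.
  have d2 := @is_derive1_comp _ expR (fun y : R => - y^-1) x _ _
    (is_derive_expR (- x^-1)) dN.
  apply: (is_derive_eq (is_deriveM d1 d2)).
  rewrite /flat x0 !hornerE /=.
  by rewrite /GRing.scale/=; field; exact: lt0r_neq0.
- apply: (@near_eq_is_derive _ R R (cst 0)).
    near=> y; rewrite /flat ifF//; apply/negbTE; rewrite -leNgt ltW//; near: y.
    exact: lt_nbhsl.
  by rewrite /flat ltNge (ltW x0)/=; exact: is_derive_cst.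
(* At 0 the slope function is flat (p * 'X), which is continuous there. *)
- rewrite flat0; apply/is_derive1_caratheodory; exists (flat (p * 'X)).
  by split; [move=> z; rewrite flat0 !subr0 flatX|exact: flat_continuous0|exact: flat0].
Unshelve. all: by end_near. Qed.

Lemma flat_smooth k p : CkOn setT k (flat p).
Proof.
apply: CkOn_S; elim: k p => [|k IH] p.
  apply: (CkOn_succ1 (openT) (fun x _ => is_derive_flat p x)); split=> // x _.
  apply/differentiable_continuous/derivable1_diffP.
  by have [] := is_derive_flat ('X^2 * (p - deriv p)) x.
apply: (CkOn_succ1 (openT) (fun x _ => is_derive_flat p x)); exact: IH.
Qed.

End Flat.

Section RealDerivatives.
Context {R : realType}.
Implicit Types f df : R -> R.

Lemma is_derive_continuous f (x a : R) : is_derive x 1 f a ->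
  {for x, continuous f}.
Proof. by move=> [/derivable1_diffP df _]; exact: differentiable_continuous. Qed.

Lemma is_deriveW (f g : R -> R) (x a b : R) :
  is_derive x 1 f a -> f =1 g -> a = b -> is_derive x 1 g b.
Proof. by move=> d /funext <- <-. Qed.

Lemma MVT_global f df (a b : R) : (forall x : R, is_derive x 1 f (df x)) ->
  a <= b -> exists2 c, a <= c <= b & f b - f a = df c * (b - a).
Proof.
move=> fdf; rewrite le_eqVlt => /predU1P[<-|ab].
  by exists a; rewrite ?lexx// !subrr mulr0.
have [|c cab E] := @MVT R f df a b ab (fun x _ => fdf x).
  apply: continuous_subspaceT => x; exact: is_derive_continuous (fdf x).
by exists c => //; move: cab; rewrite in_itv/= => /andP[/ltW -> /ltW ->].
Qed.

Lemma ge0_derive_ndecr f df : (forall x : R, is_derive x 1 f (df x)) ->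
  (forall x, 0 <= df x) -> {homo f : x y / x <= y}.
Proof.
move=> fdf df0 x y xy; rewrite -subr_ge0.
have [c _ ->] := MVT_global fdf xy.
by rewrite mulr_ge0// subr_ge0.
Qed.

Lemma is_derive_affine f (a k x d : R) : is_derive (a * x + k) 1 f d ->
  is_derive x 1 (fun t => f (a * t + k)) (d * a).
Proof.
move=> fd; apply: (@is_derive1_comp _ f (fun t : R => a * t + k) x d a fd).
apply: (is_derive_eq (is_deriveD (is_deriveZ a (is_derive_id x (1 : R)))
   (is_derive_cst k x 1))).
by rewrite addr0 /GRing.scale/= mulr1.
Qed.

Lemma compact_support_bounded (f : R -> R) (rho : R) : continuous f ->
  (forall x, rho < `|x| -> f x = 0) -> exists K, forall x, `|f x| <= K.
Proof.
move=> cf f0.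
have [||c _ H] := @EVT_max R (fun t => `|f t|) (- `|rho|) `|rho|.
- by rewrite -subr_ge0 opprK addr_ge0.
- apply: continuous_subspaceT => t.
  by apply: (@continuous_comp _ _ _ f (fun y : R => `|y|));
    [exact: cf|exact: norm_continuous].
exists `|f c| => t; have [tM|tM] := lerP `|t| `|rho|.
  by apply: H; rewrite in_itv/= -ler_norml.
by rewrite f0 ?normr0//; exact: le_lt_trans (ler_norm _) tM.
Qed.

End RealDerivatives.

Section Ramp.
Context {R : realType}.

Let e : R -> R := flat 1.
Let e' : R -> R := flat 'X^2.

Let is_derive_e (x : R) : is_derive x 1 e (e' x).
Proof.
apply: (is_derive_eq (is_derive_flat 1 x)).
by rewrite derivC subr0 mulr1.
Qed.

Let e_gt0 x : 0 < x -> 0 < e x.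
Proof. by move=> x0; rewrite /e /flat x0 hornerC mul1r expR_gt0. Qed.

Let e_ge0 x : 0 <= e x.
Proof. by rewrite /e /flat; case: ifP => // _; rewrite hornerC mul1r expR_ge0. Qed.

Let e'_ge0 x : 0 <= e' x.
Proof.
rewrite /e' /flat; case: ifP => // x0.
by rewrite hornerXn mulr_ge0 ?expR_ge0// exprn_ge0// invr_ge0 ltW.
Qed.

Let den t := e (1 * t + 1) + e ((-1) * t + 1).

Let den_gt0 t : 0 < den t.
Proof.
rewrite /den mul1r mulN1r; have [t0|t0] := lerP 0 t.
  by rewrite ltr_pwDl// e_gt0// addrC ltr_wpDr.
by rewrite ltr_wpDl// e_gt0// addrC ltr_wpDr// oppr_ge0 ltW.
Qed.

(** The spelling 1 * t + 1 and (-1) * t + 1 of the arguments is the affine form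
    of is_derive_affine. *)
Definition step (t : R) : R := flat 1 (1 * t + 1) * (flat 1 (1 * t + 1) + flat 1 ((-1) * t + 1))^-1.

Definition dstep (t : R) : R :=
  (flat 'X^2 (1 * t + 1) * flat 1 ((-1) * t + 1) +
   flat 1 (1 * t + 1) * flat 'X^2 ((-1) * t + 1)) *
  ((flat 1 (1 * t + 1) + flat 1 ((-1) * t + 1))^-1) ^+ 2.

Lemma is_derive_step (t : R) : is_derive t 1 step (dstep t).
Proof.
have d1 := is_derive_affine (is_derive_e (1 * t + 1)).
have d2 := is_derive_affine (is_derive_e (-1 * t + 1)).
have den0 : den t != 0 by rewrite gt_eqF.
have d3 := is_deriveD d1 d2.
have d4 := is_deriveV (f := den) den0 d3.
apply: (is_derive_eq (is_deriveM d1 d4)).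
rewrite /dstep -/e -/e' -/(den t) /GRing.scale /=.
by rewrite -/(den t) /den in den0 *; field.
Qed.

Lemma dstep_ge0 t : 0 <= dstep t.
Proof.
by apply: mulr_ge0; rewrite ?sqr_ge0// addr_ge0// mulr_ge0//; (exact: e_ge0 || exact: e'_ge0).
Qed.

Let flat_le0 p x : x <= 0 -> flat p x = 0 :> R.
Proof. by move=> x0; rewrite /flat ltNge x0. Qed.

Lemma step_le t : t <= -1 -> step t = 0.
Proof. by move=> t1; rewrite /step flat_le0 ?mul0r//; lra. Qed.

Lemma stepN t : step t + step (- t) = 1.
Proof.
rewrite /step -/e; have := den_gt0 t; rewrite /den.
have -> : 1 * - t + 1 = -1 * t + 1 by ring.
have -> : -1 * - t + 1 = 1 * t + 1 by ring.
by rewrite [e (-1 * t + 1) + _]addrC -mulrDl => /lt0r_neq0 H; rewrite divff.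
Qed.

Lemma dstep_eq0 t : 1 <= `|t| -> dstep t = 0.
Proof.
rewrite ler_normr => /orP[] t1; rewrite /dstep.
  by rewrite !(flat_le0 _ (x := -1 * t + 1)); [rewrite !mulr0 addr0 mul0r|lra|lra].
by rewrite !(flat_le0 _ (x := 1 * t + 1)); [rewrite !mul0r addr0 mul0r|lra|lra].
Qed.

Lemma flat_affine_smooth k p (a c : R) : CkOn setT k (fun t => flat p (a * t + c)).
Proof.
apply: (@CkOn_comp _ _ setT setT k (fun t : R => a * t + c) (flat p)) => //;
  try exact: openT; last exact: flat_smooth.
apply: CkOnD; [exact: openT| |exact: CkOn_cst openT].
apply: CkOnM; [exact: openT|exact: CkOn_cst openT|exact: CkOn_id openT].
Qed.

Lemma step_smooth k : CkOn setT k step.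
Proof.
apply: CkOnM; [exact: openT|exact: flat_affine_smooth|].
apply: CkOnV; [exact: openT|by move=> t _; exact: lt0r_neq0 (den_gt0 t)|].
by apply: CkOnD; [exact: openT| |]; exact: flat_affine_smooth.
Qed.

Lemma dstep_continuous : continuous dstep.
Proof.
have [_ /(_ 1)[_ [h _]]] := step_smooth 1.
move=> t; apply: continuous_near_eq (h t I).
by near=> s; have [_ ->] := is_derive_step s.
Unshelve. all: by end_near. Qed.

Lemma dstep_bounded : exists2 B, 0 < B & forall t, dstep t <= B.
Proof.
have [||c _ H] := @EVT_max R dstep (-1) 1; first lra.
  by apply: continuous_subspaceT; exact: dstep_continuous.
exists (dstep c + 1) => [|t]; first by rewrite ltr_wpDl// dstep_ge0.
have [t1|/ltW t1] := lerP `|t| 1; last by rewrite dstep_eq0// addr_ge0// dstep_ge0.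
by rewrite ler_wpDr// H// in_itv/= -ler_norml.
Qed.

End Ramp.

(** Smooth convex functions that are 0 near minus infinity and the identity near
    plus infinity, with second derivative b at most B. *)
Record ramp {R : realType} (a B : R) (F f b : R -> R) : Prop := {
  ramp_smooth : forall k, CkOn setT k F;
  ramp_d1 : forall t : R, is_derive t 1 F (f t);
  ramp_d2 : forall t : R, is_derive t 1 f (b t);
  ramp_ge0 : forall t, 0 <= b t;
  ramp_le : forall t, b t <= B;
  ramp_lo : forall t, t <= - a -> F t = 0;
  ramp_hi : forall t, a <= t -> F t = t }.

Section RampTheory.
Context {R : realType}.
Notation mu := (@lebesgue_measure R).

Let F (t : R) : R := \int[mu]_(s in `[(-2), t]) step s.

Let step_int (a b : R) : mu.-integrable `[a, b] (EFin \o step).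
Proof.
apply: continuous_compact_integrable; first exact: segment_compact.
apply: continuous_subspaceT => t; exact: is_derive_continuous (is_derive_step t).
Qed.

Let F_le (t : R) : t <= -1 -> F t = 0.
Proof.
move=> t1; rewrite /F (@eq_Rintegral _ _ _ _ _ (cst 0)).
  by rewrite /Rintegral integral0.
move=> s; rewrite inE/= in_itv/= => /andP[_ st].
by rewrite step_le// (le_trans st).
Qed.

Let is_derive_F (t : R) : is_derive t 1 F (step t).
Proof.
have [t1|t1] := ltrP t (-1).
  rewrite step_le ?ltW//; apply: (@near_eq_is_derive _ R R (cst 0)).
    near=> s; rewrite F_le// ltW//; near: s; exact: lt_nbhsl.
have [|||d1 d2] := @continuous_FTC1_closed R step (-2) t (t + 1) _ (step_int _ _).
- by rewrite ltrDl.
- by rewrite (lt_le_trans _ t1)//; lra.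
- exact: is_derive_continuous (is_derive_step t).
by split; [exact: d1|rewrite -derive1E; exact: d2].
Unshelve. all: by end_near. Qed.

(** By the symmetry of step, its primitive is the identity to the right of 1, and
    not merely a translate of it. *)
Let F_odd (t : R) : F t - F (- t) = t.
Proof.
have d (s : R) : is_derive s 1 (fun s => F s - F (-1 * s + 0) - s) 0.
  have d1 := is_derive_affine (is_derive_F (-1 * s + 0)).
  apply: (is_derive_eq (is_deriveB (is_deriveB (is_derive_F s) d1) (is_derive_id s 1))).
  by have := stepN s; rewrite addr0 mulN1r mulrN1; lra.
have := is_derive_0_is_cst t 0 d.
by rewrite !mulr0 !addr0 !subr0 subrr mulN1r => /eqP; rewrite subr_eq0 => /eqP.
Qed.

Lemma exists_ramp : exists B F f b, 0 < B /\ @ramp R 1 B F f b.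
Proof.
have [B B0 HB] := @dstep_bounded R.
exists B, F, step, dstep; split=> //; split => //.
- move=> k; apply: CkOn_S.
  by apply: (CkOn_succ1 openT (fun x _ => is_derive_F x)); exact: step_smooth.
- exact: is_derive_step.
- exact: dstep_ge0.
- by move=> t t1; rewrite -[RHS](F_odd t) (F_le (t := - t)) ?subr0// lerN2.
Qed.

Section Given.
Variables (a B : R) (G g b : R -> R).
Hypothesis rG : ramp a B G g b.

Lemma ramp_smooth_d1 k : CkOn setT k g.
Proof.
have [_ /(_ 1)[_ h]] := ramp_smooth rG k.+1.
apply: CkOn_ext h; first exact: openT.
by move=> t _; have [_ ->] := ramp_d1 rG t.
Qed.

Lemma ramp_smooth_d2 k : CkOn setT k b.
Proof.
have [_ /(_ 1)[_ h]] := ramp_smooth_d1 k.+1.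
apply: CkOn_ext h; first exact: openT.
by move=> t _; have [_ ->] := ramp_d2 rG t.
Qed.

Lemma ramp_d1_lo t : t < - a -> g t = 0.
Proof.
move=> ta; have [_ <-] := ramp_d1 rG t.
rewrite (near_eq_derive (g := cst (0 : R))) ?derive_cst//.
near=> s; rewrite (ramp_lo rG)// ltW//; near: s; exact: lt_nbhsl.
Unshelve. all: by end_near. Qed.

Lemma ramp_d1_hi t : a < t -> g t = 1.
Proof.
move=> ta; have [_ <-] := ramp_d1 rG t.
rewrite (near_eq_derive (g := id)) ?derive_id//.
near=> s; rewrite (ramp_hi rG)// ltW//; near: s; exact: lt_nbhsr.
Unshelve. all: by end_near. Qed.

Lemma ramp_d2_out t : a < `|t| -> b t = 0.
Proof.
rewrite ltr_normr ltrNr; have [_ <-] := ramp_d2 rG t; move=> /orP[] ta.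
  rewrite (near_eq_derive (g := cst (1 : R))) ?derive_cst//.
  near=> s; rewrite ramp_d1_hi//; near: s; exact: lt_nbhsr.
rewrite (near_eq_derive (g := cst (0 : R))) ?derive_cst//.
near=> s; rewrite ramp_d1_lo//; near: s; exact: lt_nbhsl.
Unshelve. all: by end_near. Qed.

Lemma ramp_d1_ndecr : {homo g : x y / x <= y}.
Proof. exact: ge0_derive_ndecr (ramp_d2 rG) (ramp_ge0 rG). Qed.

Lemma ramp_d1_ge0 t : 0 <= g t.
Proof.
have [ta|ta] := ltrP t (- a); first by rewrite ramp_d1_lo.
rewrite -(ramp_d1_lo (t := - a - 1)); last by lra.
by apply: ramp_d1_ndecr; lra.
Qed.

Lemma ramp_ndecr : {homo G : x y / x <= y}.
Proof. exact: ge0_derive_ndecr (ramp_d1 rG) ramp_d1_ge0. Qed.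

Lemma ramp_ge0_val t : 0 <= G t.
Proof.
have [ta|ta] := lerP t (- a); first by rewrite (ramp_lo rG).
by rewrite -(ramp_lo rG (lexx _)) ramp_ndecr// ltW.
Qed.

End Given.

Lemma ramp_scale (a B L : R) (G g b : R -> R) : 0 < L -> ramp a B G g b ->
  ramp (a * L) (B / L) (fun t => L * G (t / L)) (fun t => g (t / L))
    (fun t => b (t / L) / L).
Proof.
move=> L0 rG; have LN0 := lt0r_neq0 L0.
split.
- move=> k; apply: CkOnM; [exact: openT|exact: CkOn_cst openT|].
  apply: (@CkOn_comp _ _ setT setT k (fun t : R => t / L) G);
    [exact: openT|exact: openT|by []| |exact: ramp_smooth rG k].
  by apply: CkOnM; [exact: openT|exact: CkOn_id openT|exact: CkOn_cst openT].
- move=> t; have d := is_derive_affine (ramp_d1 rG (L^-1 * t + 0)).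
  apply: (is_deriveW (is_deriveZ L d)) => [s|].
    by rewrite /= addr0 [_ * s]mulrC.
  by rewrite addr0 [_ * t]mulrC /GRing.scale/= mulrC divfK.
- move=> t; have d := is_derive_affine (ramp_d2 rG (L^-1 * t + 0)).
  apply: (is_deriveW d) => [s|].
    by rewrite /= addr0 [_ * s]mulrC.
  by rewrite addr0 [_ * t]mulrC.
- by move=> t; rewrite divr_ge0 ?(ramp_ge0 rG)// ltW.
- by move=> t; rewrite ler_pM2r ?invr_gt0//; exact: ramp_le rG _.
- move=> t ta; rewrite (ramp_lo rG) ?mulr0//.
  by rewrite ler_pdivrMr// mulNr.
- move=> t ta; have h : a <= t / L by rewrite ler_pdivlMr.
  by rewrite (ramp_hi rG h) mulrC divfK.
Qed.

Lemma ramp_reflect (a B : R) (G g b : R -> R) : ramp a B G g b ->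
  ramp a B (fun t => G (- t) + t) (fun t => 1 - g (- t)) (fun t => b (- t)).
Proof.
move=> rG; split.
- move=> k; apply: CkOnD; [exact: openT| |exact: CkOn_id openT].
  apply: (@CkOn_comp _ _ setT setT k (fun t : R => - t) G);
    [exact: openT|exact: openT|by []| |exact: ramp_smooth rG k].
  apply: (@CkOn_ext _ _ setT k (fun t : R => (-1) * t)); first exact: openT.
    by move=> t _; rewrite mulN1r.
  by apply: CkOnM; [exact: openT|exact: CkOn_cst openT|exact: CkOn_id openT].
- move=> t; have d := is_derive_affine (ramp_d1 rG (-1 * t + 0)).
  apply: (is_deriveW (is_deriveD d (is_derive_id t (1 : R)))) => [s|].
    by rewrite -[LHS]/(G (-1 * s + 0) + s) addr0 mulN1r.
  by rewrite addr0 mulN1r mulrN1 addrC.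
- move=> t; have d := is_derive_affine (ramp_d2 rG (-1 * t + 0)).
  apply: (is_deriveW (is_deriveB (is_derive_cst (1 : R) t (1 : R)) d)) => [s|].
    by rewrite -[LHS]/(1 - g (-1 * s + 0)) addr0 mulN1r.
  by rewrite addr0 mulN1r mulrN1 opprK add0r.
- by move=> t; exact: ramp_ge0 rG _.
- by move=> t; exact: ramp_le rG _.
- by move=> t ta; rewrite (ramp_hi rG) ?addNr// lerNr.
- by move=> t ta; rewrite (ramp_lo rG) ?add0r// lerN2.
Qed.

(** Widening a ramp raises it: on the left by monotonicity, on the right by
    reflection. *)
Lemma ramp_le_scale (a B L : R) (G g b : R -> R) : 1 <= L -> ramp a B G g b ->
  forall t, G t <= L * G (t / L).
Proof.
move=> L1; have L0 : 0 < L by exact: lt_le_trans L1.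
have left F' f' b' s : ramp a B F' f' b' -> s <= 0 -> F' s <= L * F' (s / L).
  move=> rF s0; apply: (@le_trans _ _ (F' (s / L))).
    by apply: (ramp_ndecr rF); rewrite ler_pdivlMr//; nra.
  by rewrite ler_peMl// (ramp_ge0_val rF).
move=> rG t; have [t0|/ltW t0] := lerP t 0; first exact: left rG t0.
have := left _ _ _ (- t) (ramp_reflect rG); rewrite oppr_le0 => /(_ t0).
rewrite opprK mulNr opprK mulrDr mulrN [L * (t / L)]mulrC divfK ?gt_eqF//.
by rewrite lerD2r.
Qed.

End RampTheory.

(** * Radial test functions *)

Section Radial.
Context {R : realType}.

(** phi (ln q), extended by 0 to the half line where q <= 0. *)
Definition logcomp (phi : R -> R) (q : R) : R :=
  if 0 < q then phi (ln q) else 0.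

Variables (M : R) (phi : R -> R).
Hypothesis phi0 : forall t, M <= `|t| -> phi t = 0.

Lemma logcomp_small q : q <= expR (- M) -> logcomp phi q = 0.
Proof.
move=> qM; rewrite /logcomp; case: ifPn => // q0; apply: phi0.
by rewrite ler_normr; apply/orP; right; rewrite lerNr -ler_expR lnK.
Qed.

Lemma logcomp_large q : expR M <= q -> logcomp phi q = 0.
Proof.
move=> qM; rewrite /logcomp; case: ifPn => // q0; apply: phi0.
by rewrite ler_normr -[M <= ln q]ler_expR lnK// qM.
Qed.

(** Since phi vanishes near minus infinity, logcomp phi vanishes on an open set
    containing the half line q <= 0, and glues with phi \o ln. *)
Lemma logcomp_smooth k : CkOn setT k phi -> CkOn setT k (logcomp phi).
Proof.
move=> Cphi.
have oP : open [set q : R | 0 < q] by exact: open_gt.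
have oM : open [set q : R | q < expR (- M)] by exact: open_lt.
have -> : [set: R] = [set q : R | 0 < q] `|` [set q : R | q < expR (- M)].
  apply/seteqP; split=> // q _; have [q0|q0] := ltrP 0 q; [by left|right].
  exact: le_lt_trans q0 (expR_gt0 _).
apply: CkOn_setU.
  apply: (@CkOn_ext _ _ _ k (phi \o @ln R)) => //.
    by move=> q q0; rewrite /logcomp q0.
  apply: (@CkOn_comp _ _ _ setT k (@ln R) phi) => //; first exact: openT.
  exact: CkOn_ln.
apply: (@CkOn_ext _ _ _ k (fun=> 0)) => //; last exact: CkOn_cst.
by move=> q /ltW qM; rewrite logcomp_small.
Qed.

(** A profile supported in the interval from - M to M gives a function supported
    in the shell expR (- M) <= N x <= expR M. *)
Lemma test_function_radial {V : normedModType R} (N : V -> R) :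
  (forall k, CkOn setT k phi) ->
  (forall k, CkOn setT k N) -> N 0 = 0 ->
  (forall c, compact [set x | N x <= c]) ->
  test_function_off0 (logcomp phi \o N).
Proof.
move=> Cphi CN N0 cpt.
have cN : continuous N by move=> x; exact: CkOn_cont (CN 0%N) I.
have sub : supp (logcomp phi \o N) `<=`
    [set x | expR (- M) <= N x] `&` [set x | N x <= expR M].
  rewrite /supp closureEbigcap => y; apply; split.
    apply: closedI.
      apply: (closed_comp (f := N) (D := [set y | expR (- M) <= y])).
        by move=> x _; exact: cN.
      exact: closed_ge.
    apply: (closed_comp (f := N) (D := [set y | y <= expR M])).
      by move=> x _; exact: cN.
    exact: closed_le.
  move=> x /= H; split; rewrite leNgt; apply/negP => /ltW h; move: H.
    by rewrite logcomp_small// eqxx.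
  by rewrite logcomp_large// eqxx.
split.
- move=> k; apply: CkOn_setT.
  apply: (@CkOn_comp _ _ setT setT k N (logcomp phi)) => //; try exact: openT.
  exact: logcomp_smooth.
- apply: (subclosed_compact _ (cpt (expR M))); first exact: closed_closure.
  by move=> x /sub[].
- by move=> /sub[/=]; rewrite N0 leNgt expR_gt0.
Qed.

End Radial.

Section Instances.
Context {R : realType}.

Definition sqn (x : R) : R := x * x.
Definition sqn2 (x : R * R) : R := x.1 * x.1 + x.2 * x.2.

Lemma sqn_smooth k : CkOn setT k sqn.
Proof. by apply: CkOnM; [exact: openT|exact: CkOn_id openT|exact: CkOn_id openT]. Qed.

Lemma compact_sqn c : compact [set x | sqn x <= c].
Proof.
apply: (subclosed_compact _ (@segment_compact R (- (1 + `|c|)) (1 + `|c|))).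
  apply: (closed_comp (f := sqn) (D := [set y | y <= c])); last exact: closed_le.
  by move=> x _; exact: CkOn_cont (sqn_smooth 0%N) I.
move=> x /= xc; rewrite in_itv/= -ler_norml.
have x2 : `|x| * `|x| <= `|c|.
  by rewrite -normrM ger0_norm -?expr2 ?sqr_ge0//; exact: le_trans xc (ler_norm _).
by have := normr_ge0 x; nra.
Qed.

Lemma is_derive_linear {V : normedModType R} (f : V -> R) (x v : V) :
  (forall (h : R) v x, f (h *: v + x) = h * f v + f x) -> is_derive x v f (f v).
Proof.
move=> lf.
have cvgf : (fun h : R => h^-1 *: ((f \o shift x) (h *: v) - f x)) @ 0^' --> f v.
  apply: (@cvg_trans _ (cst (f v) @ 0^')); last exact: cvg_cst.
  apply: near_eq_cvg; near=> h => /=.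
  rewrite lf addrK /GRing.scale/= mulKf//; near: h; exact: nbhs_dnbhs_neq.
by split; [apply/cvg_ex; exists (f v)|exact/cvg_lim].
Unshelve. all: by end_near. Qed.

Lemma CkOn_linear {V : normedModType R} k (f : V -> R) : continuous f ->
  (forall (h : R) v x, f (h *: v + x) = h * f v + f x) -> CkOn setT k f.
Proof.
move=> cf lf; case: k => [|k]; first by split=> // x _; exact: cf.
apply: (@CkOn_succ _ _ setT k f (fun v _ => f v)); first exact: openT.
- by move=> x _; exact: cf.
- by move=> v x _; exact: is_derive_linear.
- by move=> v; exact: CkOn_cst openT.
Qed.

Lemma sqn2_smooth k : CkOn setT k sqn2.
Proof.
have C1 : CkOn setT k (fst : R * R -> R).
  by apply: CkOn_linear => [x|h v x //]; exact: cvg_fst.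
have C2 : CkOn setT k (snd : R * R -> R).
  by apply: CkOn_linear => [x|h v x //]; exact: cvg_snd.
by apply: CkOnD; [exact: openT| |]; apply: CkOnM => //; exact: openT.
Qed.

Lemma compact_sqn2 c : compact [set x | sqn2 x <= c].
Proof.
have K : compact ([set x | sqn x <= c] `*` [set x | sqn x <= c]).
  by apply: compact_setX; exact: compact_sqn.
apply: (subclosed_compact _ K).
  apply: (closed_comp (f := sqn2) (D := [set y | y <= c])); last exact: closed_le.
  by move=> x _; exact: CkOn_cont (sqn2_smooth 0%N) I.
move=> [x y] /= H; rewrite /sqn2 /= in H; rewrite /sqn; split=> /=;
  have := sqr_ge0 x; have := sqr_ge0 y; rewrite !expr2; lra.
Qed.

End Instances.

(** * Integration on the line *)

Section Line.
Context {R : realType}.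
Notation mu := (@lebesgue_measure R).

Section Affine.
Variables (a b : R).
Hypothesis a0 : a != 0.

Let aff (x : R) : R := a * x + b.

Let maff : measurable_fun [set: measurableTypeR R] (aff : _ -> measurableTypeR R).
Proof.
apply: measurable_realfun.measurable_funD; last exact: measurable_cst.
by apply: measurable_realfun.measurable_funM; [exact: measurable_cst|exact: measurable_id].
Qed.

Let preim_gt0 (c d : R) : 0 < a ->
  aff @^-1` `]c, d] = `](c - b) / a, (d - b) / a]%classic.
Proof.
move=> ap; apply/seteqP; split=> x /=;
  by rewrite !in_itv/= /aff ltr_pdivrMr// ler_pdivlMr// ltrBlDr lerBrDr mulrC.
Qed.

Let preim_lt0 (c d : R) : a < 0 ->
  aff @^-1` `]c, d] = `[(d - b) / a, (c - b) / a[%classic.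
Proof.
move=> an; apply/seteqP; split=> x /=;
  by rewrite !in_itv/= /aff ltr_ndivlMr// ler_ndivrMr// ltrBlDr lerBrDr andbC [_ * a]mulrC.
Qed.

Let scaled := mscale (`|a|%:nng)%R
  (measure_function_pushforward__canonical__measure_function_Measure mu maff).

Lemma lebesgue_affine (A : set R) : measurable A ->
  mu A = (`|a|%:E * mu (aff @^-1` A))%E.
Proof.
move=> mA; apply: (@lebesgue_measure_unique R scaled) => //= _ [[c d]] _ <- /=.
rewrite /scaled /mscale/= /pushforward.
have [ap|an] : 0 < a \/ a < 0 by have [] := ltrgt0P a; [left|right|move/eqP: a0].
  rewrite preim_gt0// !lebesgue_measure_itv/= !lte_fin (gtr0_norm ap).
  rewrite ltr_pM2r ?invr_gt0// ltrD2r.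
  case: ifPn => cd; last by rewrite mule0.
  by rewrite -!EFinD -EFinM; congr (_%:E); field.
rewrite preim_lt0// !lebesgue_measure_itv/= !lte_fin (ltr0_norm an).
rewrite ltr_nM2r ?invr_lt0// ltrD2r.
case: ifPn => cd; last by rewrite mule0.
by rewrite -!EFinD -EFinM; congr (_%:E); field.
Qed.

Lemma ge0_integral_affine (f : R -> \bar R) : measurable_fun [set: R] f ->
  (forall x, (0 <= f x)%E) ->
  (\int[mu]_x f x = `|a|%:E * \int[mu]_x f (a * x + b)%R)%E.
Proof.
move=> mf f0.
transitivity (\int[scaled]_x f x)%E.
  by apply: eq_measure_integral => A mA _; exact: lebesgue_affine.
rewrite /scaled ge0_integral_mscale//=.
by rewrite ge0_integral_pushforward// preimage_setT.
Qed.

Lemma integrable_affine (f : R -> R) : mu.-integrable setT (EFin \o f) ->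
  mu.-integrable setT (EFin \o (fun x => f (a * x + b))).
Proof.
move=> /integrableP[mf If]; apply/integrableP; split.
  by apply: (measurableT_comp mf maff).
move: If; rewrite ge0_integral_affine//; last exact: measurableT_comp.
have an : (0 < `|a|%:E)%E by rewrite lte_fin normr_gt0.
by move=> H; rewrite ltey; apply/eqP => E; move: H; rewrite /= E gt0_muley.
Qed.

Lemma Rintegral_affine (f : R -> R) : mu.-integrable setT (EFin \o f) ->
  \int[mu]_x f (a * x + b) = `|a|^-1 * \int[mu]_x f x.
Proof.
move=> If; have Iaf := integrable_affine If.
have mf := measurable_int _ If.
have Ep : (\int[mu]_x (EFin \o f)^\+ x =
    `|a|%:E * \int[mu]_x (EFin \o (fun x => f (a * x + b)%R))^\+ x)%E.
  rewrite ge0_integral_affine; [|exact: measurable_funepos|by []].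
  by congr (_ * _)%E; apply: eq_integral => x _; rewrite !funeposE.
have En : (\int[mu]_x (EFin \o f)^\- x =
    `|a|%:E * \int[mu]_x (EFin \o (fun x => f (a * x + b)%R))^\- x)%E.
  rewrite ge0_integral_affine; [|exact: measurable_funeneg|by []].
  by congr (_ * _)%E; apply: eq_integral => x _; rewrite !funenegE.
rewrite /Rintegral [in LHS]integralE [in RHS]integralE Ep En.
have := integrable_pos_fin_num measurableT Iaf.
have := integrable_neg_fin_num measurableT Iaf.
case: (integral _ _ _) => // n _; case: (integral _ _ _) => // p _.
by rewrite -!EFinM -!EFinB/= -mulrBr mulKf// normr_eq0.
Qed.

End Affine.

Lemma Rintegral_indic_co (c d : R) : c < d ->
  mu.-integrable setT (EFin \o (\1_(`[c, d[%classic) : R -> R)) /\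
  \int[mu]_x (\1_(`[c, d[%classic) x : R) = d - c.
Proof.
move=> cd; have E : (\int[mu]_x (\1_(`[c, d[%classic) x)%:E = (d - c)%:E)%E.
  by rewrite integral_indic// setIT /= lebesgue_measure_itv/= lte_fin cd -EFinB.
split; last by rewrite [LHS](congr1 fine E).
apply/integrableP; split; first exact/measurable_EFinP/measurable_indic.
under eq_integral do rewrite /= ger0_norm//.
by rewrite E ltry.
Qed.

End Line.

Section MeasurableBasics.
Context {R : realType}.

(** The line carries its Borel sets under two names: the one of the real numbers
    as a codomain, and the one on which the measure is defined. *)
Lemma measurable_line (f : R -> R) : measurable_fun [set: R] f ->
  measurable_fun [set: measurableTypeR R] f.
Proof. by []. Qed.

Lemma measurable_inv : measurable_fun [set: R] (fun x : R => x^-1).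
Proof.
have -> : [set: R] = [set 0] `|` ~` [set 0] by rewrite setUv.
apply/measurable_funU; [exact: measurable_set1|apply: measurableC; exact: measurable_set1|].
split.
  apply: (eq_measurable_fun (cst (0 : R))).
    by move=> x; rewrite inE/= => ->; rewrite invr0.
  exact: measurable_cst.
apply: open_continuous_measurable_fun; first exact/closed_openC/closed_eq.
by move=> x; rewrite inE => /eqP x0; exact: inv_continuous.
Qed.

Context d (T : measurableType d).
Implicit Types f g : T -> R.

Lemma measurable_funV f : measurable_fun setT f ->
  measurable_fun setT (fun x => (f x)^-1).
Proof. by move=> mf; exact: (measurableT_comp measurable_inv mf). Qed.

Lemma measurable_fun_div f g : measurable_fun setT f -> measurable_fun setT g ->
  measurable_fun setT (fun x => f x / g x).
Proof. by move=> mf mg; apply: measurable_funM mf (measurable_funV mg). Qed.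

Variable mu : {measure set T -> \bar R}.

Lemma integrable_dom f g : measurable_fun setT f ->
  (forall x, `|f x| <= g x) -> mu.-integrable setT (EFin \o g) ->
  mu.-integrable setT (EFin \o f).
Proof.
move=> mf fg; apply: le_integrable => //; first exact/measurable_EFinP.
by move=> x _ /=; rewrite lee_fin (le_trans (fg x))// ler_norm.
Qed.

Lemma intgD f g : mu.-integrable setT (EFin \o f) ->
  mu.-integrable setT (EFin \o g) ->
  mu.-integrable setT (EFin \o (fun x => f x + g x)).
Proof. by move=> If Ig; have := integrableD measurableT If Ig. Qed.

Lemma intgB f g : mu.-integrable setT (EFin \o f) ->
  mu.-integrable setT (EFin \o g) ->
  mu.-integrable setT (EFin \o (fun x => f x - g x)).
Proof. by move=> If Ig; have := integrableB measurableT If Ig. Qed.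

Lemma intgZ f k : mu.-integrable setT (EFin \o f) ->
  mu.-integrable setT (EFin \o (fun x => k * f x)).
Proof. by move=> If; have := integrableZl measurableT k If. Qed.

Lemma intg_norm f : mu.-integrable setT (EFin \o f) ->
  mu.-integrable setT (EFin \o (fun x => `|f x|)).
Proof. by move=> If; exact: integrable_norm. Qed.

Lemma measurable_intg f : mu.-integrable setT (EFin \o f) -> measurable_fun setT f.
Proof. by move=> /measurable_int/measurable_EFinP. Qed.

Lemma Rintegral_norm_EFin f : mu.-integrable setT (EFin \o f) ->
  (\int[mu]_x `|f x|%:E = (\int[mu]_x `|f x|)%:E)%E.
Proof.
move=> If; rewrite /Rintegral fineK//.
exact: integrable_fin_num (intg_norm If).
Qed.

Lemma intg_EFin f : mu.-integrable setT (EFin \o f) ->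
  (\int[mu]_x (f x)%:E = (\int[mu]_x f x)%:E)%E.
Proof. by move=> If; rewrite /Rintegral fineK//; exact: integrable_fin_num. Qed.

Lemma Rintegral_ae f g : mu.-integrable setT (EFin \o f) ->
  measurable_fun setT g ->
  {ae mu, forall x, f x = g x} ->
  mu.-integrable setT (EFin \o g) /\ \int[mu]_x g x = \int[mu]_x f x.
Proof.
move=> If mg fg.
have E : ae_eq mu setT (EFin \o f) (EFin \o g).
  by apply: filterS fg => x /= -> _.
have mf := measurable_int _ If.
have mg' : measurable_fun setT (EFin \o g) by exact/measurable_EFinP.
split.
  apply/integrableP; split => //; move/integrableP : If => [_].
  have mA : measurable_fun setT (abse \o (EFin \o f)) by exact: measurableT_comp.
  have mB : measurable_fun setT (abse \o (EFin \o g)) by exact: measurableT_comp.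
  rewrite (ae_eq_integral (abse \o (EFin \o f)) (abse \o (EFin \o g)))//.
  by apply: filterS fg => x /= -> _.
rewrite /Rintegral (ae_eq_integral (EFin \o f) (EFin \o g))//.
by apply: filterS fg => x /= -> _.
Qed.

End MeasurableBasics.

Section FTC.
Context {R : realType}.
Notation mu := (@lebesgue_measure R).

(** The integrand may be unbounded at the end points, as long as it is
    integrable: comparing with the indefinite integral needs only the mean value
    theorem inside. *)
Lemma FTC_segment (f F : R -> R) (a b : R) : a < b ->
  mu.-integrable `[a, b] (EFin \o f) ->
  {within `[a, b], continuous F} ->
  (forall x, a < x < b -> {for x, continuous f}) ->
  (forall x : R, a < x < b -> is_derive x 1 F (f x)) ->
  \int[mu]_(x in `[a, b]) f x = F b - F a.
Proof.
move=> ab If cF cf dF.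
pose G x := parameterized_integral mu a x f.
have cG : {within `[a, b], continuous G}.
  exact: parameterized_integral_continuous (ltW ab) If.
have dG x : a < x < b -> is_derive x 1 G (f x).
  move=> /[dup] axb /andP[ax xb].
  have [d1 d2] := @continuous_FTC1_closed R f a x b xb If ax (cf x axb).
  by split; [exact: d1|rewrite -derive1E; exact: d2].
have [||c _ E] := @MVT R (fun x => G x - F x) (fun=> 0) a b ab.
- move=> x; rewrite in_itv/= => axb; rewrite -(subrr (f x)).
  by apply: is_deriveB; [exact: dG|exact: dF].
- by move=> x; apply: cvgB; [exact: cG|exact: cF].
move: E; rewrite mul0r => /eqP; rewrite subr_eq0 => /eqP E.
have Ga : G a = 0 by rewrite /G /parameterized_integral set_itv1 Rintegral_set1.
have -> : \int[mu]_(x in `[a, b]) f x = G b by [].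
by move: E; rewrite Ga => /eqP; rewrite subr_eq => /eqP ->; rewrite sub0r addrC.
Qed.

End FTC.

(** * Logarithmic kernels *)

Section SingularKernel.
Context {R : realType}.
Notation mu := (@lebesgue_measure R).

(** A majorant with an integrable singularity at 0 and integrable tails, namely
    1 / (sqrt y (1 + sqrt y)^2) for y > 0: it is the derivative of the bounded
    function 2 sqrt y / (1 + sqrt y). *)
Definition hker (y : R) : R := (Num.sqrt y * (1 + Num.sqrt y) ^+ 2)^-1.

Definition ker (y : R) : R := hker y + hker (- y).

Lemma hker_ge0 y : 0 <= hker y.
Proof. by rewrite /hker invr_ge0 mulr_ge0 ?sqrtr_ge0// sqr_ge0. Qed.

Lemma hker_le0 y : y <= 0 -> hker y = 0.
Proof. by move=> y0; rewrite /hker ler0_sqrtr// mul0r invr0. Qed.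

Lemma ker_ge0 y : 0 <= ker y.
Proof. by rewrite addr_ge0// hker_ge0. Qed.

Lemma kerN y : ker (- y) = ker y.
Proof. by rewrite /ker opprK addrC. Qed.

Lemma ker_norm y : ker y = (Num.sqrt `|y| * (1 + Num.sqrt `|y|) ^+ 2)^-1.
Proof.
rewrite /ker; have [y0|y0] := lerP 0 y.
  by rewrite (ger0_norm y0) (@hker_le0 (- y)) ?addr0// oppr_le0.
by rewrite (ltr0_norm y0) (hker_le0 (ltW y0)) add0r.
Qed.

Let sq (y : R) : R := Num.sqrt y.

Let dprim (x : R) : 0 < x ->
  is_derive x 1 (fun y : R => 2 * (sq y * (1 + sq y)^-1)) (hker x).
Proof.
move=> x0; have s0 : 0 < sq x by rewrite sqrtr_gt0.
have ds := is_derive1_sqrt x0; rewrite -/(sq x) in ds.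
have d1 := is_deriveD (is_derive_cst (1 : R) x (1 : R)) ds.
have n0 : (cst (1 : R) + @Num.sqrt R) x != 0.
  by rewrite -[X in X != 0]/(1 + sq x) gt_eqF// addr_gt0.
have d2 := is_deriveM ds (is_deriveV n0 d1).
apply: (is_deriveW (is_deriveZ 2 d2)) => // .
have E : (cst (1 : R) + @Num.sqrt R) x = 1 + sq x by [].
rewrite E /hker /GRing.scale/= -/(sq x); field.
by rewrite !gt_eqF//= addr_gt0.
Qed.

Let sq_cvg : (fun x : R => 2 * (sq x * (1 + sq x)^-1)) x @[x --> +oo] --> (2 : R).
Proof.
apply/cvgrPdist_le => e e0; near=> x.
have x0 : 0 < x by near: x; exact: nbhs_pinfty_gt.
have s0 : 0 < sq x by rewrite sqrtr_gt0.
have -> : 2 - 2 * (sq x * (1 + sq x)^-1) = 2 / (1 + sq x).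
  by field; rewrite gt_eqF// addr_gt0.
rewrite ger0_norm; last by rewrite divr_ge0// addr_ge0// ltW.
rewrite ler_pdivrMr ?addr_gt0// mulrDr mulr1.
rewrite (@le_trans _ _ (e * sq x)) ?lerDr ?(ltW e0)//.
rewrite -ler_pdivrMl// (@le_trans _ _ (sq ((e^-1 * 2) ^+ 2)))//.
  by rewrite /sq sqrtr_sqr ler_norm.
rewrite ler_sqrt ?(ltW x0)//.
Unshelve. all: by end_near. Qed.

Lemma hker_measurable : measurable_fun [set: R] hker.
Proof.
have ms : measurable_fun [set: R] sq.
  by apply: continuous_measurable_fun; exact: sqrt_continuous.
apply: measurable_funV; apply: measurable_funM => //.
by apply: measurable_funX; apply: measurable_funD => //; exact: measurable_cst.
Qed.

Let hker_int (a : R) : 0 < a ->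
  (\int[mu]_(x in `[a, +oo[) (hker x)%:E <= 2%:E)%E.
Proof.
move=> a0.
rewrite (@ge0_continuous_FTC2y _ _ (fun y : R => 2 * (sq y * (1 + sq y)^-1)) a 2).
- by rewrite -EFinB lee_fin gerBl mulr_ge0// divr_ge0 ?sqrtr_ge0// addr_ge0 ?sqrtr_ge0.
- by move=> x _; exact: hker_ge0.
- apply: continuous_in_subspaceT => x; rewrite inE/= in_itv/= andbT => ax.
  have x0 := lt_le_trans a0 ax.
  have s0 : 0 < sq x by rewrite sqrtr_gt0.
  apply: cvgV; first by rewrite gt_eqF// mulr_gt0// exprn_gt0// addr_gt0.
  apply: cvgM; first exact: sqrt_continuous.
  apply: (@continuous_comp _ _ _ (fun x : R => 1 + Num.sqrt x) (fun y : R => y ^+ 2)).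
    by apply: cvgD; [exact: cvg_cst|exact: sqrt_continuous].
  exact: exprn_continuous.
- exact: sq_cvg.
- by move=> x ax; have [] := dprim (lt_trans a0 ax).
- by apply: cvg_at_right_filter; exact: is_derive_continuous (dprim a0).
- move=> x; rewrite in_itv/= andbT => ax.
  by rewrite derive1E; have [] := dprim (lt_trans a0 ax).
Qed.

Lemma hker_integrable : mu.-integrable setT (EFin \o hker).
Proof.
have mk : measurable_fun setT (EFin \o hker).
  by apply/measurable_EFinP; exact: hker_measurable.
apply/integrableP; split => //.
pose D (n : nat) := [set` `[(n.+1%:R : R)^-1, +oo[].
have UD : \bigcup_n D n = [set` `]0%R, +oo[].
  apply/seteqP; split=> x /=.
    by move=> [n _]; rewrite /D /= !in_itv/= !andbT; apply: lt_le_trans; rewrite invr_gt0.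
  rewrite in_itv/= andbT => x0; exists (Num.trunc x^-1) => //.
  rewrite /D/= in_itv/= andbT invf_ple ?posrE//.
  by rewrite ltW// truncnS_gt.
have E : (\int[mu]_x `|(EFin \o hker) x| = \int[mu]_(x in `]0%R, +oo[) (hker x)%:E)%E.
  rewrite [RHS]integral_mkcond; apply: eq_integral => x _ /=.
  rewrite patchE; case: ifPn => [_|]; first by rewrite ger0_norm// hker_ge0.
  rewrite notin_setE/= in_itv/= andbT => /negP; rewrite -leNgt => x0.
  by rewrite hker_le0// normr0.
rewrite E -UD.
have nd : {homo D : n m / (n <= m)%N >-> (n <= m)%O}.
  move=> n m nm; apply/subsetPset; apply: subset_itvr.
  by rewrite bnd_simp lef_pV2 ?posrE// ler_nat.
have := @ge0_nondecreasing_set_cvg_integral _ (measurableTypeR R) R D (EFin \o hker) mu nd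
  (fun i => measurable_itv _) (fun i => measurable_funTS mk)
  (fun i x _ => hker_ge0 x).
move=> /(@cvg_lim _ _) <- //.
apply: (@le_lt_trans _ _ 2%:E); last by rewrite ltry.
apply: lime_le.
  apply: ereal_nondecreasing_is_cvgn => n m nm.
  apply: ge0_subset_integral; [exact: measurable_itv|exact: measurable_itv| | |].
  - exact: measurable_funTS.
  - by move=> x _; rewrite lee_fin hker_ge0.
  - exact/subsetPset/(nd n m nm).
by apply: nearW => n; apply: hker_int; rewrite invr_gt0.
Qed.

Lemma ker_integrable : mu.-integrable setT (EFin \o ker).
Proof.
apply: intgD; first exact: hker_integrable.
have := @integrable_affine R (-1) 0 _ hker hker_integrable.
rewrite oppr_eq0 oner_eq0 => /(_ isT).
by under eq_fun do rewrite mulN1r addr0.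
Qed.

End SingularKernel.

Section LogKernel.
Context {R : realType}.
Notation mu := (@lebesgue_measure R).

(** Twice the logarithm of the absolute value. *)
Definition lg (x : R) : R := ln (x ^+ 2).

Lemma lg0 : lg 0 = 0. Proof. by rewrite /lg expr0n ln0. Qed.

Lemma lg1 : lg 1 = 0. Proof. by rewrite /lg expr1n ln1. Qed.

Lemma lgN x : lg (- x) = lg x. Proof. by rewrite /lg sqrrN. Qed.

Lemma lgM x y : x != 0 -> y != 0 -> lg (x * y) = lg x + lg y.
Proof. by move=> x0 y0; rewrite /lg exprMn lnM// posrE exprn_even_gt0. Qed.

Lemma lg_ln x : 0 < x -> lg x = 2 * ln x.
Proof. by move=> x0; rewrite /lg lnXn// mulr_natl. Qed.

Lemma expR_lg x : x != 0 -> expR (lg x) = x ^+ 2.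
Proof. by move=> x0; rewrite lnK// posrE exprn_even_gt0. Qed.

Lemma lg_measurable : measurable_fun [set: R] lg.
Proof.
apply: (measurableT_comp (@measurable_ln R)).
by apply: continuous_measurable_fun; exact: exprn_continuous.
Qed.

Lemma ln_le_subr1 (x : R) : 0 < x -> ln x <= x - 1.
Proof.
move=> x0; have := @le_ln1Dx R (x - 1).
by rewrite addrCA subrr addr0; apply; rewrite ltrBrDr addNr.
Qed.

Lemma is_derive_lg (x : R) : x != 0 -> is_derive x 1 lg (2 / x).
Proof.
move=> x0; have x2 : 0 < x ^+ 2 by rewrite exprn_even_gt0.
have d : is_derive x 1 (fun y : R => y ^+ 2) (2 * x).
  apply: (is_deriveW (is_deriveM (is_derive_id x (1 : R)) (is_derive_id x (1 : R)))) => //.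
  by rewrite /GRing.scale/=; ring.
apply: (is_deriveW (@is_derive1_comp _ (@ln R) (fun y => y ^+ 2) x _ _ (is_derive1_ln x2) d)) => //.
by field.
Qed.

Lemma lg_continuous (x : R) : x != 0 -> {for x, continuous lg}.
Proof. by move=> /is_derive_lg/is_derive_continuous. Qed.

Lemma norm_ln_le (r : R) : 0 < r -> `|ln r| <= `|r ^+ 2 - 1| / r.
Proof.
move=> r0; have h1 := ln_le_subr1 r0.
have h2 : - ln r <= r^-1 - 1 by rewrite -lnV ?posrE// ln_le_subr1// invr_gt0.
rewrite ler_pdivlMr// -[X in _ * X](gtr0_norm r0) -normrM.
have rr : r^-1 * r = 1 by rewrite mulVf// gt_eqF.
have [r1|r1] := lerP 1 r.
  have l0 : 0 <= ln r by exact: ln_ge0.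
  rewrite ger0_norm ?mulr_ge0// ?(ltW r0)// ger0_norm; nra.
have l0 : ln r <= 0 by exact/ln_le0/ltW.
rewrite ler0_norm; last by nra.
rewrite ler0_norm; nra.
Qed.

(** The double zero of the squared logarithm at 1 cancels the kernel 1/s^2. *)
Lemma lg_sq_le (y : R) : lg y ^+ 2 <= 64 * (1 - y) ^+ 2 * ker y.
Proof.
have [->|y0] := eqVneq y 0.
  by rewrite lg0 expr0n/= mulr_ge0 ?ker_ge0// mulr_ge0 ?sqr_ge0.
(* Bounding ln at the fourth root r of |y| produces the factor 1/q of ker. *)
rewrite ker_norm; set q := Num.sqrt `|y|.
have q0 : 0 < q by rewrite sqrtr_gt0 normr_gt0.
have yq : `|y| = q ^+ 2 by rewrite sqr_sqrtr.
pose r := Num.sqrt q.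
have r0 : 0 < r by rewrite sqrtr_gt0.
have qr : q = r ^+ 2 by rewrite sqr_sqrtr// ltW.
have -> : lg y = 8 * ln r.
  rewrite /lg -[y ^+ 2]real_normK ?num_real// yq qr -!exprM lnXn//.
  by rewrite mulr_natl.
have h := norm_ln_le r0.
have h2 : ln r ^+ 2 * q <= (q - 1) ^+ 2.
  rewrite -[ln r ^+ 2]real_normK ?num_real// -[(q - 1) ^+ 2]real_normK ?num_real//.
  rewrite [X in _ * X]qr -exprMn ler_sqr ?nnegrE ?mulr_ge0// ?(ltW r0)//.
  by rewrite qr -ler_pdivlMr.
have h3 : (q ^+ 2 - 1) ^+ 2 <= (1 - y) ^+ 2.
  rewrite -yq; have := ler_norm y; have := sqr_ge0 y.
  have -> : (`|y| - 1) ^+ 2 = y ^+ 2 - 2 * `|y| + 1.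
    by rewrite -[y ^+ 2]real_normK ?num_real//; ring.
  by rewrite !expr2 => _; nra.
rewrite ler_pdivlMr; last by rewrite mulr_gt0// exprn_gt0// addr_gt0.
apply: (@le_trans _ _ (64 * (q ^+ 2 - 1) ^+ 2)); last by rewrite ler_pM2l.
have -> : (8 * ln r) ^+ 2 * (q * (1 + q) ^+ 2) =
  64 * (ln r ^+ 2 * q * (1 + q) ^+ 2) by ring.
rewrite ler_pM2l//; have -> : (q ^+ 2 - 1) ^+ 2 = (q - 1) ^+ 2 * (1 + q) ^+ 2 by ring.
by rewrite ler_wpM2r// sqr_ge0.
Qed.

Lemma ker_ge_near (s : R) : s != 0 -> `|s| <= 1 -> 1 <= 4 * ker s.
Proof.
move=> s0 s1; rewrite ker_norm; set q := Num.sqrt `|s|.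
have q0 : 0 < q by rewrite sqrtr_gt0 normr_gt0.
have q1 : q <= 1 by rewrite -[1]sqrtr1 ler_sqrt.
rewrite ler_pdivlMr ?mul1r; last by rewrite mulr_gt0// exprn_gt0// addr_gt0.
by rewrite expr2; nra.
Qed.

Lemma ker_ge_far (s : R) : 4^-1 <= `|s| -> (s ^+ 2)^-1 <= 18 * ker s.
Proof.
move=> s1; rewrite ker_norm; set q := Num.sqrt `|s|.
have s0 : 0 < `|s| by exact: lt_le_trans s1.
have q0 : 0 < q by rewrite sqrtr_gt0.
have sq : `|s| = q ^+ 2 by rewrite sqr_sqrtr.
have q1 : 2^-1 <= q.
  have -> : 2^-1 = Num.sqrt (4^-1 : R).
    have -> : 4^-1 = (2^-1) ^+ 2 :> R by field.
    by rewrite sqrtr_sqr ger0_norm.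
  by rewrite ler_sqrt.
have p1 : 0 < q * (1 + q) ^+ 2 by rewrite mulr_gt0// exprn_gt0// addr_gt0.
rewrite -[s ^+ 2]real_normK ?num_real// sq ler_pdivlMr//.
rewrite mulrC ler_pdivrMr ?exprn_gt0//.
have -> : 18 * (q ^+ 2) ^+ 2 = q * (18 * q ^+ 3) by ring.
rewrite ler_pM2l// (@le_trans _ _ ((3 * q) ^+ 2))//.
  by rewrite ler_sqr ?nnegrE ?addr_ge0 ?mulr_ge0 ?(ltW q0)//; lra.
have -> : (3 * q) ^+ 2 = q ^+ 2 * 9 by ring.
have -> : 18 * q ^+ 3 = q ^+ 2 * (18 * q) by ring.
by rewrite ler_pM2l ?exprn_gt0//; lra.
Qed.

Lemma inv1D_le_ker (x : R) : (1 + x ^+ 2)^-1 <= 18 * ker x + 4 * ker (1 - x).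
Proof.
have [->|x0] := eqVneq x 0.
  rewrite subr0 expr0n/= addr0 invr1.
  have := @ker_ge_near 1 (oner_neq0 _); rewrite normr1 => /(_ (lexx _)).
  by have := ker_ge0 (0 : R); lra.
have x2 := sqr_ge0 x.
apply: (@le_trans _ _ (18 * ker x)); last by rewrite lerDl mulr_ge0// ker_ge0.
have [x1|x1] := lerP `|x| 1.
  rewrite (@le_trans _ _ 1)//.
    by rewrite invf_le1 ?lerDl// ltr_pwDl.
  by rewrite (le_trans (ker_ge_near x0 x1))// ler_wpM2r ?ker_ge0//; lra.
rewrite (le_trans _ (ker_ge_far _))//; last by lra.
by rewrite lef_pV2 ?posrE ?exprn_even_gt0//; lra.
Qed.

Lemma ker_affine_integrable (a b : R) : a != 0 ->
  mu.-integrable setT (EFin \o (fun s => ker (a * s + b))).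
Proof. by move=> a0; apply: integrable_affine => //; exact: ker_integrable. Qed.

Lemma ker_1B_integrable : mu.-integrable setT (EFin \o (fun s : R => ker (1 - s))).
Proof.
have := @ker_affine_integrable (-1) 1; rewrite oppr_eq0 oner_eq0 => /(_ isT).
by under eq_fun do rewrite mulN1r addrC.
Qed.

Lemma ker_1D_integrable : mu.-integrable setT (EFin \o (fun s : R => ker (1 + s))).
Proof.
have := @ker_affine_integrable 1 1; rewrite oner_eq0 => /(_ isT).
by under eq_fun do rewrite mul1r addrC.
Qed.

Lemma inv1D_measurable : measurable_fun [set: R] (fun x : R => (1 + x ^+ 2)^-1).
Proof.
apply: measurable_funV; apply: measurable_funD; first exact: measurable_cst.
by apply: continuous_measurable_fun; exact: exprn_continuous.
Qed.

Lemma inv1D_integrable : mu.-integrable setT (EFin \o (fun x : R => (1 + x ^+ 2)^-1)).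
Proof.
have Ig := intgD (intgZ 18 ker_integrable) (intgZ 4 ker_1B_integrable).
apply: (integrable_dom (measurable_line inv1D_measurable) _ Ig) => x.
by rewrite ger0_norm ?inv1D_le_ker// invr_ge0 addr_ge0// sqr_ge0.
Qed.

Lemma lg_le_sq (y : R) : `|lg y| <= 1 + lg y ^+ 2.
Proof.
rewrite -[lg y ^+ 2]real_normK ?num_real// expr2.
by have := normr_ge0 (lg y); nra.
Qed.

Lemma lg_inv1D_integrable :
  mu.-integrable setT (EFin \o (fun x : R => lg x * (1 + x ^+ 2)^-1)).
Proof.
have Ig := intgD inv1D_integrable (intgZ 128 ker_integrable).
apply: (integrable_dom _ _ Ig) => [|x].
  apply: measurable_line.
  apply: measurable_funM; [exact: lg_measurable|exact: inv1D_measurable].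
have p : 0 < 1 + x ^+ 2 by rewrite ltr_pwDl// sqr_ge0.
rewrite normrM [X in _ * X]gtr0_norm ?invr_gt0// ler_pdivrMr// mulrDl mulVf ?gt_eqF//.
rewrite (le_trans (lg_le_sq x))// lerD2l (le_trans (lg_sq_le x))//.
rewrite [leRHS]mulrAC; apply: ler_wpM2r; first exact: ker_ge0.
by have := sqr_ge0 (1 + x); rewrite !expr2; lra.
Qed.

(** As lg 1 = 0, klog is minus the integrand of the half Laplacian of lg at the
    point 1, whereas ksq controls the remainder of a second order expansion in
    lg (1 - s) and lg (1 + s). *)
Definition ksq (s : R) : R := (lg (1 - s) ^+ 2 + lg (1 + s) ^+ 2) / s ^+ 2.

Definition klog (s : R) : R := (lg (1 - s) + lg (1 + s)) / s ^+ 2.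

Lemma ksq_le (s : R) : ksq s <= 64 * (ker (1 - s) + ker (1 + s)).
Proof.
rewrite /ksq; have [->|s0] := eqVneq s 0.
  by rewrite expr0n/= invr0 mulr0 mulr_ge0// addr_ge0// ker_ge0.
rewrite ler_pdivrMr ?exprn_even_gt0//.
have h1 := lg_sq_le (1 - s); have h2 := lg_sq_le (1 + s).
rewrite opprB addrCA subrr addr0 in h1.
rewrite opprD addrA subrr add0r sqrrN in h2.
by rewrite (le_trans (lerD h1 h2))//; lra.
Qed.

Lemma ksq_ge0 (s : R) : 0 <= ksq s.
Proof. by rewrite divr_ge0 ?sqr_ge0// addr_ge0// sqr_ge0. Qed.

Lemma lg1B_measurable : measurable_fun [set: R] (fun s => lg (1 - s)).
Proof.
apply: (measurableT_comp lg_measurable).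
by apply: measurable_funB; [exact: measurable_cst|exact: measurable_id].
Qed.

Lemma lg1D_measurable : measurable_fun [set: R] (fun s => lg (1 + s)).
Proof.
apply: (measurableT_comp lg_measurable).
by apply: measurable_funD; [exact: measurable_cst|exact: measurable_id].
Qed.

Lemma sqr_measurable : measurable_fun [set: R] (fun s : R => s ^+ 2).
Proof. by apply: continuous_measurable_fun; exact: exprn_continuous. Qed.

Lemma ksq_integrable : mu.-integrable setT (EFin \o ksq).
Proof.
have Ig := intgZ 64 (intgD ker_1B_integrable ker_1D_integrable).
apply: (integrable_dom _ _ Ig).
  apply: measurable_line.
  apply: measurable_fun_div; last exact: sqr_measurable.
  by apply: measurable_funD; apply: measurable_funX;
    [exact: lg1B_measurable|exact: lg1D_measurable].
by move=> s; rewrite ger0_norm ?ksq_ge0// ksq_le.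
Qed.

Lemma lg_small (s : R) : 0 < s -> `|s| <= 4^-1 -> `|lg (1 - s) + lg (1 + s)| <= 4 * s ^+ 2.
Proof.
move=> s0; rewrite gtr0_norm// => s1.
rewrite -lgM; [|lra|lra].
have E : (1 - s) * (1 + s) = 1 - s ^+ 2 by ring.
have s2 : 0 < s ^+ 2 by rewrite exprn_gt0.
have s3 : s ^+ 2 <= 4^-1 by rewrite expr2; nra.
have p : 0 < 1 - s ^+ 2 by lra.
rewrite E lg_ln//.
have l0 : ln (1 - s ^+ 2) <= 0 by apply: ln_le0; lra.
rewrite ler0_norm; last by lra.
have := @ln_le_subr1 (1 - s ^+ 2)^-1; rewrite invr_gt0 p => /(_ isT).
rewrite lnV ?posrE// => h.
suff : (1 - s ^+ 2)^-1 - 1 <= 2 * s ^+ 2 by lra.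
by rewrite lerBlDr -[X in X <= _]mul1r ler_pdivrMr//; nra.
Qed.

Lemma klogN (s : R) : klog (- s) = klog s.
Proof. by rewrite /klog opprK sqrrN addrC. Qed.

(** Near 0 the two logarithms cancel to second order; away from 0 the square
    dominates, up to the integrable tail of 1/s^2. *)
Lemma klog_le (s : R) :
  `|klog s| <= 36 * ker s + 64 * (ker (1 - s) + ker (1 + s)).
Proof.
wlog s0 : s / 0 < s => [H|].
  have [s0|s0|->] := ltrgt0P s; first exact: H.
    by have := H (- s); rewrite oppr_gt0 klogN kerN opprK [ker (1 + s) + _]addrC; apply.
  rewrite /klog expr0n/= invr0 mulr0 normr0.
  have := ker_ge0 (0 : R); have := ker_ge0 (1 - 0 : R).
  by have := ker_ge0 (1 + 0 : R); lra.
have s2 : 0 < s ^+ 2 by rewrite exprn_gt0.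
have k1 := ker_ge0 (1 - s); have k2 := ker_ge0 (1 + s); have k3 := ker_ge0 s.
have [s1|s1] := lerP `|s| 4^-1.
  have h := ker_ge_near (lt0r_neq0 s0) _.
  rewrite /klog normrM [X in _ * X]gtr0_norm ?invr_gt0// ler_pdivrMr//.
  rewrite (le_trans (lg_small s0 s1))// ler_pM2r//.
  have : 1 <= 4 * ker s by apply: h; lra.
  lra.
rewrite (@le_trans _ _ (2 * (s ^+ 2)^-1 + ksq s))//.
  rewrite /klog /ksq -mulrDl normrM [X in _ * X <= _]gtr0_norm ?invr_gt0//.
  rewrite ler_pM2r ?invr_gt0// (le_trans (ler_normD _ _))//.
  by have := lg_le_sq (1 - s); have := lg_le_sq (1 + s); lra.
by have := ksq_le s; have := ker_ge_far (ltW s1); lra.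
Qed.

Lemma klog_measurable : measurable_fun [set: R] klog.
Proof.
apply: measurable_fun_div; last exact: sqr_measurable.
by apply: measurable_funD; [exact: lg1B_measurable|exact: lg1D_measurable].
Qed.

Lemma klog_integrable : mu.-integrable setT (EFin \o klog).
Proof.
apply: (integrable_dom (measurable_line klog_measurable) klog_le).
apply: intgD; first exact: intgZ ker_integrable.
apply: intgZ; apply: intgD; [exact: ker_1B_integrable|exact: ker_1D_integrable].
Qed.

End LogKernel.

Section LogHarmonic.
Context {R : realType}.
Notation mu := (@lebesgue_measure R).

Let E (x : R) : R := x * lg x.

Let E_bound (x : R) : 0 <= x -> 2 * (x - 1) <= E x <= 2 * x * (x - 1).
Proof.
rewrite le_eqVlt => /predU1P[<-|x0].
  by rewrite /E mul0r mulr0 mul0r; apply/andP; split; lra.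
rewrite /E lg_ln//; have h1 := ln_le_subr1 x0.
have := @ln_le_subr1 _ x^-1; rewrite invr_gt0 lnV ?posrE// => /(_ x0) h2.
have h3 : x * x^-1 = 1 by rewrite divff// gt_eqF.
by apply/andP; split; nra.
Qed.

Let E_continuous : continuous E.
Proof.
move=> x; have [->|x0] := eqVneq x 0; last first.
  by apply: cvgM; [exact: cvg_id|exact: lg_continuous].
rewrite /continuous_at /E mul0r; apply/cvgr0Pnorm_le => e e0.
near=> y.
have [->|y0] := eqVneq y 0; first by rewrite mul0r normr0 ltW.
have b := norm_ln_le; set q := Num.sqrt `|y|.
have q0 : 0 < q by rewrite sqrtr_gt0 normr_gt0.
have yq : `|y| = q ^+ 2 by rewrite sqr_sqrtr.
have lq : lg y = 4 * ln q.
  by rewrite /lg -[y ^+ 2]real_normK ?num_real// yq -!exprM lnXn// mulr_natl.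
have y1 : `|y| < 1 by near: y; apply: cvgr0_norm_lt => //; exact: cvg_id.
have ye : `|y| <= (e / 4) ^+ 2.
  near: y; apply: cvgr0_norm_le; [exact: cvg_id|].
  by rewrite exprn_gt0// divr_gt0.
have q1 : q <= 1 by rewrite -[1]sqrtr1 ler_sqrt// ltW.
have qe : q <= e / 4.
  rewrite -[e / 4]ger0_norm ?divr_ge0 ?(ltW e0)// -sqrtr_sqr ler_sqrt//.
  by rewrite sqr_ge0.
rewrite normrM yq lq normrM ger0_norm//.
have e1 : `|q ^+ 2 - 1| = 1 - q ^+ 2.
  by rewrite ler0_norm ?opprB// subr_le0 expr_le1// ltW.
have := norm_ln_le q0; rewrite ler_pdivlMr// e1 => h.
by have := sqr_ge0 q; rewrite !expr2 in h *; nra.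
Unshelve. all: by end_near. Qed.

Let is_derive_E (x : R) : x != 0 -> is_derive x 1 E (lg x + 2).
Proof.
move=> x0.
apply: (is_deriveW (is_deriveM (is_derive_id x (1 : R)) (is_derive_lg x0))) => //.
by rewrite /GRing.scale/=; field.
Qed.

Let H (s : R) : R := E (1 * s + 1) + E ((-1) * s + 1).

(** A primitive of klog on each side of its singularity at 1, extended
    continuously across 0 and 1. *)
Let W (s : R) : R := - (H s / s).

Let W_le (s : R) : `|s| <= 1 -> `|W s| <= 4 * `|s|.
Proof.
move=> s1; have [->|s0] := eqVneq s 0.
  by rewrite /W invr0 mulr0 oppr0 normr0 mulr0.
have /ler_normlP[h1 h2] := s1.
rewrite /W normrN normrM normfV ler_pdivrMr ?normr_gt0//.
have /andP[a1 a2] := @E_bound (1 * s + 1) ltac:(lra).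
have /andP[b1 b2] := @E_bound (-1 * s + 1) ltac:(lra).
have ss : `|s| * `|s| = s * s by rewrite -normrM ger0_norm// -expr2 sqr_ge0.
rewrite -mulrA ss ler_norml /H; apply/andP; split; nra.
Qed.

Let H_continuous : continuous H.
Proof.
move=> s; apply: cvgD.
  apply: (@continuous_comp _ _ _ (fun s : R => 1 * s + 1) E); last exact: E_continuous.
  by apply: cvgD; [apply: cvgM; [exact: cvg_cst|exact: cvg_id]|exact: cvg_cst].
apply: (@continuous_comp _ _ _ (fun s : R => (-1) * s + 1) E); last exact: E_continuous.
by apply: cvgD; [apply: cvgM; [exact: cvg_cst|exact: cvg_id]|exact: cvg_cst].
Qed.

Let W_continuous : continuous W.
Proof.
move=> s; have [->|s0] := eqVneq s 0; last first.
  by apply: cvgN; apply: cvgM; [exact: H_continuous|exact: inv_continuous].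
rewrite /continuous_at {2}/W invr0 mulr0 oppr0; apply/cvgr0Pnorm_le => e e0.
near=> y.
have y1 : `|y| < 1 by near: y; apply: cvgr0_norm_lt => //; exact: cvg_id.
rewrite (le_trans (W_le (ltW y1)))// -ler_pdivlMl//.
near: y; apply: cvgr0_norm_le; [exact: cvg_id|].
by rewrite mulr_gt0.
Unshelve. all: by end_near. Qed.

Let is_derive_W (s : R) : 0 < s -> s != 1 -> is_derive s 1 W (klog s).
Proof.
move=> s0 s1.
have p0 : 1 * s + 1 != 0 by rewrite gt_eqF//; lra.
have m0 : -1 * s + 1 != 0 by rewrite mulN1r addrC subr_eq0 eq_sym.
have sn : s != 0 by rewrite gt_eqF.
have d1 := is_derive_affine (is_derive_E p0).
have d2 := is_derive_affine (is_derive_E m0).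
have d3 := is_deriveD d1 d2.
have d4 := is_deriveV (f := id) sn (is_derive_id s (1 : R)).
apply: (is_deriveW (is_deriveN (is_deriveM d3 d4))) => //.
rewrite -[((fun t : R => E (1 * t + 1)) + (fun t : R => E (-1 * t + 1))) s]/(E (1 * s + 1) + E (-1 * s + 1)).
rewrite /klog /E /GRing.scale/= !mul1r !mulN1r.
rewrite ![_ + 1]addrC; field.
by [].
Qed.

Let W_infty : W x @[x --> +oo] --> (0 : R).
Proof.
apply/cvgr0Pnorm_le => e e0; near=> s.
have s2 : 2 <= s by near: s; exact: nbhs_pinfty_ge.
have s0 : 0 < s by lra.
pose q := Num.sqrt s.
have q0 : 0 < q by rewrite sqrtr_gt0.
have qs : s = q ^+ 2 by rewrite sqr_sqrtr// ltW.
have qe : 24 / e <= q.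
  rewrite -[24 / e]ger0_norm ?divr_ge0 ?(ltW e0)// -sqrtr_sqr ler_sqrt ?(ltW s0)//.
suff : `|W s| <= 24 / q.
  by move/le_trans; apply; rewrite ler_pdivrMr// mulrC -ler_pdivrMr.
have p1 : 0 < s + 1 by lra.
have p2 : 0 < s - 1 by lra.
have EH : H s = 2 * s * (ln (s + 1) - ln (s - 1)) + 2 * (ln (s + 1) + ln (s - 1)).
  rewrite /H /E; have -> : -1 * s + 1 = - (s - 1) by ring.
  by rewrite lgN mul1r !lg_ln//; ring.
have l1 : 0 <= ln (s - 1) by apply: ln_ge0; lra.
have l2 : ln (s - 1) <= ln (s + 1) by rewrite ler_ln ?posrE//; lra.
have l3 : ln (s + 1) - ln (s - 1) <= 2 / (s - 1).
  rewrite -ln_div ?posrE//; apply: (le_trans (ln_le_subr1 _)); first exact: divr_gt0.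
  suff -> : (s + 1) / (s - 1) - 1 = 2 / (s - 1) by [].
  by field; rewrite gt_eqF.
have l4 : 2 / (s - 1) <= 4 / s.
  by rewrite ler_pdivrMr// mulrAC ler_pdivlMr//; lra.
have l5 : ln (s + 1) <= 2 * q.
  have h : s + 1 <= (1 + q) ^+ 2 by rewrite qs expr2; nra.
  have h2 : ln (s + 1) <= ln ((1 + q) ^+ 2) by rewrite ler_ln ?posrE// exprn_gt0//; lra.
  rewrite (le_trans h2)// lnXn ?addr_gt0// mulr2n.
  by have := @ln_le_subr1 _ (1 + q); rewrite addr_gt0// => /(_ isT); lra.
have l6 : 0 <= 4 / s by rewrite divr_ge0// ltW.
have l7 : s * (4 / s) = 4 by rewrite mulrCA divff ?mulr1// gt_eqF.
have H0 : 0 <= H s by rewrite EH; nra.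
have H1 : H s <= 8 + 8 * q by rewrite EH; nra.
rewrite /W normrN ger0_norm; last by rewrite divr_ge0// ltW.
have q1 : 1 <= q by rewrite -[1]sqrtr1 ler_sqrt; lra.
have -> : 24 / q = 24 * q / s by rewrite [in RHS]qs; field; rewrite gt_eqF.
by rewrite ler_pM2r ?invr_gt0//; lra.
Unshelve. all: by end_near. Qed.

Let klog_cont (s : R) : 0 < s -> s != 1 -> {for s, continuous klog}.
Proof.
move=> s0 s1; apply: cvgM.
  apply: cvgD.
    apply: (@continuous_comp _ _ _ (fun s : R => 1 - s) lg).
      by apply: cvgB; [exact: cvg_cst|exact: cvg_id].
    by apply: lg_continuous; rewrite subr_eq0 eq_sym.
  apply: (@continuous_comp _ _ _ (fun s : R => 1 + s) lg).
    by apply: cvgD; [exact: cvg_cst|exact: cvg_id].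
  by apply: lg_continuous; rewrite gt_eqF// addr_gt0.
apply: (@continuous_comp _ _ _ (fun s : R => s ^+ 2) (fun y : R => y^-1)).
  exact: exprn_continuous.
by apply: inv_continuous; rewrite gt_eqF// exprn_gt0.
Qed.

Let klog_int (A : set R) : measurable A -> mu.-integrable A (EFin \o klog).
Proof.
by move=> mA; apply: integrableS klog_integrable => //; exact: measurableT.
Qed.

Let seg01 : \int[mu]_(x in `[0, 1]) klog x = W 1.
Proof.
have -> : W 1 = W 1 - W 0 by rewrite [W 0]/W invr0 mulr0 oppr0 subr0.
apply: (@FTC_segment R klog W 0 1) => //.
- exact: klog_int.
- by apply: continuous_subspaceT; exact: W_continuous.
- by move=> x /andP[x0 x1]; apply: klog_cont => //; rewrite lt_eqF.
- by move=> x /andP[x0 x1]; apply: is_derive_W => //; rewrite lt_eqF.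
Qed.

Let seg12 : \int[mu]_(x in `[1, 2]) klog x = W 2 - W 1.
Proof.
apply: (@FTC_segment R klog W 1 2).
- by rewrite ltr1n.
- exact: klog_int.
- by apply: continuous_subspaceT; exact: W_continuous.
- by move=> x /andP[x0 x1]; apply: klog_cont; [lra|rewrite gt_eqF].
- by move=> x /andP[x0 x1]; apply: is_derive_W; [lra|rewrite gt_eqF].
Qed.

Let seg2y : \int[mu]_(x in `[2, +oo[) klog x = - W 2.
Proof.
rewrite /Rintegral (@ge0_continuous_FTC2y R klog W 2 0).
- by rewrite /= sub0r.
- move=> x x2; rewrite /klog divr_ge0 ?sqr_ge0//.
  by rewrite addr_ge0// /lg ln_ge0// expr2; nra.
- apply: continuous_in_subspaceT => x; rewrite inE/= in_itv/= andbT => ax.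
  by apply: klog_cont; [lra|rewrite gt_eqF//; lra].
- exact: W_infty.
- move=> x ax; suff [] : is_derive x 1 W (klog x) by [].
  by apply: is_derive_W; [lra|rewrite gt_eqF//; lra].
- by apply: cvg_at_right_filter; exact: W_continuous.
- move=> x; rewrite in_itv/= andbT => ax; rewrite derive1E.
  suff [] : is_derive x 1 W (klog x) by [].
  by apply: is_derive_W; [lra|rewrite gt_eqF//; lra].
Qed.

(** The logarithm of the absolute value is, up to a constant, a fundamental
    solution of the half Laplacian, which thus annihilates it at the point 1. Concretely, the primitive
    W is continuous across the singularity 1 and vanishes at 0 and at infinity. *)
Lemma klog_integral : \int[mu]_x klog x = 0.
Proof.
pose wp (x : R) := if 0 < x then klog x else 0.
have E1 : klog = (fun x => wp x + wp ((-1) * x + 0)).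
  apply/funext => x; rewrite /wp addr0 mulN1r oppr_gt0.
  have [x0|x0|->] := ltrgt0P x; rewrite ?addr0 ?add0r ?klogN//.
  by rewrite /klog expr0n/= invr0 mulr0.
have E2 : wp = klog \_ `[0, +oo[.
  apply/funext => x; rewrite patchE /wp; case: (boolP (x \in _)).
    rewrite inE/= in_itv/= andbT le_eqVlt => /predU1P[<-|->//].
    by rewrite ltxx /klog expr0n/= invr0 mulr0.
  by rewrite notin_setE/= in_itv/= andbT => /negP; rewrite -ltNge => /ltW; case: ltgtP.
have Iwp : mu.-integrable setT (EFin \o wp).
  rewrite E2 -restrict_EFin; apply/integrable_restrict => //.
  by rewrite setTI; exact: klog_int.
have Z : \int[mu]_x wp x = 0.
  rewrite E2 -Rintegral_mkcond.
  have U1 : `[0, +oo[%classic = `[0, 1]%classic `|` `]1, +oo[%classic :> set R.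
    apply/seteqP; split=> x /=; rewrite !in_itv/= !andbT.
      by move=> x0; have [x1|x1] := lerP x 1; [left; rewrite x0|right].
    by move=> [/andP[]//|/ltW]; exact: le_trans ler01.
  have U2 : `[1, +oo[%classic = `[1, 2]%classic `|` `]2, +oo[%classic :> set R.
    apply/seteqP; split=> x /=; rewrite !in_itv/= !andbT.
      by move=> x0; have [x1|x1] := lerP x 2; [left; rewrite x0|right].
    by move=> [/andP[]//|/ltW]; apply: le_trans; rewrite ler1n.
  have disj (a b : R) : [disjoint `[a, b]%classic & `]b, +oo[%classic].
    rewrite disj_set2E; apply/eqP; apply/seteqP; split=> x //=.
    by rewrite !in_itv/= andbT => -[/andP[_ xb] bx]; have := lt_le_trans bx xb; rewrite ltxx.
  rewrite U1 Rintegral_setU//; last by apply: klog_int; exact: measurableU.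
  rewrite seg01 Rintegral_itv_obnd_cbnd; last exact: klog_int.
  rewrite U2 Rintegral_setU//; last by apply: klog_int; exact: measurableU.
  rewrite seg12 Rintegral_itv_obnd_cbnd; last exact: klog_int.
  by rewrite seg2y; ring.
rewrite E1 RintegralD//; last first.
  by apply: integrable_affine => //; rewrite oppr_eq0 oner_eq0.
by rewrite Z add0r Rintegral_affine ?Z ?mulr0// oppr_eq0 oner_eq0.
Qed.

End LogHarmonic.

(** * The logarithmic blow-up *)

Section Blowup.
Context {R : realType} d (T : measurableType d) (mu : {measure set T -> \bar R}).

(** The exponential lies above its tangent at ln c. *)
Lemma mean_exp_le (v c : R) : 0 < c -> v <= c^-1 * expR v + (ln c - 1).
Proof.
move=> c0; have := expR_ge1Dx (v - ln c).
by rewrite expRD expRN lnK ?posrE// mulrC; lra.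
Qed.

(** The density P_ L is spread over a region of logarithmic width L and compared
    with a fixed density N. By convexity of the exponential, spreading makes the
    integral of V against P_ L at most a constant minus m ln L. *)
Lemma log_blowup (V E N : T -> R) (P_ : R -> T -> R) (B m : R) : 0 < m -> 0 <= B ->
  mu.-integrable setT (EFin \o E) ->
  (forall L, 1 <= L ->
    [/\ forall x, 0 <= P_ L x,
        mu.-integrable setT (EFin \o P_ L),
        mu.-integrable setT (EFin \o (fun x => V x * P_ L x)),
        \int[mu]_x P_ L x = m &
        forall x, expR (V x) * P_ L x <= B / L * E x]) ->
  (forall L, 1 <= L -> \int[mu]_x (V x * N x) <= \int[mu]_x (V x * P_ L x)) ->
  False.
Proof.
move=> m0 B0 IE HP HN.
pose C := B * \int[mu]_x E x - \int[mu]_x (V x * N x).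
pose L := expR (`|C| / m).
have L1 : 1 <= L by rewrite -expR0 ler_expR divr_ge0// ltW.
have L0 : 0 < L by exact: expR_gt0.
have [P0 IP IVP Pm PE] := HP L L1.
have : \int[mu]_x (V x * P_ L x) <=
    \int[mu]_x (B * E x + (- (`|C| / m) - 1) * P_ L x).
  apply: le_Rintegral => //; first by apply: intgD; exact: intgZ.
  move=> x _.
  have := @mean_exp_le (V x) L^-1; rewrite invr_gt0 invrK lnV ?posrE// expRK => /(_ L0) h.
  apply: (le_trans (ler_wpM2r (P0 x) h)); rewrite mulrDl lerD2r -mulrA.
  by rewrite -ler_pdivlMl// mulrCA mulrA; exact: PE.
rewrite RintegralD//; [|exact: intgZ|exact: intgZ].
rewrite !RintegralZl// Pm => h; have := HN L L1.
move=> /le_trans/(_ h).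
have -> : (- (`|C| / m) - 1) * m = - `|C| - m by field; rewrite gt_eqF.
by have := ler_norm C; rewrite /C; lra.
Qed.

End Blowup.

Section LogcompCalculus.
Context {R : realType}.

Lemma is_derive_logcomp (M : R) (phi dphi : R -> R) (q : R) :
  (forall t : R, is_derive t 1 phi (dphi t)) ->
  (forall t, M <= `|t| -> phi t = 0) ->
  is_derive q 1 (logcomp phi) (logcomp dphi q / q).
Proof.
move=> dp phi0; have [q0|q0] := ltrP 0 q.
  apply: (@near_eq_is_derive _ R R (phi \o @ln R)).
    by near=> y; rewrite /logcomp ifT//; near: y; exact: lt_nbhsr.
  rewrite /logcomp q0.
  exact: (@is_derive1_comp _ phi (@ln R) q _ _ (dp _) (is_derive1_ln q0)).
rewrite /logcomp ltNge q0/= mul0r.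
apply: (@near_eq_is_derive _ R R (cst 0)).
near=> y; rewrite -/(logcomp phi y) (logcomp_small phi0)// ltW//; near: y.
by apply: lt_nbhsl; exact: le_lt_trans q0 (expR_gt0 _).
Unshelve. all: by end_near. Qed.

Lemma logcomp_measurable (phi : R -> R) : measurable_fun [set: R] phi ->
  measurable_fun [set: R] (logcomp phi).
Proof.
move=> mphi; apply: measurable_fun_ifT.
- by apply: measurable_fun_ltr; [exact: measurable_cst|exact: measurable_id].
- exact: (measurableT_comp mphi (@measurable_ln R)).
- exact: measurable_cst.
Qed.

Lemma continuous_logcomp (M : R) (phi : R -> R) : continuous phi ->
  (forall t, M <= `|t| -> phi t = 0) -> continuous (logcomp phi).
Proof.
move=> cphi phi0 q; have C0 : CkOn setT 0 phi by split=> // t _; exact: cphi.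
exact: CkOn_cont (logcomp_smooth phi0 C0) I.
Qed.

Lemma logcomp_bounded (M : R) (phi : R -> R) : continuous phi ->
  (forall t, M <= `|t| -> phi t = 0) ->
  exists2 K, 0 <= K & forall q, `|logcomp phi q| <= K /\ `|logcomp phi q / q| <= K.
Proof.
move=> cphi phi0.
have [K0 HK0] := compact_support_bounded cphi (fun t tM => phi0 t (ltW tM)).
have K00 : 0 <= K0 by exact: le_trans (normr_ge0 _) (HK0 0).
have HK q : `|logcomp phi q| <= K0.
  by rewrite /logcomp; case: ifPn => // _; rewrite normr0.
exists (K0 + K0 * expR M); first by rewrite addr_ge0// mulr_ge0// expR_ge0.
move=> q; split; first by rewrite (le_trans (HK q))// lerDl mulr_ge0// expR_ge0.
apply: (@le_trans _ _ (K0 * expR M)); last by rewrite lerDr.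
have [qM|qM] := lerP q (expR (- M)).
  by rewrite (logcomp_small phi0 qM) mul0r normr0 mulr_ge0// expR_ge0.
have q0 : 0 < q by exact: lt_trans (expR_gt0 _) qM.
rewrite normrM; apply: ler_pM => //.
rewrite gtr0_norm ?invr_gt0//.
by rewrite -[expR M]invrK -expRN lef_pV2 ?posrE ?expR_gt0// ltW.
Qed.

Lemma logcompB (phi chi : R -> R) q :
  logcomp (fun t => phi t - chi t) q = logcomp phi q - logcomp chi q.
Proof. by rewrite /logcomp; case: ifP => // _; rewrite subr0. Qed.

Lemma logcomp_expRN (phi : R -> R) q :
  logcomp (fun t => phi t * expR (- t)) q = logcomp phi q / q.
Proof.
by rewrite /logcomp; case: ifPn => q0; rewrite ?mul0r// expRN lnK.
Qed.

Lemma logcomp_idM (phi : R -> R) q :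
  logcomp (fun t => t * phi t) q = ln q * logcomp phi q.
Proof. by rewrite /logcomp; case: ifPn => // _; rewrite mulr0. Qed.

Lemma logcomp_ge0 (phi : R -> R) q : (forall t, 0 <= phi t) -> 0 <= logcomp phi q.
Proof. by move=> h; rewrite /logcomp; case: ifP. Qed.

End LogcompCalculus.

Section Tent.
Context {R : realType}.
Variables (B : R) (F f b : R -> R).
Hypothesis rF : ramp 1 B F f b.

(** The profile of the test functions: its second derivative is negative on a
    fixed interval only, and at most of order 1/L elsewhere. *)
Definition tent (G : R -> R) (L t : R) : R := L * G (t / L) - G t.

Variable L : R.
Hypothesis L1 : 1 <= L.

Let L0 : 0 < L. Proof. exact: lt_le_trans L1. Qed.

Let rFL := ramp_scale L0 rF.

Lemma tent_ge0 t : 0 <= tent F L t.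
Proof. by rewrite subr_ge0; exact: ramp_le_scale L1 rF t. Qed.

Lemma tent_out t : L <= `|t| -> tent F L t = 0.
Proof.
rewrite /tent ler_normr => /orP[Lt|Lt].
  rewrite (ramp_hi rFL) ?mul1r// (ramp_hi rF) ?subrr//.
  exact: le_trans L1 Lt.
rewrite (ramp_lo rFL) ?mul1r 1?lerNr// (ramp_lo rF) ?subr0// lerNr.
exact: le_trans L1 Lt.
Qed.

Definition dtent (t : R) : R := f (t / L) - f t.
Definition ddtent (t : R) : R := b (t / L) / L - b t.

Lemma is_derive_tent (t : R) : is_derive t 1 (tent F L) (dtent t).
Proof. by apply: is_deriveB; [exact: ramp_d1 rFL t|exact: ramp_d1 rF t]. Qed.

Lemma is_derive_dtent (t : R) : is_derive t 1 dtent (ddtent t).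
Proof. by apply: is_deriveB; [exact: ramp_d2 rFL t|exact: ramp_d2 rF t]. Qed.

Lemma dtent_out t : L + 1 <= `|t| -> dtent t = 0.
Proof.
have h1 := L1; have h0 := L0.
rewrite /dtent ler_normr => /orP[Lt|Lt].
  by rewrite (ramp_d1_hi rFL) ?(ramp_d1_hi rF) ?subrr//; lra.
by rewrite (ramp_d1_lo rFL) ?(ramp_d1_lo rF) ?subrr//; lra.
Qed.

Lemma tent_smooth k : CkOn setT k (tent F L).
Proof.
apply: (@CkOn_ext _ _ setT k (fun t : R => L * F (t / L) + (-1) * F t)); first exact: openT.
  by move=> t _; rewrite mulN1r.
apply: CkOnD; [exact: openT|exact: ramp_smooth rFL k|].
by apply: CkOnM; [exact: openT|exact: CkOn_cst openT|exact: ramp_smooth rF k].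
Qed.

End Tent.

(** * The plane *)

Section DivergenceFree.
Context {R : realType}.
Notation mu := (@lebesgue_measure R).
Notation mu2 := (mu \x mu)%E.
Notation T1 := (measurableTypeR R).

Lemma integral_derive_compact (g dg : R -> R) (r : R) :
  (forall x : R, is_derive x 1 g (dg x)) -> continuous dg ->
  (forall x, r <= `|x| -> g x = 0) -> (forall x, r < `|x| -> dg x = 0) ->
  (\int[mu]_x (dg x)%:E = 0)%E.
Proof.
move=> dgg cdg g0 dg0; pose s := `|r| + 1.
have s0 : 0 < s by rewrite ltr_wpDl.
have rs : r < s by rewrite /s; have := ler_norm r; lra.
have Idg : mu.-integrable `[(- s), s] (EFin \o dg).
  apply: continuous_compact_integrable; first exact: segment_compact.
  exact: continuous_subspaceT.
have := @FTC_segment R dg g (- s) s.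
rewrite gtrN// !g0 ?normrN ?(gtr0_norm s0) ?(ltW rs)// subrr => /(_ isT Idg) H.
have : \int[mu]_(x in `[(- s), s]) dg x = 0.
  apply: H => //; last by move=> x _; exact: cdg.
  by apply: continuous_subspaceT => x; exact: is_derive_continuous (dgg x).
have -> : (\int[mu]_x (dg x)%:E = \int[mu]_(x in `[(- s)%R, s]) (dg x)%:E)%E.
  rewrite [RHS]integral_mkcond; apply: eq_integral => x _.
  rewrite patchE; case: ifPn => //; rewrite notin_setE/= in_itv/= -ler_norml => /negP.
  by rewrite -ltNge => sx; rewrite dg0// (lt_trans rs).
rewrite /Rintegral => E; rewrite -[LHS]fineK ?E//.
exact: integrable_fin_num.
Qed.

Lemma sqn2_measurable : measurable_fun [set: T1 * T1] (@sqn2 R).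
Proof.
have m1 : measurable_fun [set: T1 * T1] (fst : T1 * T1 -> R) by exact: measurable_fst.
have m2 : measurable_fun [set: T1 * T1] (snd : T1 * T1 -> R) by exact: measurable_snd.
by apply: measurable_funD; exact: measurable_funM.
Qed.

Lemma plane_compact_integrable (h : T1 * T1 -> R) (K M : R) :
  measurable_fun setT h -> 0 <= K -> (forall x, `|h x| <= K) ->
  (forall x, M < sqn2 x -> h x = 0) -> mu2.-integrable setT (EFin \o h).
Proof.
move=> mh K0 hK hM; pose r := 1 + `|M|.
pose box := `[(- r), r]%classic `*` `[(- r), r]%classic : set (T1 * T1).
have mbox : measurable box by apply: measurableX; exact: measurable_itv.
have Ibox : mu2.-integrable setT (EFin \o (\1_box : _ -> R)).
  apply/integrableP; split; first exact/measurable_EFinP/measurable_indic.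
  under eq_integral do rewrite /= ger0_norm//.
  rewrite integral_indic// setIT.
  rewrite /box [X in (X < _)%E]product_measure1E; [|exact: measurable_itv|exact: measurable_itv].
  rewrite /= !lebesgue_measure_itv/=.
  by case: ifP => _; rewrite -?EFinD -?EFinM ?mule0 ltry.
apply: (integrable_dom mh _ (intgZ K Ibox)) => -[x y].
rewrite indicE; have [_|xb] := boolP ((x, y) \in box); first by rewrite mulr1.
rewrite mulr0 hM ?normr0//; move: xb; rewrite notin_setE /box/= !in_itv/= -!ler_norml.
move=> /not_andP; rewrite /sqn2/= => xy.
have e (z : R) : z * z = `|z| * `|z| by rewrite -normrM ger0_norm// -expr2 sqr_ge0.
have big (z : R) : ~ `|z| <= r -> M < z * z.
  move=> /negP; rewrite -ltNge /r e => zr.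
  by have := ler_norm M; have := normr_ge0 M; nra.
have x2 := sqr_ge0 x; have y2 := sqr_ge0 y; rewrite expr2 in x2; rewrite expr2 in y2.
by case: xy => /big; lra.
Qed.

Variables (M : R) (B dB : R -> R).
Hypothesis dBB : forall t : R, is_derive t 1 B (dB t).
Hypothesis cdB : continuous dB.
Hypothesis B0 : forall t, M <= `|t| -> B t = 0.
Hypothesis dB0 : forall t, M <= `|t| -> dB t = 0.

Let A := logcomp (fun t => B t * expR (- t)).
Let dA := logcomp (fun t => (dB t - B t) * expR (- t) * expR (- t)).

Let cB : continuous B.
Proof. by move=> t; exact: is_derive_continuous (dBB t). Qed.

Let cexpN : continuous (fun t : R => expR (- t)).
Proof.
move=> t; apply: (@continuous_comp _ _ _ (fun t : R => - t) expR).
  exact: opp_continuous.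
exact: continuous_expR.
Qed.

Let cA : continuous (fun t => B t * expR (- t)).
Proof. by move=> t; apply: cvgM; [exact: cB|exact: cexpN]. Qed.

Let cdA : continuous (fun t => (dB t - B t) * expR (- t) * expR (- t)).
Proof.
move=> t; apply: cvgM; last exact: cexpN.
by apply: cvgM; [apply: cvgB; [exact: cdB|exact: cB]|exact: cexpN].
Qed.

Let A0 t : M <= `|t| -> B t * expR (- t) = 0.
Proof. by move=> /B0 ->; rewrite mul0r. Qed.

Let dA0 t : M <= `|t| -> (dB t - B t) * expR (- t) * expR (- t) = 0.
Proof. by move=> tM; rewrite B0// dB0// subrr !mul0r. Qed.

Let is_derive_A (q : R) : is_derive q 1 A (dA q).
Proof.
have d (t : R) : is_derive t 1 (fun t => B t * expR (- t)) ((dB t - B t) * expR (- t)).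
  have d1 := is_derive_affine (is_derive_expR (-1 * t + 0)).
  apply: (is_deriveW (is_deriveM (dBB t) d1)) => [s|].
    by rewrite -[LHS]/(B s * expR (-1 * s + 0)) mulN1r addr0.
  by rewrite /GRing.scale/= mulN1r addr0; ring.
have := is_derive_logcomp q d A0.
by rewrite /dA -[X in is_derive _ _ _ X -> _]logcomp_expRN.
Qed.

Let slice (x c : R) : is_derive x 1 (fun x => x * A (x * x + c))
  (A (x * x + c) + 2 * (x * x) * dA (x * x + c)).
Proof.
have d1 : is_derive x 1 (fun x : R => x * x + c) (2 * x).
  apply: (is_deriveW (is_deriveD (is_deriveM (is_derive_id x (1 : R)) (is_derive_id x (1 : R))) (is_derive_cst c x 1))) => //.
  by rewrite /GRing.scale/=; ring.
have d2 := @is_derive1_comp _ A (fun x : R => x * x + c) x _ _ (is_derive_A _) d1.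
apply: (is_deriveW (is_deriveM (is_derive_id x (1 : R)) d2)) => //.
by rewrite /GRing.scale/=; ring.
Qed.

Let out (phi : R -> R) (q : R) : (forall t, M <= `|t| -> phi t = 0) ->
  expR M < q -> logcomp phi q = 0.
Proof. by move=> phi0 /ltW; exact: logcomp_large. Qed.

Let k1 (x : T1 * T1) : R := A (sqn2 x) + 2 * (x.1 * x.1) * dA (sqn2 x).
Let k2 (x : T1 * T1) : R := A (sqn2 x) + 2 * (x.2 * x.2) * dA (sqn2 x).

Let slice_int c : 0 <= c ->
  (\int[mu]_x (A (x * x + c) + 2 * (x * x) * dA (x * x + c))%:E = 0)%E.
Proof.
move=> c0; pose r := 1 + expR M.
have r0 : 1 < r by rewrite /r; have := expR_gt0 M; lra.
have big (x : R) : r <= `|x| -> expR M < x * x + c.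
  have -> : x * x = `|x| * `|x| by rewrite -normrM ger0_norm// -expr2 sqr_ge0.
  by move=> xr; rewrite /r in xr r0; nra.
apply: (@integral_derive_compact (fun x => x * A (x * x + c)) _ r).
- by move=> x; exact: slice.
- have cq : continuous (fun x : R => x * x + c).
    by move=> x; apply: cvgD; [apply: cvgM; exact: cvg_id|exact: cvg_cst].
  have c1 : continuous (fun x : R => A (x * x + c)).
    move=> x; apply: (@continuous_comp _ _ _ (fun x : R => x * x + c) A); first exact: cq.
    exact: continuous_logcomp cA A0 _.
  have c2 : continuous (fun x : R => dA (x * x + c)).
    move=> x; apply: (@continuous_comp _ _ _ (fun x : R => x * x + c) dA); first exact: cq.
    exact: continuous_logcomp cdA dA0 _.
  move=> x; apply: cvgD; first exact: c1.
  apply: cvgM; last exact: c2.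
  by apply: cvgM; [exact: cvg_cst|apply: cvgM; exact: cvg_id].
- by move=> x /big xr; rewrite /A out// mulr0.
- by move=> x /ltW/big xr; rewrite /A /dA !out// mulr0 addr0.
Qed.

Let meas_logcomp (phi : R -> R) : continuous phi ->
  measurable_fun [set: T1 * T1] (fun x => logcomp phi (sqn2 x)).
Proof.
move=> cphi.
exact: (measurableT_comp (logcomp_measurable (continuous_measurable_fun cphi)) sqn2_measurable).
Qed.

Let k_int (p : T1 * T1 -> R) : measurable_fun setT p ->
  (forall x, p x * p x <= sqn2 x) ->
  mu2.-integrable setT (EFin \o (fun x => A (sqn2 x) + 2 * (p x * p x) * dA (sqn2 x))).
Proof.
move=> mp ple.
have [K1 K10 H1] := logcomp_bounded cA A0.
have [K2 K20 H2] := logcomp_bounded cdA dA0.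
have eM := expR_ge0 M.
apply: (@plane_compact_integrable _ (K1 + 2 * (expR M * K2)) (expR M)).
- apply: measurable_funD; first exact: meas_logcomp.
  apply: measurable_funM; last exact: meas_logcomp.
  by apply: measurable_funM; [exact: measurable_cst|exact: measurable_funM].
- by rewrite addr_ge0// mulr_ge0// mulr_ge0.
- move=> x; rewrite (le_trans (ler_normD _ _))// lerD ?(H1 _).1//.
  have [qM|qM] := lerP (sqn2 x) (expR M); last first.
    by rewrite /dA out// mulr0 normr0 mulr_ge0// mulr_ge0.
  rewrite -mulrA normrM ger0_norm// ler_pM2l// normrM ler_pM ?(H2 _).1//.
  by rewrite ger0_norm -?expr2 ?sqr_ge0//; rewrite expr2 (le_trans (ple x)).
- by move=> x xM; rewrite /A /dA !out// mulr0 addr0.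
Qed.

(** A radial density B'(ln q) / q is the divergence of the compactly supported
    field x B(ln q) / q, so each half of it integrates to 0 along the lines of
    one coordinate direction. *)
Lemma plane_integral0 : mu2.-integrable setT
    (EFin \o (fun x : T1 * T1 => logcomp dB (sqn2 x) / sqn2 x)) /\
  \int[mu2]_x (logcomp dB (sqn2 x) / sqn2 x) = 0.
Proof.
have sq0 (z : R) : 0 <= z * z by rewrite -expr2 sqr_ge0.
have I1 : mu2.-integrable setT (EFin \o k1).
  apply: (k_int (p := fst)) => [|x]; first exact: measurable_fst.
  by rewrite /sqn2 lerDl.
have I2 : mu2.-integrable setT (EFin \o k2).
  apply: (k_int (p := snd)) => [|x]; first exact: measurable_snd.
  by rewrite /sqn2 lerDr.
have E : (fun x : T1 * T1 => logcomp dB (sqn2 x) / sqn2 x) =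
    (fun x => 2^-1 * (k1 x + k2 x)).
  apply/funext => x; rewrite /k1 /k2 /A /dA !logcomp_expRN logcompB.
  have -> : 2^-1 * (logcomp B (sqn2 x) / sqn2 x + 2 * (x.1 * x.1) *
     ((logcomp dB (sqn2 x) - logcomp B (sqn2 x)) / sqn2 x / sqn2 x) +
     (logcomp B (sqn2 x) / sqn2 x + 2 * (x.2 * x.2) *
     ((logcomp dB (sqn2 x) - logcomp B (sqn2 x)) / sqn2 x / sqn2 x))) =
   logcomp B (sqn2 x) / sqn2 x + sqn2 x *
     ((logcomp dB (sqn2 x) - logcomp B (sqn2 x)) / sqn2 x / sqn2 x).
    move: (logcomp B _) (logcomp dB _) (sqn2 x)^-1 => p q i.
    by rewrite /sqn2; field.
  have [->|q0] := eqVneq (sqn2 x) 0; first by rewrite invr0 !mulr0 addr0.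
  by field.
have Z1 : \int[mu2]_x k1 x = 0.
  rewrite /Rintegral -(integral21_prod_meas1 I1) /fubini_G.
  have E1 y : (\int[mu]_x (k1 (x, y))%:E = 0)%E by exact: slice_int (sq0 y).
  under eq_integral do rewrite E1.
  by rewrite integral0.
have Z2 : \int[mu2]_x k2 x = 0.
  rewrite /Rintegral -(integral12_prod_meas1 I2) /fubini_F.
  have E2 x : (\int[mu]_y (k2 (x, y))%:E = 0)%E.
    rewrite -[RHS](slice_int (sq0 x)); apply: eq_integral => y _.
    by rewrite /k2 /sqn2/= [x * x + _]addrC.
  under eq_integral do rewrite E2.
  by rewrite integral0.
split; first by rewrite E; apply: intgZ; exact: intgD.
have -> : \int[mu2]_x (logcomp dB (sqn2 x) / sqn2 x) =
    \int[mu2]_x (2^-1 * (k1 x + k2 x)).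
  by apply: eq_Rintegral => x _; rewrite -[LHS]/((fun x => logcomp dB (sqn2 x) / sqn2 x) x) E.
rewrite RintegralZl//; last exact: intgD.
by rewrite RintegralD// Z1 Z2 addr0 mulr0.
Qed.

End DivergenceFree.

Section PlaneLaplacian.
Context {R : realType}.
Variables (M : R) (phi dphi ddphi : R -> R).
Hypothesis d1 : forall t : R, is_derive t 1 phi (dphi t).
Hypothesis d2 : forall t : R, is_derive t 1 dphi (ddphi t).
Hypothesis phi0 : forall t, M <= `|t| -> phi t = 0.
Hypothesis dphi0 : forall t, M <= `|t| -> dphi t = 0.

Let Th1 := logcomp (fun t => dphi t * expR (- t)).
Let Th2 := logcomp (fun t => (ddphi t - dphi t) * expR (- t) * expR (- t)).

Let is_derive_Th (q : R) : is_derive q 1 (logcomp phi) (Th1 q).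
Proof. by have := is_derive_logcomp q d1 phi0; rewrite /Th1 logcomp_expRN. Qed.

Let is_derive_Th1 (q : R) : is_derive q 1 Th1 (Th2 q).
Proof.
have d (t : R) : is_derive t 1 (fun t => dphi t * expR (- t))
    ((ddphi t - dphi t) * expR (- t)).
  have d3 := is_derive_affine (is_derive_expR (-1 * t + 0)).
  apply: (is_deriveW (is_deriveM (d2 t) d3)) => [s|].
    by rewrite -[LHS]/(dphi s * expR (-1 * s + 0)) mulN1r addr0.
  by rewrite /GRing.scale/= mulN1r addr0; ring.
have z t : M <= `|t| -> dphi t * expR (- t) = 0 by move=> /dphi0 ->; rewrite mul0r.
have := is_derive_logcomp q d z.
by rewrite /Th2 -[X in is_derive _ _ _ X -> _]logcomp_expRN.
Qed.

Let is_derive_sqn2 (x v : R * R) :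
  is_derive x v (@sqn2 R) (2 * (x.1 * v.1 + x.2 * v.2)).
Proof.
have f1 : is_derive x v (fst : R * R -> R) v.1 by exact: is_derive_linear.
have f2 : is_derive x v (snd : R * R -> R) v.2 by exact: is_derive_linear.
have := is_deriveD (is_deriveM f1 f1) (is_deriveM f2 f2).
have -> : fst * fst + snd * snd = @sqn2 R by [].
by rewrite /GRing.scale/=; move/is_derive_eq; apply; ring.
Qed.

Let first (v x : R * R) :
  is_derive x v (logcomp phi \o @sqn2 R) (Th1 (sqn2 x) * (2 * (x.1 * v.1 + x.2 * v.2))).
Proof. by apply: is_derive_comp_dir; [exact: is_derive_sqn2|exact: is_derive_Th]. Qed.

(** The logarithm of q is harmonic off the origin, with squared gradient 4 / q, so
    that only the second derivative of phi survives. *)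
Lemma laplacian_radial (x : R * R) :
  laplacian (logcomp phi \o @sqn2 R) x = 4 * (logcomp ddphi (sqn2 x) / sqn2 x).
Proof.
have D v : 'D_v (logcomp phi \o @sqn2 R) =
    fun x => Th1 (sqn2 x) * (2 * (x.1 * v.1 + x.2 * v.2)).
  by apply/funext => y; have [_ ->] := first v y.
have dd v : 'D_v ('D_v (logcomp phi \o @sqn2 R)) x =
    Th2 (sqn2 x) * (2 * (x.1 * v.1 + x.2 * v.2)) ^+ 2 +
    Th1 (sqn2 x) * (2 * (v.1 * v.1 + v.2 * v.2)).
  rewrite D.
  have e1 : is_derive x v (Th1 \o @sqn2 R) (Th2 (sqn2 x) * (2 * (x.1 * v.1 + x.2 * v.2))).
    by apply: is_derive_comp_dir; [exact: is_derive_sqn2|exact: is_derive_Th1].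
  have e2 : is_derive x v (fun y : R * R => 2 * (y.1 * v.1 + y.2 * v.2))
      (2 * (v.1 * v.1 + v.2 * v.2)).
    apply: (@is_derive_linear _ _ (fun y : R * R => 2 * (y.1 * v.1 + y.2 * v.2))).
    by move=> h w y /=; rewrite /GRing.scale/=; ring.
  have [_ E] := is_deriveM e1 e2.
  by rewrite [LHS]E /GRing.scale/=; ring.
rewrite /laplacian !dd /= /Th2 /Th1 !logcomp_expRN logcompB.
have -> : logcomp dphi (sqn2 x) / sqn2 x = sqn2 x * (logcomp dphi (sqn2 x) / sqn2 x / sqn2 x).
  have [->|q0] := eqVneq (sqn2 x) 0; first by rewrite invr0 !mulr0.
  by field.
have -> : logcomp ddphi (sqn2 x) / sqn2 x = sqn2 x * (logcomp ddphi (sqn2 x) / sqn2 x / sqn2 x).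
  have [->|q0] := eqVneq (sqn2 x) 0; first by rewrite invr0 !mulr0.
  by field.
move: (logcomp _ _) (logcomp dphi _) (sqn2 x)^-1 => p q i.
by rewrite /sqn2; ring.
Qed.

End PlaneLaplacian.

Section PlaneSolution.
Context {R : realType}.
Notation mu := (@lebesgue_measure R).
Notation mu2 := (mu \x mu)%E.
Notation T1 := (measurableTypeR R).

Lemma radial_integrable (M : R) (beta : R -> R) : continuous beta ->
  (forall t, M <= `|t| -> beta t = 0) ->
  mu2.-integrable setT (EFin \o (fun x : T1 * T1 => logcomp beta (sqn2 x) / sqn2 x)).
Proof.
move=> cb b0; have [K K0 HK] := logcomp_bounded cb b0.
apply: (@plane_compact_integrable _ _ K (expR M)) => //.
- apply: measurable_fun_div; last exact: sqn2_measurable.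
  exact: (measurableT_comp (logcomp_measurable (continuous_measurable_fun cb)) sqn2_measurable).
- by move=> x; exact: (HK _).2.
- by move=> x /ltW xM; rewrite (logcomp_large b0 xM) mul0r.
Qed.

Variable u : R * R -> R.
Hypothesis lu : locally_integrable2 u.

Lemma radial_u_integrable (M : R) (beta : R -> R) : continuous beta ->
  (forall t, M <= `|t| -> beta t = 0) ->
  mu2.-integrable setT
    (EFin \o (fun x : T1 * T1 => u x * (logcomp beta (sqn2 x) / sqn2 x))).
Proof.
move=> cb b0; have [K K0 HK] := logcomp_bounded cb b0.
have [mu_ Iu] := lu.
pose D : set (T1 * T1) := [set x | sqn2 x <= expR M].
have mD : measurable D.
  have := sqn2_measurable measurableT (measurable_itv `]-oo, (expR M)]).
  by rewrite setTI; congr measurable; apply/seteqP; split=> x /=; rewrite in_itv.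
have mu' : measurable_fun [set: T1 * T1] u by [].
have ID : mu2.-integrable D (EFin \o u).
  apply/integrableP; split.
    by apply/measurable_EFinP; exact: measurable_funTS.
  exact: Iu _ (@compact_sqn2 R (expR M)).
have I1 : mu2.-integrable setT (EFin \o (u \_ D)).
  by rewrite -restrict_EFin; apply/integrable_restrict => //; rewrite setTI.
apply: (integrable_dom _ _ (intgZ K (intg_norm I1))).
  apply: measurable_funM => //; apply: measurable_fun_div; last exact: sqn2_measurable.
  exact: (measurableT_comp (logcomp_measurable (continuous_measurable_fun cb)) sqn2_measurable).
move=> x; rewrite patchE; case: (boolP (x \in D)) => [_|].
  by rewrite normrM mulrC ler_wpM2r// (HK _).2.
rewrite notin_setE/= => /negP; rewrite -ltNge => /ltW xM.
by rewrite (logcomp_large b0 xM) mul0r mulr0 !normr0 mulr0.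
Qed.

Lemma radial_mass_gt0 (M : R) (beta : R -> R) : continuous beta ->
  (forall t, M <= `|t| -> beta t = 0) -> (forall t, 0 <= beta t) ->
  (exists t, 0 < beta t) ->
  0 < \int[mu2]_x (logcomp beta (sqn2 x) / sqn2 x).
Proof.
move=> cb b0 bge [t bt].
pose q := expR t; have q0 : 0 < q by exact: expR_gt0.
pose h (q : R) := logcomp beta q / q.
have h0 y : 0 <= y -> 0 <= h y by move=> y0; rewrite divr_ge0// logcomp_ge0.
have hq : 0 < h q by rewrite divr_gt0// /logcomp q0 expRK.
have ch : {for q, continuous h}.
  by apply: cvgM; [exact: continuous_logcomp cb b0 q|apply: inv_continuous; rewrite gt_eqF].
have /nbhs_ballP[e /= e0 He] : \forall y \near q, h q / 2 < h y.
  have hh : h q / 2 < h q by rewrite ltr_pdivrMr// mulr_natr mulr2n ltrDl.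
  exact: (ch _ (lt_nbhsr hh)).
pose s := Num.sqrt q; have s0 : 0 < s by rewrite sqrtr_gt0.
have sq : s * s = q by rewrite -expr2 sqr_sqrtr// ltW.
pose eta := e / (2 * s + 3 + e).
have den0 : 0 < 2 * s + 3 + e by rewrite !addr_gt0// mulr_gt0.
have eta0 : 0 < eta by rewrite divr_gt0.
have etaE : eta * (2 * s + 3 + e) = e by rewrite divfK// gt_eqF.
pose box : set (T1 * T1) := `[s, (s + eta)]%classic `*` `[0, eta]%classic.
have mbox : measurable box by apply: measurableX; exact: measurable_itv.
have mubox : (mu2 box = (eta * eta)%:E)%E.
  rewrite /box product_measure1E; [|exact: measurable_itv|exact: measurable_itv].
  rewrite /= !lebesgue_measure_itv/= !lte_fin ltrDl eta0.
  by rewrite -!EFinB -EFinM; congr (_%:E); ring.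
have Ebox : (\int[mu2]_x (\1_box x)%:E = (eta * eta)%:E)%E.
  by rewrite integral_indic// setIT; exact: mubox.
have Ibox : mu2.-integrable setT (EFin \o (\1_box : _ -> R)).
  apply/integrableP; split; first exact/measurable_EFinP/measurable_indic.
  under eq_integral do rewrite /= ger0_norm//.
  by rewrite Ebox ltry.
apply: (@lt_le_trans _ _ (\int[mu2]_x (h q / 2 * \1_box x))).
  have hq2 : 0 < h q / 2 by exact: divr_gt0.
  rewrite RintegralZl//; apply: mulr_gt0 => //.
  by rewrite [X in 0 < X](congr1 fine Ebox)/= mulr_gt0.
apply: le_Rintegral => //; first exact: intgZ.
  exact: radial_integrable cb b0.
move=> [x y] _; rewrite indicE; case: (boolP (_ \in _)) => [|_]; last first.
  by rewrite mulr0 h0// /sqn2 addr_ge0// -expr2 sqr_ge0.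
rewrite inE /box/= !in_itv/= => -[/andP[x1 x2] /andP[y1 y2]].
(* eta is so small that all points of the box have squared norm within e of q. *)
rewrite mulr1 ltW//; apply: He.
rewrite /ball/= /sqn2/= ltr_norml; apply/andP; split; nra.
Qed.

End PlaneSolution.

Section RampFacts.
Context {R : realType}.
Variables (B : R) (F f b : R -> R).
Hypothesis rF : ramp 1 B F f b.

Lemma ramp_continuous_d2 : continuous b.
Proof. by move=> t; exact: CkOn_cont (ramp_smooth_d2 rF 0%N) I. Qed.

Lemma ramp_d2_pos : exists t, 0 < b t.
Proof.
have [|c _] := @MVT_global R f b (-2) 2 (ramp_d2 rF); first by lra.
rewrite (ramp_d1_hi rF) ?(ramp_d1_lo rF); [|lra|lra].
by exists c; lra.
Qed.

End RampFacts.

Lemma no_solution2 (R : realType) : ~ exists u : R * R -> R, is_solution2 u.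
Proof.
move=> [u [lu IE Hu]].
have [B [F [f [b [B0 rF]]]]] := @exists_ramp R.
pose bL (L t : R) : R := b (t / L) / L.
have rFL L : 0 < L -> ramp (1 * L) (B / L) (fun t => L * F (t / L)) (fun t => f (t / L)) (bL L).
  by move=> L0; exact: ramp_scale.
have cb : continuous b by exact: ramp_continuous_d2 rF.
have cbL L : 0 < L -> continuous (bL L).
  by move=> L0 t; exact: CkOn_cont (ramp_smooth_d2 (rFL L L0) 0%N) I.
have b0 t : 2 <= `|t| -> b t = 0 by move=> h; apply: (ramp_d2_out rF); lra.
have bL0 L t : 0 < L -> L + 1 <= `|t| -> bL L t = 0.
  by move=> L0 h; apply: (ramp_d2_out (rFL L L0)); rewrite mul1r; lra.
pose rad (beta : R -> R) (x : R * R) := logcomp beta (sqn2 x) / sqn2 x.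
pose mu2 := (@lebesgue_measure R \x @lebesgue_measure R)%E.
pose V (x : R * R) := 2 * u x + ln (sqn2 x).
have lnrad beta x : ln (sqn2 x) * rad beta x = rad (fun t => t * beta t) x.
  by rewrite /rad logcomp_idM mulrA.
have IV M beta : continuous beta -> (forall t, M <= `|t| -> beta t = 0) ->
    mu2.-integrable setT (EFin \o (fun x => V x * rad beta x)) /\
    \int[mu2]_x (V x * rad beta x) =
    2 * \int[mu2]_x (u x * rad beta x) + \int[mu2]_x rad (fun t => t * beta t) x.
  move=> cbeta beta0.
  have I1 := radial_u_integrable lu cbeta beta0.
  have I2 : mu2.-integrable setT (EFin \o rad (fun t => t * beta t)).
    apply: (@radial_integrable R M) => [t|t /beta0 ->]; last by rewrite mulr0.
    by apply: cvgM; [exact: cvg_id|exact: cbeta].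
  have E : (fun x => V x * rad beta x) =
      (fun x => 2 * (u x * rad beta x) + rad (fun t => t * beta t) x).
    by apply/funext => x; rewrite -lnrad /V; ring.
  rewrite E; split; first by apply: intgD => //; exact: intgZ.
  by rewrite RintegralD//; [rewrite RintegralZl|exact: intgZ].
have tz L (dB Bf : R -> R) : (forall t : R, is_derive t 1 Bf (dB t)) -> continuous dB ->
    (forall t, L + 1 <= `|t| -> Bf t = 0) -> (forall t, L + 1 <= `|t| -> dB t = 0) ->
    \int[mu2]_x rad dB x = 0.
  by move=> h1 h2 h3 h4; exact: (plane_integral0 h1 h2 h3 h4).2.
have radB beta1 beta2 x : rad (fun t => beta1 t - beta2 t) x = rad beta1 x - rad beta2 x.
  by rewrite /rad logcompB mulrBl.
have Ib : mu2.-integrable setT (EFin \o rad b) by exact: radial_integrable cb b0.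
have IbL L : 0 < L -> mu2.-integrable setT (EFin \o rad (bL L)).
  by move=> L0; apply: radial_integrable (cbL L L0) (fun t => bL0 L t L0).
have IuL L : 0 < L -> mu2.-integrable setT (EFin \o (fun x => u x * rad (bL L) x)).
  move=> L0.
  exact (@radial_u_integrable R u lu (L + 1) (bL L) (cbL L L0) (fun t => bL0 L t L0)).
have Iub : mu2.-integrable setT (EFin \o (fun x => u x * rad b x)).
  exact (@radial_u_integrable R u lu 2 b cb b0).
have ctM (beta : R -> R) : continuous beta -> continuous (fun t : R => t * beta t).
  by move=> cbeta t; apply: cvgM; [exact: cvg_id|exact: cbeta].
(* The densities differ by a second derivative of the tent. *)
have mass L : 1 <= L -> \int[mu2]_x rad (bL L) x = \int[mu2]_x rad b x.
  move=> L1; have L0 : 0 < L by exact: lt_le_trans L1.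
  apply/eqP; rewrite -subr_eq0 -RintegralB//; last exact: IbL.
  apply/eqP; transitivity (\int[mu2]_x rad (ddtent b L) x).
    by apply: eq_Rintegral => x _; rewrite -radB.
  apply: (tz L (ddtent b L) (dtent f L)).
  - exact (is_derive_dtent rF L1).
  - by move=> t; apply: cvgB; [exact: cbL|exact: cb].
  - by move=> t tL; exact (dtent_out rF L1 tL).
  - by move=> t tL; rewrite /ddtent -/(bL L t) bL0// b0 ?subrr//; lra.
(* Times t, a second derivative is still the derivative of a function of compact
   support, by partial integration. *)
have moment L : 1 <= L ->
    \int[mu2]_x rad (fun t => t * bL L t) x = \int[mu2]_x rad (fun t => t * b t) x.
  move=> L1; have L0 : 0 < L by exact: lt_le_trans L1.
  apply/eqP; rewrite -subr_eq0 -RintegralB//; last 2 first.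
  - apply: (@radial_integrable R (L + 1)); first exact/ctM/cbL.
    by move=> t tL; rewrite bL0// mulr0.
  - apply: (@radial_integrable R 2); first exact: ctM.
    by move=> t tL; rewrite b0// mulr0.
  apply/eqP; transitivity (\int[mu2]_x rad (fun t => t * ddtent b L t) x).
    apply: eq_Rintegral => x _; rewrite -radB; congr (logcomp _ _ / _).
    by apply/funext => t; rewrite /ddtent -/(bL L t); ring.
  apply: (tz L _ (fun t => t * dtent f L t - tent F L t)).
  - move=> t; apply: (is_deriveW (is_deriveB (is_deriveM (is_derive_id t (1 : R))
      (is_derive_dtent rF L1 t)) (is_derive_tent rF L1 t))) => //.
    by rewrite /GRing.scale/=; ring.
  - by apply: ctM => t; apply: cvgB; [exact: cbL|exact: cb].
  - by move=> t tL; rewrite (dtent_out rF L1 tL) (tent_out rF L1) ?mulr0 ?subrr//; lra.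
  - by move=> t tL; rewrite /ddtent -/(bL L t) bL0// b0 ?subrr ?mulr0//; lra.
apply: (@log_blowup R _ _ mu2 V (fun x => expR (2 * u x)) (rad b)
  (fun L => rad (bL L)) B (\int[mu2]_x rad b x)) => //.
- exact: radial_mass_gt0 cb b0 (ramp_ge0 rF) (ramp_d2_pos rF).
- exact: ltW.
- move=> L L1; have L0 : 0 < L by exact: lt_le_trans L1.
  have q0 (x : R * R) : 0 <= sqn2 x by rewrite /sqn2 addr_ge0// -expr2 sqr_ge0.
  split.
  + by move=> x; rewrite divr_ge0// logcomp_ge0// => t; exact: ramp_ge0 (rFL L L0) t.
  + exact: IbL.
  + exact: (IV (L + 1) _ (cbL L L0) (fun t => bL0 L t L0)).1.
  + exact: mass.
  + move=> x; rewrite /V /rad /logcomp; case: ifPn => [qx|_]; last first.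
      by rewrite mul0r mulr0 mulr_ge0 ?expR_ge0// divr_ge0 ?(ltW B0)// ltW.
    rewrite expRD lnK ?posrE// mulrACA [X in _ * X]mulrC.
    rewrite mulVf ?gt_eqF// mulr1 [leRHS]mulrC ler_pM2l ?expR_gt0//.
    exact: ramp_le (rFL L L0) _.
- move=> L L1; have L0 : 0 < L by exact: lt_le_trans L1.
  rewrite (IV (L + 1) _ (cbL L L0) (fun t => bL0 L t L0)).2 (IV 2 _ cb b0).2 (moment L L1).
  rewrite lerD2r ler_pM2l// -subr_ge0 -RintegralB//; last exact: IuL.
  have T := @test_function_radial R L (tent F L) (tent_out rF L1) _ (@sqn2 R)
    (tent_smooth rF L1) (@sqn2_smooth R) _ (@compact_sqn2 R).
  have {}T := T ltac:(by rewrite /sqn2 /= !mulr0 addr0).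
  have := Hu _ T.
  have -> : \int[mu2]_x (u x * - laplacian (logcomp (tent F L) \o sqn2) x) =
      \int[mu2]_x (- 4 * (u x * rad (bL L) x - u x * rad b x)).
    apply: eq_Rintegral => x _.
    have tout t : L + 1 <= `|t| -> tent F L t = 0.
      by move=> tL; apply: (tent_out rF L1); lra.
    have lap := laplacian_radial (is_derive_tent rF L1) (is_derive_dtent rF L1)
      tout (fun t tL => dtent_out rF L1 tL).
    by rewrite lap -/(rad _ x) radB; ring.
  rewrite RintegralZl//; last first.
    by apply: intgB => //; exact: IuL.
  have : 0 <= \int[mu2]_x (expR (2 * u x) * (logcomp (tent F L) \o sqn2) x).
    apply: Rintegral_ge0 => x _; rewrite mulr_ge0 ?expR_ge0//=.
    by apply: logcomp_ge0 => t; exact (tent_ge0 rF L1 t).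
  by rewrite -oppr_le0 => /[swap] <-; rewrite mulNr oppr_le0 pmulr_rge0.
Qed.

(** * The half Laplacian on the line *)

Section FubiniReal.
Context {R : realType}.
Notation mu := (@lebesgue_measure R).
Notation mu2 := (mu \x mu)%E.
Notation T1 := (measurableTypeR R).

Lemma fubini_dom (k : T1 * T1 -> R) (H : T1 -> R) : measurable_fun setT k ->
  (forall x, (\int[mu]_y `|k (x, y)|%:E <= (H x)%:E)%E) ->
  mu.-integrable setT (EFin \o H) -> mu2.-integrable setT (EFin \o k).
Proof.
move=> mk kH IH.
have mEk : measurable_fun setT (EFin \o k) by exact/measurable_EFinP.
apply: (integrable12ltyP mu mu mEk).2.
apply: (@le_lt_trans _ _ (\int[mu]_x (H x)%:E)%E); last exact: integrable_lty.
apply: ge0_le_integral => //.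
- by move=> x _; exact: integral_ge0.
- apply: (measurable_fun_fubini_tonelli_F (fun z : T1 * T1 => `|k z|%:E)) => //.
  by apply/measurable_EFinP; exact: measurableT_comp.
- exact: measurable_int IH.
- by move=> x _; exact: kH.
Qed.

(** The slices are given almost everywhere only, which leaves out the steps at
    which a dilation degenerates. *)
Lemma fubini_val (k : T1 * T1 -> R) (G H : T1 -> R) :
  mu2.-integrable setT (EFin \o k) ->
  measurable_fun setT G -> measurable_fun setT H ->
  {ae mu, forall x, (\int[mu]_y (k (x, y))%:E)%E = (G x)%:E} ->
  {ae mu, forall y, (\int[mu]_x (k (x, y))%:E)%E = (H y)%:E} ->
  [/\ mu.-integrable setT (EFin \o G), mu.-integrable setT (EFin \o H) &
      \int[mu]_x G x = \int[mu]_y H y].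
Proof.
move=> Ik mG mH aeG aeH.
have E1 : ae_eq mu setT (fubini_F mu (EFin \o k)) (EFin \o G).
  by apply: filterS aeG => x E _.
have E2 : ae_eq mu setT (fubini_G mu (EFin \o k)) (EFin \o H).
  by apply: filterS aeH => x E _.
have IF := integrable_fubini_F Ik.
have mF := measurable_fubini_F Ik.
have mGG := measurable_fubini_G Ik.
have mG' : measurable_fun setT (EFin \o G) by exact/measurable_EFinP.
have mH' : measurable_fun setT (EFin \o H) by exact/measurable_EFinP.
have intae (f g : T1 -> \bar R) : measurable_fun setT f -> measurable_fun setT g ->
    ae_eq mu setT f g -> mu.-integrable setT f -> mu.-integrable setT g.
  move=> mf mg fg /integrableP[_ If]; apply/integrableP; split => //.
  have mA : measurable_fun setT (abse \o f) by exact: measurableT_comp.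
  have mB : measurable_fun setT (abse \o g) by exact: measurableT_comp.
  rewrite -(ae_eq_integral (abse \o g) (abse \o f) _ mA mB)//.
  by apply: filterS fg => x /= fgx Tx; rewrite fgx.
split.
- exact: (intae _ _ mF mG' E1 IF).
- apply: (intae _ _ mGG mH' E2); apply/integrableP; split; first exact mGG.
  have Hlt := (integrable21ltyP mu mu (measurable_int _ Ik)).1 Ik.
  apply: le_lt_trans Hlt; apply: ge0_le_integral => //.
  + exact: measurableT_comp.
  + apply: (measurable_fun_fubini_tonelli_G (abse \o (EFin \o k))) => [|z].
      by apply: measurableT_comp => //; exact: measurable_int Ik.
    exact: abse_ge0.
  + move=> y _; apply: le_abse_integral => //.
    exact: (measurableT_comp (measurable_int _ Ik) (pair2_measurable y)).
- have := Fubini Ik; rewrite (ae_eq_integral _ _ _ mF mG' E1)//.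
  by rewrite (ae_eq_integral _ _ _ mGG mH' E2)// /Rintegral => ->.
Qed.

End FubiniReal.

(** The properties of a compactly supported smooth function on which the second
    difference quotient depends. *)
Record bump {R : realType} (psi : R -> R) (rho K : R) : Prop := {
  bump_continuous : continuous psi;
  bump_radius : 1 <= rho;
  bump_out : forall x, rho < `|x| -> psi x = 0;
  bump_le : forall x, `|psi x| <= K;
  bump_diff : forall x h,
    `|2 * psi x - psi (x + h) - psi (x - h)| <= K * h ^+ 2 }.

Section HalfLaplacian.
Context {R : realType}.
Notation mu := (@lebesgue_measure R).
Notation mu2 := (mu \x mu)%E.
Notation T1 := (measurableTypeR R).

Variables (psi : R -> R) (rho K : R).
Hypothesis bpsi : bump psi rho K.

Let cpsi := bump_continuous bpsi.
Let rho1 := bump_radius bpsi.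
Let psi_out := bump_out bpsi.
Let psi_le := bump_le bpsi.
Let psi_diff := bump_diff bpsi.

Let K0 : 0 <= K. Proof. exact: le_trans (normr_ge0 _) (psi_le 0). Qed.

Definition second_diff (x h : R) : R :=
  (2 * psi x - psi (x + h) - psi (x - h)) / h ^+ 2.

(** The constant is 4 + 4 * 18, from the near and the far bound of the kernel. *)
Lemma second_diff_ker x h : `|second_diff x h| <= 76 * K * ker h.
Proof.
have [->|h0] := eqVneq h 0.
  by rewrite /second_diff expr0n/= invr0 mulr0 normr0 !mulr_ge0// ker_ge0.
have h2 : 0 < h ^+ 2 by rewrite exprn_even_gt0.
rewrite /second_diff normrM normfV (gtr0_norm h2).
have [h1|h1] := lerP `|h| 1.
  rewrite ler_pdivrMr// (le_trans (psi_diff x h))// ler_wpM2r ?(ltW h2)//.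
  by have := ker_ge_near h0 h1; have := K0; have := ker_ge0 h; nra.
have : `|2 * psi x - psi (x + h) - psi (x - h)| <= 4 * K.
  have a1 := psi_le x; have a2 := psi_le (x + h); have a3 := psi_le (x - h).
  rewrite !ler_norml in a1 a2 a3 *.
  by case/andP: a1 => ? ?; case/andP: a2 => ? ?; case/andP: a3 => ? ?; apply/andP; split; lra.
move=> hh; apply: (le_trans (ler_wpM2r _ hh)); first by rewrite invr_ge0 ltW.
have := @ker_ge_far _ h ltac:(lra); have := K0; have := ker_ge0 h; nra.
Qed.

Let W (x : R) : R := (1 + x ^+ 2)^-1.

(** When |x| > 2 rho, only steps h of size at least |x| / 2 reach the support of
    psi, which turns 1/h^2 into 4/x^2. *)
Definition sd_dom (x h : R) : R := W x *
  ((1 + 4 * rho ^+ 2) * (76 * K) * ker h + 8 * (`|psi (x + h)| + `|psi (x - h)|)).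

Lemma second_diff_dom x h : `|second_diff x h| <= sd_dom x h.
Proof.
have x2 := sqr_ge0 x; have r2 := sqr_ge0 rho.
have p1 : 0 < 1 + x ^+ 2 by lra.
rewrite /sd_dom /W mulrC ler_pdivlMr//.
have n1 := normr_ge0 (psi (x + h)); have n2 := normr_ge0 (psi (x - h)).
have kh := ker_ge0 h; have k0 := K0.
have [xr|xr] := lerP `|x| (2 * rho).
  apply: (@le_trans _ _ ((76 * K * ker h) * (1 + 4 * rho ^+ 2))).
    apply: ler_pM => //; [lra|exact: second_diff_ker|rewrite lerD2l].
    rewrite -[x ^+ 2]real_normK ?num_real// (_ : 4 * rho ^+ 2 = (2 * rho) ^+ 2); last by ring.
    by rewrite ler_sqr ?nnegrE//; have := rho1; lra.
  rewrite (_ : 76 * K * ker h * _ = (1 + 4 * rho ^+ 2) * (76 * K) * ker h); last by ring.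
  by rewrite lerDl; lra.
have r1 := rho1.
have xx : `|x| ^+ 2 = x ^+ 2 by rewrite real_normK ?num_real.
have x4 : 4 <= x ^+ 2 by rewrite -xx expr2; nra.
suff H : `|second_diff x h| * x ^+ 2 <= 4 * (`|psi (x + h)| + `|psi (x - h)|).
  have s0 := normr_ge0 (second_diff x h).
  have c0 : 0 <= (1 + 4 * rho ^+ 2) * (76 * K) * ker h.
    by rewrite mulr_ge0// mulr_ge0//; lra.
  by nra.
rewrite /second_diff (psi_out (x := x)) ?mulr0 ?sub0r; last by lra.
have far y : `|x - y| = `|h| -> `|psi y| * x ^+ 2 <= 4 * h ^+ 2 * `|psi y|.
  move=> xyh; have [->|py] := eqVneq (psi y) 0; first by rewrite normr0 mul0r mulr0.
  have yr : `|y| <= rho.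
    by rewrite leNgt; apply/negP => /psi_out py0; rewrite py0 eqxx in py.
  have hx : `|x| <= 2 * `|h|.
    by have := ler_normD (x - y) y; rewrite subrK xyh; lra.
  rewrite [leLHS]mulrC ler_wpM2r// -xx -[h ^+ 2]real_normK ?num_real// !expr2.
  by have := normr_ge0 x; nra.
have f1 : `|psi (x + h)| * x ^+ 2 <= 4 * h ^+ 2 * `|psi (x + h)|.
  by apply: far; rewrite opprD addrA subrr sub0r normrN.
have f2 : `|psi (x - h)| * x ^+ 2 <= 4 * h ^+ 2 * `|psi (x - h)|.
  by apply: far; rewrite opprB addrCA subrr addr0.
have [->|h0] := eqVneq h 0.
  by rewrite expr0n/= invr0 mulr0 normr0 mul0r mulr_ge0// addr_ge0.
have h2 : 0 < h ^+ 2 by rewrite exprn_even_gt0.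
rewrite normrM normfV (gtr0_norm h2) mulrAC ler_pdivrMr//.
have := ler_normB (- psi (x + h)) (psi (x - h)); rewrite normrN => hh.
have x0 : 0 <= x ^+ 2 by lra.
apply: (le_trans (ler_wpM2r x0 hh)); rewrite mulrDl; lra.
Qed.

Let psi_meas : measurable_fun [set: R] psi.
Proof. exact: continuous_measurable_fun. Qed.

Lemma bump_weight_integrable (w : R -> R) : measurable_fun [set: R] w ->
  (exists2 C, 0 <= C & forall x, `|x| <= rho -> `|w x| <= C * W x) ->
  mu.-integrable setT (EFin \o (fun x => w x * psi x)).
Proof.
move=> mw [C C0 wC].
apply: (integrable_dom _ _ (intgZ (C * K) (@inv1D_integrable R))).
  by apply: measurable_line; exact: measurable_funM.
move=> x; have [xr|xr] := lerP `|x| rho; last first.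
  by rewrite psi_out// mulr0 normr0 mulr_ge0 ?mulr_ge0 ?K0// invr_ge0 addr_ge0// sqr_ge0.
by rewrite normrM mulrAC ler_pM// wC.
Qed.

Let WC x : `|x| <= rho -> 1 <= (1 + rho ^+ 2) * W x.
Proof.
move=> xr; have x2 := sqr_ge0 x; rewrite /W ler_pdivlMr ?mul1r ?lerD2l; last by lra.
rewrite -[x ^+ 2]real_normK ?num_real// ler_sqr ?nnegrE//.
by have := rho1; lra.
Qed.

Lemma bump_bounded_integrable (w : R -> R) C : measurable_fun [set: R] w -> 0 <= C ->
  (forall x, `|x| <= rho -> `|w x| <= C) ->
  mu.-integrable setT (EFin \o (fun x => w x * psi x)).
Proof.
move=> mw C0 wC; apply: bump_weight_integrable => //.
exists (C * (1 + rho ^+ 2)); first by rewrite mulr_ge0// addr_ge0// sqr_ge0.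
move=> x xr; rewrite (le_trans (wC x xr))// -mulrA ler_peMr//; exact: WC.
Qed.

Let Ipsi : mu.-integrable setT (EFin \o psi).
Proof.
have H : mu.-integrable setT (EFin \o (fun x => 1 * psi x)).
  by apply: (@bump_bounded_integrable (fun=> 1) 1) => // x _; rewrite normr1.
by move: H; under [X in EFin \o X]eq_fun do rewrite mul1r.
Qed.

Let normpsi_shift (x : R) :
  mu.-integrable setT (EFin \o (fun h => `|psi (x + h)| + `|psi (x - h)|)) /\
  \int[mu]_h (`|psi (x + h)| + `|psi (x - h)|) = 2 * \int[mu]_h `|psi h|.
Proof.
have In := intg_norm Ipsi.
have one0 : (1 : R) != 0 by exact: oner_neq0.
have mone0 : (-1 : R) != 0 by rewrite oppr_eq0.
have E1 : (fun h => `|psi (x + h)|) = (fun h => `|psi (1 * h + x)|).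
  by apply/funext => h; rewrite mul1r addrC.
have E2 : (fun h => `|psi (x - h)|) = (fun h => `|psi (-1 * h + x)|).
  by apply/funext => h; rewrite mulN1r addrC.
have I1 : mu.-integrable setT (EFin \o (fun h => `|psi (x + h)|)).
  by rewrite E1; apply: (integrable_affine x one0 In).
have I2 : mu.-integrable setT (EFin \o (fun h => `|psi (x - h)|)).
  by rewrite E2; apply: (integrable_affine x mone0 In).
split; first exact: intgD.
rewrite RintegralD// E1 E2 (Rintegral_affine x one0 In) (Rintegral_affine x mone0 In).
by rewrite normrN normr1 invr1 !mul1r; ring.
Qed.

Definition sd_bound : R :=
  (1 + 4 * rho ^+ 2) * (76 * K) * \int[mu]_h ker h + 16 * \int[mu]_h `|psi h|.

Let dom_int (x : R) : (\int[mu]_h (sd_dom x h)%:E = (sd_bound * W x)%:E)%E.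
Proof.
have [I1 E1] := normpsi_shift x.
have I2 := intgZ ((1 + 4 * rho ^+ 2) * (76 * K)) (@ker_integrable R).
have I3 := intgZ 8 I1.
rewrite intg_EFin; last by apply: intgZ; exact: intgD.
rewrite RintegralZl//; last exact: intgD.
rewrite RintegralD// RintegralZl//; last exact: ker_integrable.
by rewrite RintegralZl// E1 /sd_bound; congr (_%:E); ring.
Qed.

Let dom_integrable (x : R) : mu.-integrable setT (EFin \o sd_dom x).
Proof.
have [I1 _] := normpsi_shift x.
by apply: intgZ; apply: intgD; apply: intgZ => //; exact: ker_integrable.
Qed.

Lemma second_diff_measurable :
  measurable_fun [set: T1 * T1] (fun z : T1 * T1 => second_diff z.1 z.2).
Proof.
have m1 : measurable_fun [set: T1 * T1] (fst : T1 * T1 -> R) by exact: measurable_fst.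
have m2 : measurable_fun [set: T1 * T1] (snd : T1 * T1 -> R) by exact: measurable_snd.
apply: measurable_fun_div; last exact: measurable_funX.
apply: measurable_funB.
  apply: measurable_funB.
    by apply: measurable_funM; [exact: measurable_cst|exact: (measurableT_comp psi_meas m1)].
  by apply: (measurableT_comp psi_meas); exact: measurable_funD.
by apply: (measurableT_comp psi_meas); exact: measurable_funB.
Qed.

Let sd_slice_meas (x : R) : measurable_fun [set: T1] (second_diff x).
Proof. exact: (measurableT_comp second_diff_measurable (pair1_measurable x)). Qed.

Lemma sd_integrable (x : R) : mu.-integrable setT (EFin \o second_diff x).
Proof.
exact: integrable_dom (sd_slice_meas x) (second_diff_dom x) (dom_integrable x).
Qed.

Lemma second_diff_norm_int (x : R) :
  (\int[mu]_h `|second_diff x h|%:E <= (sd_bound * W x)%:E)%E.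
Proof.
rewrite -dom_int; apply: ge0_le_integral => //.
- by apply/measurable_EFinP; apply: measurableT_comp => //; exact: sd_slice_meas.
- by apply: measurable_int; exact: dom_integrable.
- by move=> h _; rewrite lee_fin second_diff_dom.
Qed.

(** The half Laplacian, up to a constant factor. *)
Definition hlap (x : R) : R := \int[mu]_h second_diff x h.

Lemma hlap_le x : `|hlap x| <= sd_bound * W x.
Proof.
apply: (le_trans (le_normr_Rintegral _ (sd_integrable x))) => //.
by rewrite -lee_fin -(Rintegral_norm_EFin (sd_integrable x)) second_diff_norm_int.
Qed.

Lemma second_diff_weight_integrable (w : R -> R) : measurable_fun [set: R] w ->
  mu.-integrable setT (EFin \o (fun x => w x * W x)) ->
  mu2.-integrable setT (EFin \o (fun z : T1 * T1 => w z.1 * second_diff z.1 z.2)).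
Proof.
move=> mw Iw.
apply: (@fubini_dom R _ (fun x => sd_bound * `|w x * W x|)).
- apply: measurable_funM; last exact: second_diff_measurable.
  exact: (measurableT_comp mw measurable_fst).
- move=> x /=.
  have W0 : 0 <= W x by rewrite invr_ge0 addr_ge0// sqr_ge0.
  have -> : sd_bound * `|w x * W x| = `|w x| * (sd_bound * W x).
    by rewrite normrM (ger0_norm W0); ring.
  under eq_integral do rewrite normrM EFinM.
  rewrite ge0_integralZl//; last first.
    by apply/measurable_EFinP; apply: measurableT_comp => //; exact: sd_slice_meas.
  by rewrite EFinM lee_wpmul2l ?lee_fin// second_diff_norm_int.
- exact: intgZ (intg_norm Iw).
Qed.

Lemma hlap_measurable : measurable_fun [set: T1] hlap.
Proof.
have I1 : mu2.-integrable setT (EFin \o (fun z : T1 * T1 => 1 * second_diff z.1 z.2)).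
  apply: (@second_diff_weight_integrable (fun=> 1)); first exact: measurable_cst.
  by under [X in EFin \o X]eq_fun do rewrite mul1r; exact: inv1D_integrable.
have := measurable_fubini_F I1 => mF.
have -> : hlap = fine \o fubini_F mu (EFin \o (fun z : T1 * T1 => 1 * second_diff z.1 z.2)).
  apply/funext => x; rewrite /hlap /Rintegral /= /fubini_F; congr fine.
  by apply: eq_integral => h _ /=; rewrite mul1r.
exact: measurableT_comp.
Qed.

Lemma hlap_integrable : mu.-integrable setT (EFin \o hlap).
Proof.
exact: integrable_dom hlap_measurable hlap_le (intgZ sd_bound (@inv1D_integrable R)).
Qed.

End HalfLaplacian.

Section CosKernel.
Context {R : realType}.
Notation mu := (@lebesgue_measure R).

(** The second difference of the cosine at 0: its integral is the symbol of the
    operator hlap at frequency 1. *)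
Definition cosker (h : R) : R := (2 - 2 * cos h) / h ^+ 2.

Lemma cosker_ge0 h : 0 <= cosker h.
Proof. by rewrite divr_ge0 ?sqr_ge0//; have := cos_le1 h; lra. Qed.

Lemma cosker_measurable : measurable_fun [set: R] cosker.
Proof.
apply: measurable_fun_div; last exact: sqr_measurable.
apply: measurable_funB; first exact: measurable_cst.
apply: measurable_funM; first exact: measurable_cst.
by apply: continuous_measurable_fun; exact: continuous_cos.
Qed.

Let cos_ge (h : R) : 0 < h -> 1 - cos h <= h ^+ 2.
Proof.
move=> h0.
have [c /andP[c0 ch] E] := MVT_global (@is_derive_cos R) (ltW h0).
have [d _ Es] := MVT_global (@is_derive_sin R) c0.
rewrite cos0 subr0 in E; rewrite sin0 !subr0 in Es.
have -> : 1 - cos h = sin c * h by move: E; lra.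
have d1 := cos_le1 d; rewrite expr2 ler_pM2r// Es.
by have := cos_geN1 d; nra.
Qed.

Lemma cosker_integrable : mu.-integrable setT (EFin \o cosker).
Proof.
apply: (integrable_dom (measurable_line cosker_measurable) _ (intgZ 80 (@ker_integrable R))) => h.
rewrite ger0_norm ?cosker_ge0//.
have [->|h0] := eqVneq h 0.
  by rewrite /cosker expr0n/= invr0 mulr0 mulr_ge0// ker_ge0.
have h2 : 0 < h ^+ 2 by rewrite exprn_even_gt0.
have k0 := ker_ge0 h.
have [h1|h1] := lerP `|h| 1.
  rewrite ler_pdivrMr//.
  have k1 := ker_ge_near h0 h1.
  have := @cos_ge `|h|; rewrite normr_gt0 h0 cos_norm real_normK ?num_real// => /(_ isT).
  by nra.
have k1 := @ker_ge_far _ h ltac:(lra).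
have : 2 - 2 * cos h <= 4 by have := cos_geN1 h; lra.
have i0 : 0 < (h ^+ 2)^-1 by rewrite invr_gt0.
by rewrite /cosker => c4; nra.
Qed.

Definition cosconst : R := \int[mu]_h cosker h.

Lemma cosconst_gt0 : 0 < cosconst.
Proof.
have cc1 : cos (1 : R) < 1.
  rewrite -[X in _ < X]cos0 ltr_cos ?in_itv/= ?lexx ?ltr01 ?ler01//=.
    by have := @pihalf_ge1 R; lra.
  by have := @pihalf_ge1 R; lra.
pose k : R := (2 - 2 * cos 1) / 4.
have k0 : 0 < k by rewrite divr_gt0//; lra.
have [I1 E1] := @Rintegral_indic_co R 1 2 (ltr1n _ 2).
apply: (@lt_le_trans _ _ (\int[mu]_x (k * \1_(`[1%R, 2%R[%classic) x))).
  by rewrite RintegralZl// E1 mulr_gt0//; lra.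
apply: le_Rintegral => //; [exact: intgZ|exact: cosker_integrable|].
move=> x _; rewrite indicE; case: (boolP (_ \in _)) => [|_]; last by rewrite mulr0 cosker_ge0.
rewrite inE/= in_itv/= => /andP[x1 x2]; rewrite mulr1 /cosker.
have x0 : 0 < x by lra.
have cx : cos x <= cos 1.
  move: x1; rewrite le_eqVlt => /predU1P[<-//|x1].
  by apply/ltW; rewrite ltr_cos// in_itv/=; apply/andP; split; have := @pihalf_ge1 R; lra.
rewrite ler_pdivlMr ?exprn_gt0// /k expr2.
rewrite mulrAC ler_pdivrMr//; apply: ler_pM; [lra|nra|lra|nra].
Qed.

Lemma cosker_scale (xi : R) :
  \int[mu]_h ((2 - 2 * cos (h * xi)) / h ^+ 2) = `|xi| * cosconst.
Proof.
have [->|xi0] := eqVneq xi 0.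
  rewrite normr0 mul0r (@eq_Rintegral _ _ _ _ _ (cst 0)).
    by rewrite /Rintegral integral0.
  by move=> h _; rewrite mulr0 cos0 mulr1 subrr mul0r.
have := Rintegral_affine 0 xi0 cosker_integrable.
move=> E; have E2 : \int[mu]_h ((2 - 2 * cos (h * xi)) / h ^+ 2) =
    \int[mu]_h (xi ^+ 2 * cosker (xi * h + 0)).
  apply: eq_Rintegral => h _; rewrite /cosker addr0 [xi * h]mulrC.
  have [->|h0] := eqVneq h 0; first by rewrite mul0r expr0n/= invr0 !mulr0.
  by field; rewrite h0 xi0.
rewrite E2 RintegralZl//; last by apply: integrable_affine => //; exact: cosker_integrable.
rewrite E mulrA -/cosconst; congr (_ * _).
by rewrite -[xi ^+ 2]real_normK ?num_real// expr2 mulfK// normr_eq0.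
Qed.

Lemma cosker_scale_integrable (xi : R) :
  mu.-integrable setT (EFin \o (fun h => (2 - 2 * cos (h * xi)) / h ^+ 2)).
Proof.
have [->|xi0] := eqVneq xi 0.
  have -> : (fun h : R => (2 - 2 * cos (h * 0)) / h ^+ 2) = fun=> 0.
    by apply/funext => h; rewrite mulr0 cos0 mulr1 subrr mul0r.
  exact: integrable0.
have -> : (fun h => (2 - 2 * cos (h * xi)) / h ^+ 2) =
    (fun h => xi ^+ 2 * cosker (xi * h + 0)).
  apply/funext => h; rewrite /cosker addr0 [xi * h]mulrC.
  have [->|h0] := eqVneq h 0; first by rewrite mul0r expr0n/= invr0 !mulr0.
  by field; rewrite h0 xi0.
by apply: intgZ; apply: integrable_affine => //; exact: cosker_integrable.
Qed.

End CosKernel.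

Section Fourier.
Context {R : realType}.
Notation mu := (@lebesgue_measure R).
Notation mu2 := (mu \x mu)%E.
Notation T1 := (measurableTypeR R).

Variables (psi : R -> R) (rho K : R).
Hypothesis bpsi : bump psi rho K.

(** After exchanging the integrals, translation invariance moves the second
    difference from psi to e, which is an eigenfunction of it by the addition
    formula. *)
Lemma hlap_multiplier (e cs : R -> R) (c : R) : measurable_fun [set: R] e ->
  (forall x, `|e x| <= 1) ->
  (forall x h, e (x + h) + e (x - h) = 2 * cs h * e x) ->
  mu.-integrable setT (EFin \o (fun h => (2 - 2 * cs h) / h ^+ 2)) ->
  \int[mu]_h ((2 - 2 * cs h) / h ^+ 2) = c ->
  \int[mu]_x (e x * hlap psi x) = c * \int[mu]_x (e x * psi x).
Proof.
move=> me e1 ecs Ics <-.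
have We : mu.-integrable setT (EFin \o (fun x => e x * (1 + x ^+ 2)^-1)).
  apply: (integrable_dom _ _ (@inv1D_integrable R)).
    by apply: measurable_line; apply: measurable_funM => //; exact: inv1D_measurable.
  move=> x; rewrite normrM [X in _ * X]ger0_norm ?invr_ge0 ?addr_ge0 ?sqr_ge0//.
  by rewrite ler_piMl// invr_ge0 addr_ge0// sqr_ge0.
have Ik := second_diff_weight_integrable bpsi me We.
have shift h : measurable_fun [set: R] (fun x => e (x - h)).
  apply: (measurableT_comp me); apply: measurable_funB; first exact: measurable_id.
  exact: measurable_cst.
have Ish h : mu.-integrable setT (EFin \o (fun x => e (x - h) * psi x)).
  by apply: (bump_bounded_integrable bpsi (shift h) ler01) => x _.
have Iep : mu.-integrable setT (EFin \o (fun x => e x * psi x)).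
  by apply: (bump_bounded_integrable bpsi me ler01) => x _.
have tr h : mu.-integrable setT (EFin \o (fun x => e x * psi (x + h))) /\
    \int[mu]_x (e x * psi (x + h)) = \int[mu]_x (e (x - h) * psi x).
  have E : (fun x => e x * psi (x + h)) =
      (fun x => (fun y => e (y - h) * psi y) (1 * x + h)).
    by apply/funext => x; rewrite /= mul1r addrK.
  rewrite E; split; first exact: (integrable_affine h (oner_neq0 _) (Ish h)).
  rewrite -[LHS]/(\int[mu]_x (fun y => e (y - h) * psi y) (1 * x + h)).
  by rewrite (Rintegral_affine h (oner_neq0 _) (Ish h)) normr1 invr1 mul1r.
pose J := \int[mu]_x (e x * psi x).
have inner h : (\int[mu]_x (e x * second_diff psi x h)%:E =
    ((2 - 2 * cs h) / h ^+ 2 * J)%:E)%E.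
  have [I1 E1] := tr h; have [I2 E2] := tr (- h).
  have F x : e x * second_diff psi x h =
      (h ^+ 2)^-1 * (2 * (e x * psi x) - e x * psi (x + h) - e x * psi (x + - h)).
    by rewrite /second_diff; ring.
  have I3 : mu.-integrable setT (EFin \o (fun x =>
      2 * (e x * psi x) - e x * psi (x + h) - e x * psi (x + - h))).
    by apply: intgB => //; apply: intgB => //; exact: intgZ.
  rewrite [LHS](_ : _ = (\int[mu]_x ((h ^+ 2)^-1 * (2 * (e x * psi x) -
      e x * psi (x + h) - e x * psi (x + - h)))%:E)%E); last first.
    by apply: eq_integral => x _; rewrite F.
  rewrite intg_EFin; last exact: intgZ.
  congr (_%:E); rewrite RintegralZl// RintegralB//; last by apply: intgB => //; exact: intgZ.
  rewrite RintegralB//; last exact: intgZ.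
  rewrite RintegralZl// E1 E2 -/J.
  have E3 : \int[mu]_x (e (x - h) * psi x) + \int[mu]_x (e (x - - h) * psi x) =
      2 * cs h * J.
    rewrite -RintegralD// /J -RintegralZl//; apply: eq_Rintegral => x _.
    by rewrite opprK addrC -mulrDl ecs; ring.
  have -> : 2 * J - \int[mu]_x (e (x - h) * psi x) - \int[mu]_x (e (x - - h) * psi x)
     = 2 * J - (2 * cs h * J) by rewrite -E3; ring.
  by ring.
have [||||_ _ E] := @fubini_val R (fun z : T1 * T1 => e z.1 * second_diff psi z.1 z.2)
  (fun x => e x * hlap psi x) (fun h => (2 - 2 * cs h) / h ^+ 2 * J) Ik.
- apply: measurable_funM; last exact: hlap_measurable bpsi.
  exact: measurable_line.
- apply: measurable_funM; last exact: measurable_cst.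
  exact: measurable_intg Ics.
- apply: aeW => x /=; rewrite intg_EFin; last exact: intgZ (sd_integrable bpsi x).
  by rewrite RintegralZl//; exact: sd_integrable bpsi x.
- by apply: aeW => h /=; exact: inner.
rewrite E [RHS]mulrC -RintegralZl//.
by apply: eq_Rintegral => h _; rewrite mulrC.
Qed.

Lemma is_half_laplacian_hlap :
  is_half_laplacian psi (fun x => (@cosconst R)^-1 * hlap psi x).
Proof.
have C0 := @cosconst_gt0 R; have Cn := lt0r_neq0 C0.
have Ih := hlap_integrable bpsi.
split; first exact: intgZ.
move=> xi.
have mul_meas (f : R -> R) : continuous f -> measurable_fun [set: R] (fun x => f (x * xi)).
  move=> cf; apply: (measurableT_comp (continuous_measurable_fun cf)).
  by apply: measurable_funM; [exact: measurable_id|exact: measurable_cst].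
have Hc := @hlap_multiplier (fun x => cos (x * xi)) (fun h => cos (h * xi))
  (`|xi| * cosconst) (mul_meas _ (@continuous_cos R)) (fun x => cos_max _) _
  (cosker_scale_integrable xi) (cosker_scale xi).
have Hs := @hlap_multiplier (fun x => sin (x * xi)) (fun h => cos (h * xi))
  (`|xi| * cosconst) (mul_meas _ (@continuous_sin R)) (fun x => sin_max _) _
  (cosker_scale_integrable xi) (cosker_scale xi).
have {}Hc := Hc ltac:(by move=> x h; rewrite mulrDl mulrBl cosD cosB; ring).
have {}Hs := Hs ltac:(by move=> x h; rewrite mulrDl mulrBl sinD sinB; ring).
have weight (e : R -> R) : measurable_fun [set: R] e -> (forall x, `|e x| <= 1) ->
    \int[mu]_x (cosconst^-1 * hlap psi x * e x) = cosconst^-1 * \int[mu]_x (e x * hlap psi x).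
  move=> me e1; rewrite -RintegralZl//.
    by apply: eq_Rintegral => x _; ring.
  apply: (integrable_dom _ _ (intg_norm Ih)).
    by apply: measurable_funM; [exact: measurable_line|exact: hlap_measurable bpsi].
  by move=> x; rewrite normrM ler_piMl.
rewrite /fourier.
rewrite (weight (fun x => cos (x * xi)) (mul_meas _ (@continuous_cos R)) (fun x => cos_max _)).
rewrite (weight (fun x => sin (x * xi)) (mul_meas _ (@continuous_sin R)) (fun x => sin_max _)).
rewrite Hc Hs.
have sw (e : R -> R) : \int[mu]_x (psi x * e x) = \int[mu]_x (e x * psi x).
  by apply: eq_Rintegral => x _; rewrite mulrC.
rewrite !sw; apply/eqP; rewrite complex.eq_complex /= !mul0r subr0 addr0.
by apply/andP; split; apply/eqP; field.
Qed.

End Fourier.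

Section SmoothBump.
Context {R : realType}.

Lemma smooth_bump (psi : R -> R) (rho : R) : (forall k, CkOn setT k psi) ->
  (forall x, rho < `|x| -> psi x = 0) -> exists r K, bump psi r K.
Proof.
move=> Cpsi psi0.
have cpsi : continuous psi by move=> x; exact: CkOn_cont (Cpsi 0%N) I.
have [_ /(_ 1)[d1 C1]] := Cpsi 2%N.
have [cd1 /(_ 1)[d2 C2]] := C1.
pose D1 : R -> R := 'D_1 psi; pose D2 : R -> R := 'D_1 D1.
have dp (x : R) : is_derive x 1 psi (D1 x) by apply: derivableP; exact: d1.
have ddp (x : R) : is_derive x 1 D1 (D2 x) by apply: derivableP; exact: d2.
have far (x : R) : rho < `|x| -> \forall y \near x, rho < `|y|.
  move=> xr; have cn : {for x, continuous (fun y : R => `|y|)} by exact: norm_continuous.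
  exact: (cn _ (lt_nbhsr xr)).
have D10 (x : R) : rho < `|x| -> D1 x = 0.
  move=> xr; rewrite /D1 (near_eq_derive (g := cst (0 : R))) ?derive_cst//.
  by apply: filterS (far x xr) => y /psi0.
have D20 (x : R) : rho < `|x| -> D2 x = 0.
  move=> xr; rewrite /D2 (near_eq_derive (g := cst (0 : R))) ?derive_cst//.
  by apply: filterS (far x xr) => y /D10.
have [K0 HK0] := compact_support_bounded cpsi psi0.
have [K2 HK2] := compact_support_bounded (fun x => C2.1 x I) D20.
have K00 : 0 <= K0 by exact: le_trans (normr_ge0 _) (HK0 0).
have K20 : 0 <= K2 by exact: le_trans (normr_ge0 _) (HK2 0).
exists (1 + `|rho|), (K0 + 2 * K2); split=> //.
- by rewrite lerDl.
- by move=> x xr; apply: psi0; have := ler_norm rho; lra.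
- by move=> x; rewrite (le_trans (HK0 x))// lerDl mulr_ge0.
move=> x h; wlog h0 : h / 0 <= h => [H|].
  have [/H//|/ltW hn] := lerP 0 h.
  have := H (- h); rewrite oppr_ge0 opprK sqrrN => /(_ hn).
  by rewrite addrAC.
have [c1 /andP[a1 b1] E1] := @MVT_global R psi D1 x (x + h) dp ltac:(lra).
have [c2 /andP[a2 b2] E2] := @MVT_global R psi D1 (x - h) x dp ltac:(lra).
have [c3 _ E3] := @MVT_global R D1 D2 c2 c1 ddp ltac:(lra).
have -> : 2 * psi x - psi (x + h) - psi (x - h) = - (D2 c3 * (c1 - c2)) * h.
  rewrite -E3 mulNr mulrBl.
  have -> : D1 c1 * h = psi (x + h) - psi x by rewrite E1; ring.
  have -> : D1 c2 * h = psi x - psi (x - h) by rewrite E2; ring.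
  by ring.
rewrite normrM normrN normrM (ger0_norm h0) (@ger0_norm _ (c1 - c2)); last by lra.
have h3 := HK2 c3; have n3 := normr_ge0 (D2 c3).
have c12 : c1 - c2 <= 2 * h by lra.
have c120 : 0 <= c1 - c2 by lra.
have : `|D2 c3| * (c1 - c2) <= K2 * (2 * h) by apply: ler_pM.
by rewrite expr2; nra.
Qed.

End SmoothBump.

(** * Bregman divergences of the ramp *)

Section Bregman.
Context {R : realType}.
Notation mu := (@lebesgue_measure R).
Notation mu2 := (mu \x mu)%E.
Notation T1 := (measurableTypeR R).

Definition breg (F f : R -> R) (t d : R) : R := F (t + d) - F t - d * f t.

(** The second order part of the second difference of F (lg x) with step x s, for
    t = lg x: the omitted first order part is f t * klog s. *)
Definition bregq (F f : R -> R) (t s : R) : R :=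
  (breg F f t (lg (1 + s)) + breg F f t (lg (1 - s))) / s ^+ 2.

(** The factor 1/|x| is the Jacobian |x| of the step h = x s, over x^2. *)
Definition bregP (F f : R -> R) (x : R) : R :=
  (\int[mu]_s bregq F f (lg x) s) / `|x|.

Variables (a B : R) (F f b : R -> R).
Hypothesis a1 : 1 <= a.
Hypothesis rF : ramp a B F f b.

Let B0 : 0 <= B. Proof. exact: le_trans (ramp_ge0 rF 0) (ramp_le rF 0). Qed.

Lemma breg_bound t d : 0 <= breg F f t d <= B * d ^+ 2.
Proof.
have dF := ramp_d1 rF; have df := ramp_d2 rF.
rewrite /breg expr2; have [d0|/ltW d0] := lerP 0 d.
  have [c /andP[c1 c2] E1] := @MVT_global R F f t (t + d) dF ltac:(lra).
  have [e _ E2] := @MVT_global R f b t c df c1.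
  have e0 := ramp_ge0 rF e; have eB := ramp_le rF e.
  have -> : F (t + d) - F t - d * f t = b e * (c - t) * d by rewrite E1 -E2; ring.
  have ct : 0 <= c - t <= d by apply/andP; split; lra.
  case/andP: ct => ct0 ctd.
  rewrite !mulr_ge0//= mulrA ler_wpM2r// ler_pM//.
have [c /andP[c1 c2] E1] := @MVT_global R F f (t + d) t dF ltac:(lra).
have [e _ E2] := @MVT_global R f b c t df c2.
have e0 := ramp_ge0 rF e; have eB := ramp_le rF e.
have -> : F (t + d) - F t - d * f t = b e * (t - c) * (- d).
  have -> : F (t + d) - F t = - (F t - F (t + d)) by ring.
  by rewrite E1 -E2; ring.
have ct0 : 0 <= t - c by lra.
have ctd : t - c <= - d by lra.
have d0' : 0 <= - d by lra.
rewrite !mulr_ge0//= (_ : B * (d * d) = B * (- d) * (- d)); last by ring.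
by rewrite ler_wpM2r// ler_pM.
Qed.

Lemma bregq_ge0 t s : 0 <= bregq F f t s.
Proof.
rewrite divr_ge0 ?sqr_ge0// addr_ge0//.
  by case/andP: (breg_bound t (lg (1 + s))).
by case/andP: (breg_bound t (lg (1 - s))).
Qed.

Lemma bregq_le t s : bregq F f t s <= B * ksq s.
Proof.
rewrite /bregq /ksq mulrA ler_wpM2r ?invr_ge0 ?sqr_ge0// mulrDr addrC.
by apply: lerD; [case/andP: (breg_bound t (lg (1 - s)))|case/andP: (breg_bound t (lg (1 + s)))].
Qed.

Let F_meas : measurable_fun [set: R] F.
Proof. by apply: continuous_measurable_fun => t; exact: is_derive_continuous (ramp_d1 rF t). Qed.

Let f_meas : measurable_fun [set: R] f.
Proof. by apply: continuous_measurable_fun => t; exact: is_derive_continuous (ramp_d2 rF t). Qed.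

Let breg_meas d (T : measurableType d) (g h : T -> R) : measurable_fun setT g ->
  measurable_fun setT h -> measurable_fun setT (fun z => breg F f (g z) (h z)).
Proof.
move=> mg mh; apply: measurable_funB.
  apply: measurable_funB; last exact: (measurableT_comp F_meas mg).
  by apply: (measurableT_comp F_meas); exact: measurable_funD.
by apply: measurable_funM => //; exact: (measurableT_comp f_meas mg).
Qed.

Let bregq_meas2 : measurable_fun [set: T1 * T1] (fun z => bregq F f (lg z.1) z.2).
Proof.
have m1 : measurable_fun [set: T1 * T1] (fst : T1 * T1 -> R) by exact: measurable_fst.
have m2 : measurable_fun [set: T1 * T1] (snd : T1 * T1 -> R) by exact: measurable_snd.
have l1 := measurableT_comp (@lg_measurable R) m1.
apply: measurable_fun_div; last exact: measurable_funX.
apply: measurable_funD; apply: breg_meas => //.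
  exact: (measurableT_comp (@lg1D_measurable R) m2).
exact: (measurableT_comp (@lg1B_measurable R) m2).
Qed.

Let bregq_meas t : measurable_fun [set: T1] (bregq F f t).
Proof.
apply: measurable_fun_div; last exact: measurable_line (@sqr_measurable R).
apply: measurable_funD; apply: breg_meas; try exact: measurable_cst.
  exact: measurable_line (@lg1D_measurable R).
exact: measurable_line (@lg1B_measurable R).
Qed.

Lemma bregq_integrable t : mu.-integrable setT (EFin \o bregq F f t).
Proof.
apply: (integrable_dom (bregq_meas t) _ (intgZ B (@ksq_integrable R))) => s.
by rewrite ger0_norm ?bregq_ge0// bregq_le.
Qed.

Lemma bregP_ge0 x : 0 <= bregP F f x.
Proof. by rewrite divr_ge0// Rintegral_ge0// => s _; exact: bregq_ge0. Qed.

Lemma bregP_le x : `|x| * bregP F f x <= B * \int[mu]_s ksq s.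
Proof.
have K0 : 0 <= \int[mu]_s ksq s by apply: Rintegral_ge0 => s _; exact: ksq_ge0.
have [->|x0] := eqVneq x 0; first by rewrite normr0 mul0r mulr_ge0.
rewrite /bregP mulrCA divff ?normr_eq0// mulr1 -RintegralZl//; last exact: ksq_integrable.
apply: le_Rintegral => //; first exact: bregq_integrable.
  exact: intgZ (@ksq_integrable R).
by move=> s _; exact: bregq_le.
Qed.

Lemma bregP_measurable : measurable_fun [set: T1] (bregP F f).
Proof.
apply: measurable_fun_div; last first.
  by apply: measurable_line; apply: continuous_measurable_fun; exact: norm_continuous.
have m := measurable_fun_fubini_tonelli_F (m2 := mu)
  (fun z : T1 * T1 => (bregq F f (lg z.1) z.2)%:E).
have {}m := m ltac:(by apply/measurable_EFinP).
have {}m := m ltac:(by move=> z; rewrite lee_fin bregq_ge0).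
by apply: (measurableT_comp _ m).
Qed.

End Bregman.

Section BregmanDecay.
Context {R : realType}.
Notation mu := (@lebesgue_measure R).

Lemma ramp_le_norm (a B : R) F f b t : 0 <= a -> @ramp R a B F f b -> F t <= `|t| + a.
Proof.
move=> a0 rF; have [ta|ta] := lerP t a.
  by rewrite (le_trans (ramp_ndecr rF ta))// (ramp_hi rF)// lerDr.
by rewrite (ramp_hi rF (ltW ta)) (le_trans (ler_norm t))// lerDl.
Qed.

Let A1 (a : R) : 1 <= a -> 1 <= expR a.
Proof. by move=> a1; rewrite -expR0 ler_expR; lra. Qed.

Let decay_const (a : R) : R := (1 + a) * (18 + 18 * expR a ^+ 2) + 64 * (1 + expR a) ^+ 2.

Let lg_near (a y : R) : 1 <= a -> y != 0 -> `|y| <= expR a ->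
  `|lg y| + a <= decay_const a * ker y.
Proof.
move=> a1 y0 yA; have := A1 a1; rewrite /decay_const; move: (expR a) yA => A yA A1'.
have k0 := ker_ge0 y; have A20 : 1 <= A ^+ 2 by rewrite expr2; nra.
have o1 : 1 <= (18 + 18 * A ^+ 2) * ker y.
  have [y1|y1] := lerP `|y| 1.
    by have := ker_ge_near y0 y1; nra.
  have := @ker_ge_far _ y ltac:(lra) => h.
  have y2 : 0 < y ^+ 2 by rewrite exprn_even_gt0.
  have yA2 : y ^+ 2 <= A ^+ 2.
    by rewrite -[y ^+ 2]real_normK ?num_real// ler_sqr ?nnegrE//; lra.
  have : 1 <= A ^+ 2 * (y ^+ 2)^-1 by rewrite ler_pdivlMr// mul1r.
  by nra.
have o2 : (1 - y) ^+ 2 <= (1 + A) ^+ 2.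
  rewrite -[(1 - y) ^+ 2]real_normK ?num_real// ler_sqr ?nnegrE//; last by lra.
  by have := ler_normB 1 y; rewrite normr1; lra.
have o3 : 64 * (1 - y) ^+ 2 * ker y <= 64 * (1 + A) ^+ 2 * ker y.
  by rewrite ler_wpM2r// ler_pM2l.
have o4 : (1 + a) <= (1 + a) * (18 + 18 * A ^+ 2) * ker y.
  by rewrite -mulrA ler_peMr//; lra.
by have := lg_le_sq y; have := lg_sq_le y; rewrite mulrDl; lra.
Qed.

Let lg_far (a y : R) : 1 <= a -> (expR a)^-1 <= `|y| ->
  `|lg y| + a <= decay_const a * (y ^+ 2 * ker y).
Proof.
move=> a1 yA; have := A1 a1; rewrite /decay_const; move: (expR a) yA => A yA A1'.
have A0 : 0 < A by lra.
have k0 := ker_ge0 y; have A20 : 1 <= A ^+ 2 by rewrite expr2; nra.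
have y0' : 0 < `|y| by rewrite (lt_le_trans _ yA)// invr_gt0.
have y0 : y != 0 by rewrite -normr_gt0.
have y2 : 0 < y ^+ 2 by rewrite exprn_even_gt0.
have yA1 : 1 <= A * `|y| by rewrite mulrC -ler_pdivrMr// mul1r.
have yy : y ^+ 2 = `|y| ^+ 2 by rewrite real_normK ?num_real.
have o1 : 1 <= (18 + 18 * A ^+ 2) * (y ^+ 2 * ker y).
  have [y1|y1] := lerP `|y| 1.
    have h := ker_ge_near y0 y1.
    have : 1 <= A ^+ 2 * y ^+ 2 by rewrite yy !expr2; nra.
    have : 0 <= y ^+ 2 * ker y by rewrite mulr_ge0// ltW.
    by nra.
  have h := @ker_ge_far _ y ltac:(lra).
  have : 1 <= 18 * (y ^+ 2 * ker y).
    by rewrite mulrCA -ler_pdivrMl// mulr1.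
  have : 0 <= y ^+ 2 * ker y by rewrite mulr_ge0// ltW.
  by nra.
have o2 : (1 - y) ^+ 2 <= (1 + A) ^+ 2 * y ^+ 2.
  rewrite yy -exprMn -[(1 - y) ^+ 2]real_normK ?num_real// ler_sqr ?nnegrE ?mulr_ge0//; last by lra.
  by have := ler_normB 1 y; rewrite normr1; lra.
have o3 : 64 * (1 - y) ^+ 2 * ker y <= 64 * (1 + A) ^+ 2 * (y ^+ 2 * ker y).
  by rewrite mulrA ler_wpM2r// -mulrA ler_pM2l.
have o4 : (1 + a) <= (1 + a) * (18 + 18 * A ^+ 2) * (y ^+ 2 * ker y).
  by rewrite -mulrA ler_peMr//; lra.
by have := lg_le_sq y; have := lg_sq_le y; rewrite mulrDl; lra.
Qed.

Variables (a B : R) (F f b : R -> R).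
Hypothesis a1 : 1 <= a.
Hypothesis rF : ramp a B F f b.

Let A := expR a.
Let A1' : 1 <= A := A1 a1.
Let C10 : 0 <= decay_const a.
Proof.
have aa := a1; rewrite /decay_const; apply: addr_ge0; last by rewrite mulr_ge0// sqr_ge0.
by apply: mulr_ge0; [lra|rewrite addr_ge0// mulr_ge0// sqr_ge0].
Qed.

Let breg0 t : breg F f t 0 = 0.
Proof. by rewrite /breg addr0 subrr mul0r subrr. Qed.

Let lg_gt (x : R) : A < `|x| -> a < lg x.
Proof.
move=> xA; have aa := a1; rewrite -ltr_expR expR_lg; last first.
  by rewrite -normr_gt0 (lt_trans _ xA)// expR_gt0.
rewrite -real_normK ?num_real// expr2; have := A1'; rewrite -/A; nra.
Qed.

Let lg_lt (x : R) : x != 0 -> `|x| < A^-1 -> lg x < - a.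
Proof.
move=> x0 xA; have := @lg_gt x^-1.
have -> : lg x^-1 = - lg x.
  by apply/eqP; rewrite -addr_eq0 -lgM ?invr_eq0// mulVf// lg1.
rewrite normfV => H; rewrite ltrNr; apply: H.
by rewrite -[A]invrK ltf_pV2 ?posrE ?normr_gt0// invr_gt0 expR_gt0.
Qed.

(** For lg x beyond the ramp the divergence vanishes unless x l lies to the left
    of the end of the ramp; then l is at most 1/2 in absolute value, so (1 - l)^2
    is bounded below, and ker (x l) absorbs the logarithm of x l. *)
Let breg_large (x l : R) : 2 * A <= `|x| ->
  breg F f (lg x) (lg l) <= 4 * decay_const a * ker (x * l) * (1 - l) ^+ 2.
Proof.
move=> xA; have AA := A1'; have k0 := ker_ge0 (x * l); have CC := C10.
have [->|l0] := eqVneq l 0.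
  by rewrite lg0 breg0 !mulr_ge0 ?sqr_ge0 ?ker_ge0.
have x0 : x != 0 by rewrite -normr_gt0; lra.
have xa : a < lg x by apply: lg_gt; lra.
rewrite /breg -lgM// (ramp_hi rF (ltW xa)) (ramp_d1_hi rF xa) mulr1.
have -> : F (lg (x * l)) - lg x - lg l = F (lg (x * l)) - lg (x * l) by rewrite lgM//; ring.
have y0 : x * l != 0 by rewrite mulf_neq0.
have [ya|ya] := lerP a (lg (x * l)).
  by rewrite (ramp_hi rF ya) subrr mulr_ge0 ?sqr_ge0// mulr_ge0// mulr_ge0.
have yA : `|x * l| <= A.
  by rewrite leNgt; apply/negP => /lg_gt; lra.
have l2 : `|l| <= 2^-1.
  rewrite leNgt; apply/negP => l2; move: yA; rewrite normrM; nra.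
have l3 : 1 <= 4 * (1 - l) ^+ 2.
  rewrite -[(1 - l) ^+ 2]real_normK ?num_real// expr2.
  have := ler_normD l (1 - l); rewrite addrCA subrr addr0 normr1 => h.
  have : 2^-1 <= `|1 - l| by lra.
  by nra.
have aa : 0 <= a by have := a1; lra.
have rG := ramp_reflect rF.
have := ramp_le_norm (- lg (x * l)) aa rG; rewrite opprK normrN => h.
have h2 := lg_near a1 y0 yA.
have h3 : 0 <= decay_const a * ker (x * l) by rewrite mulr_ge0.
have -> : 4 * decay_const a * ker (x * l) * (1 - l) ^+ 2 = decay_const a * ker (x * l) * (4 * (1 - l) ^+ 2) by ring.
by rewrite (le_trans h)// (le_trans h2)// ler_peMr.
Qed.

(** Before the ramp, the divergence is F (lg (x l)), which vanishes unless l is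
    large; then (1 - l)^2 is comparable to l^2 and x^2 l^2 ker (x l) absorbs the
    logarithm of x l. *)
Let breg_small (x l : R) : x != 0 -> `|x| <= (2 * A)^-1 ->
  breg F f (lg x) (lg l) <= 4 * decay_const a * x ^+ 2 * ker (x * l) * (1 - l) ^+ 2.
Proof.
move=> x0 xA; have AA := A1'; have k0 := ker_ge0 (x * l); have CC := C10.
have x20 := sqr_ge0 x.
have G0 (m : R) : 0 <= 4 * decay_const a * x ^+ 2 * ker (x * m) * (1 - m) ^+ 2.
  apply: mulr_ge0 (sqr_ge0 _); apply: mulr_ge0 (ker_ge0 _).
  by apply: mulr_ge0 => //; exact: mulr_ge0.
have [->|l0] := eqVneq l 0.
  by rewrite lg0 breg0.
have A0 : 0 < A by lra.
have xAx : `|x| * (2 * A) <= 1 by rewrite -ler_pdivlMr ?mul1r//; lra.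
have xa : lg x < - a.
  apply: lg_lt => //; rewrite (le_lt_trans xA)// ltf_pV2 ?posrE//; lra.
rewrite /breg -lgM// (ramp_lo rF (ltW xa)) (ramp_d1_lo rF xa) mulr0 !subr0.
have y0 : x * l != 0 by rewrite mulf_neq0.
have [ya|ya] := lerP (lg (x * l)) (- a).
  by rewrite (ramp_lo rF ya).
have yA : A^-1 <= `|x * l|.
  by rewrite leNgt; apply/negP => /(lg_lt y0); lra.
have yA' : 1 <= A * `|x * l| by rewrite mulrC -ler_pdivrMr// mul1r.
have l2 : 2 <= `|l|.
  rewrite normrM in yA'; rewrite leNgt; apply/negP => l2.
  have := normr_ge0 x; have := normr_ge0 l; nra.
have l3 : l ^+ 2 <= 4 * (1 - l) ^+ 2.
  rewrite -[(1 - l) ^+ 2]real_normK ?num_real// -[l ^+ 2]real_normK ?num_real// !expr2.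
  have := ler_normB 1 (1 - l); rewrite normr1 opprB addrCA subrr addr0 => h.
  have : `|l| <= 2 * `|1 - l| by lra.
  by have := normr_ge0 l; nra.
have aa : 0 <= a by have := a1; lra.
have h := ramp_le_norm (lg (x * l)) aa rF.
have h2 := lg_far a1 yA.
rewrite (le_trans h)// (le_trans h2)// exprMn.
have -> : 4 * decay_const a * x ^+ 2 * ker (x * l) * (1 - l) ^+ 2 =
  decay_const a * x ^+ 2 * ker (x * l) * (4 * (1 - l) ^+ 2) by ring.
have -> : decay_const a * (x ^+ 2 * l ^+ 2 * ker (x * l)) = decay_const a * x ^+ 2 * ker (x * l) * l ^+ 2 by ring.
by rewrite ler_wpM2l// mulr_ge0// mulr_ge0.
Qed.

Let J := \int[mu]_s @ker R s.
Let J0 : 0 <= J. Proof. by apply: Rintegral_ge0 => s _; exact: ker_ge0. Qed.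

Let ker_slices (x : R) : x != 0 ->
  mu.-integrable setT (EFin \o (fun s => ker (x * (1 + s)) + ker (x * (1 - s)))) /\
  \int[mu]_s (ker (x * (1 + s)) + ker (x * (1 - s))) = 2 * J / `|x|.
Proof.
move=> x0; have nx0 : - x != 0 by rewrite oppr_eq0.
have E1 : (fun s => ker (x * (1 + s))) = (fun s => ker (x * s + x)).
  by apply/funext => s; congr ker; ring.
have E2 : (fun s => ker (x * (1 - s))) = (fun s => ker (- x * s + x)).
  by apply/funext => s; congr ker; ring.
have I1 : mu.-integrable setT (EFin \o (fun s => ker (x * (1 + s)))).
  by rewrite E1; exact: ker_affine_integrable.
have I2 : mu.-integrable setT (EFin \o (fun s => ker (x * (1 - s)))).
  by rewrite E2; exact: ker_affine_integrable.
split; first exact: intgD.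
rewrite RintegralD// E1 E2 (Rintegral_affine x x0 (@ker_integrable R)).
rewrite (Rintegral_affine x nx0 (@ker_integrable R)) normrN -/J.
by ring.
Qed.

Let bregq_ker (x c : R) : x != 0 -> 0 <= c ->
  (forall l, breg F f (lg x) (lg l) <= c * ker (x * l) * (1 - l) ^+ 2) ->
  bregP F f x <= c * (2 * J) / x ^+ 2.
Proof.
move=> x0 c0 H; have [I1 E1] := ker_slices x0.
have xn : 0 < `|x| by rewrite normr_gt0.
rewrite -[x ^+ 2]real_normK ?num_real// expr2 invfM mulrA ler_wpM2r ?invr_ge0//.
rewrite -mulrA -E1 -RintegralZl//; apply: le_Rintegral => //.
- exact: bregq_integrable rF _.
- exact: intgZ.
move=> s _; have p := ker_ge0 (x * (1 + s)); have m := ker_ge0 (x * (1 - s)).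
rewrite /bregq; have [->|s0] := eqVneq s 0.
  by rewrite expr0n/= invr0 mulr0 mulr_ge0// addr_ge0// ker_ge0.
rewrite ler_pdivrMr ?exprn_even_gt0// mulrDr mulrDl; apply: lerD.
  by have := H (1 + s); rewrite (_ : 1 - (1 + s) = - s) ?sqrrN//; ring.
by have := H (1 - s); rewrite (_ : 1 - (1 - s) = s)//; ring.
Qed.

Lemma bregP_decay : exists C, forall x, `|bregP F f x| <= C * (1 + x ^+ 2)^-1.
Proof.
have AA := A1'; have CC := C10; have JJ := J0.
have A20 : 0 < 2 * A by lra.
have K0 : 0 <= \int[mu]_s @ksq R s by apply: Rintegral_ge0 => s _; exact: ksq_ge0.
have B0 : 0 <= B by exact: le_trans (ramp_ge0 rF 0) (ramp_le rF 0).
pose C := 4 * decay_const a * (2 * J); have C0 : 0 <= C by rewrite !mulr_ge0.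
pose D := (1 + 4 * A ^+ 2) * (2 * A) * (B * \int[mu]_s @ksq R s).
have D0 : 0 <= D.
  by rewrite mulr_ge0 ?mulr_ge0//; [have := sqr_ge0 A; lra|lra].
exists (2 * C + D) => x; have x20 := sqr_ge0 x.
rewrite ger0_norm ?(bregP_ge0 rF)// ler_pdivlMr; last by lra.
have [->|x0] := eqVneq x 0.
  by rewrite /bregP normr0 invr0 mulr0 mul0r; lra.
have P0 := bregP_ge0 rF x.
have xn : 0 < `|x| by rewrite normr_gt0.
have xx : x ^+ 2 = `|x| ^+ 2 by rewrite real_normK ?num_real.
have x2 : 0 < x ^+ 2 by rewrite exprn_even_gt0.
have [xA|xA] := lerP (2 * A) `|x|.
  have h : bregP F f x <= C / x ^+ 2.
    by apply: bregq_ker => //; [rewrite mulr_ge0|move=> l; exact: breg_large].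
  rewrite ler_pdivlMr// in h.
  have x1 : 1 <= x ^+ 2 by rewrite xx expr2; nra.
  by nra.
have [xB|xB] := lerP `|x| (2 * A)^-1.
  have h : bregP F f x <= 4 * decay_const a * x ^+ 2 * (2 * J) / x ^+ 2.
    by apply: bregq_ker => //; [apply: mulr_ge0 => //; rewrite mulr_ge0|move=> l; exact: breg_small].
  have {}h : bregP F f x <= C.
    by rewrite (le_trans h)// /C (_ : 4 * decay_const a * x ^+ 2 * (2 * J) / x ^+ 2 = 4 * decay_const a * (2 * J))//; field.
  have x1 : x ^+ 2 <= 1.
    have : `|x| <= 1.
      by rewrite (le_trans xB)// invf_le1; lra.
    by rewrite xx expr2; nra.
  by nra.
have x4 : 1 + x ^+ 2 <= 1 + 4 * A ^+ 2 by rewrite xx !expr2; nra.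
have i1 : 1 <= 2 * A * `|x|.
  by rewrite mulrC -ler_pdivrMr ?mul1r ?(ltW xB).
have := bregP_le rF x.
rewrite /D; move: (bregP F f x) (B * _) P0 => p q p0 h.
have h1 : p <= 2 * A * q.
  rewrite (le_trans _ (_ : 2 * A * (`|x| * p) <= _))//; last by rewrite ler_pM2l.
  by rewrite mulrA ler_peMl.
have h2 : p * (1 + x ^+ 2) <= 2 * A * q * (1 + 4 * A ^+ 2).
  by rewrite ler_pM// addr_ge0.
rewrite (le_trans h2)// (_ : 2 * A * q * (1 + 4 * A ^+ 2) = (1 + 4 * A ^+ 2) * (2 * A) * q).
  by rewrite lerDr mulr_ge0.
by ring.
Qed.

Lemma bregP_integrable (w : R -> R) : measurable_fun [set: R] w ->
  mu.-integrable setT (EFin \o (fun x => w x * (1 + x ^+ 2)^-1)) ->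
  mu.-integrable setT (EFin \o (fun x => w x * bregP F f x)).
Proof.
move=> mw Iw; have [C HC] := bregP_decay.
have C0 : 0 <= C.
  have := le_trans (normr_ge0 _) (HC 0); rewrite expr0n/= addr0 invr1 mulr1.
  exact.
apply: (integrable_dom _ _ (intgZ C (intg_norm Iw))).
  by apply: measurable_funM; [exact: measurable_line|exact: bregP_measurable rF].
move=> x; rewrite (normrM (w x)) (normrM (w x)) [leRHS]mulrCA ler_wpM2l//.
by rewrite [X in _ * X]ger0_norm ?HC// invr_ge0 addr_ge0// sqr_ge0.
Qed.

(** For s in an interval of length (A x)^-1 to the left of 1, multiplication by
    1 - s takes x from beyond the ramp to before it, and the divergence is at
    least a there. *)
Lemma bregP_mass_gt0 : 0 < \int[mu]_x bregP F f x.
Proof.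
have AA := A1'; have aa := a1.
have Iw : mu.-integrable setT (EFin \o bregP F f).
  have h : mu.-integrable setT (EFin \o (fun x => 1 * (1 + x ^+ 2)^-1)).
    by under [X in EFin \o X]eq_fun do rewrite mul1r; exact: inv1D_integrable.
  have := @bregP_integrable (fun=> 1) (@measurable_cst _ _ _ _ _ _) h.
  by under [X in EFin \o X]eq_fun do rewrite mul1r.
have [I1 E1] := @Rintegral_indic_co R (2 * A) (4 * A) ltac:(lra).
pose k := (A * (4 * A))^-1 / (4 * A).
have k0 : 0 < k by rewrite divr_gt0 ?invr_gt0 ?mulr_gt0//; lra.
apply: (@lt_le_trans _ _ (\int[mu]_x (k * \1_(`[(2 * A), (4 * A)[%classic) x))).
  by rewrite RintegralZl// E1 mulr_gt0//; lra.
apply: le_Rintegral => //; first exact: intgZ.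
move=> x _; rewrite indicE; case: (boolP (_ \in _)) => [|_]; last first.
  by rewrite mulr0 (bregP_ge0 rF).
rewrite inE/= in_itv/= => /andP[x1 x2]; rewrite mulr1 /bregP.
have x0 : 0 < x by lra.
have Ax : 0 < A * x by rewrite mulr_gt0//; lra.
have iAx : (A * x)^-1 <= 2^-1 by rewrite lef_pV2 ?posrE//; nra.
have [I2 E2] := @Rintegral_indic_co R (1 - (A * x)^-1) 1 ltac:(rewrite gtrBl invr_gt0//).
rewrite (gtr0_norm x0) /k; apply: ler_pM.
- by rewrite invr_ge0 mulr_ge0//; lra.
- by rewrite invr_ge0; lra.
- apply: (@le_trans _ _ (A * x)^-1); first by rewrite lef_pV2 ?posrE ?mulr_gt0//; nra.
  have <- : \int[mu]_s (\1_(`[(1 - (A * x)^-1), 1[%classic) s : R) = (A * x)^-1.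
    by rewrite E2; ring.
  apply: le_Rintegral => //; first exact: bregq_integrable rF _.
  move=> s _; rewrite indicE; case: (boolP (_ \in _)) => [|_]; last exact: bregq_ge0 rF _ _.
  rewrite inE/= in_itv/= => /andP[s1 s2].
  have s0 : 0 < s by lra.
  rewrite /bregq ler_pdivlMr ?exprn_gt0// mul1r.
  have /andP[b1 _] := breg_bound rF (lg x) (lg (1 + s)).
  suff : 1 <= breg F f (lg x) (lg (1 - s)) by rewrite expr2; nra.
  have xa : a < lg x by apply: lg_gt; rewrite gtr0_norm//; lra.
  have s10 : 1 - s != 0 by rewrite gt_eqF//; lra.
  have y0 : 0 < x * (1 - s) by rewrite mulr_gt0//; lra.
  have ya : lg (x * (1 - s)) <= - a.
    have yA : x * (1 - s) <= A^-1.
      have : x * (1 - s) <= x * (A * x)^-1 by rewrite ler_pM2l//; lra.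
      by rewrite invfM mulrCA divff ?mulr1// gt_eqF.
    rewrite -ler_expR expRN expR_lg ?gt_eqF//.
    by rewrite -/A expr2 (le_trans _ yA)// ler_piMl ?(ltW y0)// (le_trans yA)// invf_le1; lra.
  have E : lg x + lg (1 - s) = lg (x * (1 - s)) by rewrite lgM// gt_eqF.
  rewrite /breg E (ramp_hi rF (ltW xa)) (ramp_d1_hi rF xa) mulr1 (ramp_lo rF ya).
  rewrite sub0r -opprD E lerNr (le_trans ya)// lerN2.
  exact: a1.
- by rewrite lef_pV2 ?posrE//; lra.
Qed.

End BregmanDecay.

(** * The half Laplacian in logarithmic coordinates *)

Section NonzeroAE.
Context {R : realType}.
Notation mu := (@lebesgue_measure R).

Lemma ae_neq (a : R) : {ae mu, forall s, s != a}.
Proof.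
exists [set a]; split; [exact: measurable_set1|exact: lebesgue_measure_set1|].
by move=> s /= /negP; rewrite negbK => /eqP.
Qed.

Lemma ae_neq1 : {ae mu, forall s : R, 1 + s != 0 /\ 1 - s != 0}.
Proof.
have FF := ae_filter_ringOfSetsType mu.
apply: filterS (filterI (ae_neq (-1)) (ae_neq 1)) => s [s1 s2]; split.
  by rewrite addrC addr_eq0.
by rewrite subr_eq0 eq_sym.
Qed.

End NonzeroAE.

Section LogCoordinates.
Context {R : realType}.
Notation mu := (@lebesgue_measure R).
Notation mu2 := (mu \x mu)%E.
Notation T1 := (measurableTypeR R).

Variables (psi : R -> R) (rho K : R).
Hypothesis bpsi : bump psi rho K.

(** The second difference with step x s, times the Jacobian |x|. *)
Definition log_diff (x s : R) : R :=
  (2 * psi x - psi (x * (1 + s)) - psi (x * (1 - s))) / s ^+ 2 / `|x|.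

Let log_diffE x s : x != 0 -> log_diff x s = `|x| * second_diff psi x (x * s + 0).
Proof.
move=> x0; have xn : `|x| != 0 by rewrite normr_eq0.
rewrite /log_diff /second_diff addr0 mulrDr mulr1 mulrBr mulr1 exprMn.
rewrite -[x ^+ 2]real_normK ?num_real//; have [->|s0] := eqVneq s 0.
  by rewrite expr0n/= !mulr0 invr0 !mulr0 mul0r.
by field; rewrite xn s0.
Qed.

Lemma log_diff_integral x : x != 0 ->
  mu.-integrable setT (EFin \o log_diff x) /\ \int[mu]_s log_diff x s = hlap psi x.
Proof.
move=> x0; have xn : `|x| != 0 by rewrite normr_eq0.
have -> : log_diff x = (fun s => `|x| * second_diff psi x (x * s + 0)).
  by apply/funext => s; exact: log_diffE.
have Isd := sd_integrable bpsi x; have I1 := integrable_affine 0 x0 Isd.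
split; first exact: intgZ.
by rewrite RintegralZl// (Rintegral_affine 0 x0 Isd) mulrA divff// mul1r.
Qed.

Let log_diff_norm x : x != 0 ->
  (\int[mu]_s `|log_diff x s|%:E <= (sd_bound psi rho K * (1 + x ^+ 2)^-1)%:E)%E.
Proof.
move=> x0; apply: le_trans (second_diff_norm_int bpsi x).
have Isd := sd_integrable bpsi x; have In := intg_norm Isd.
have [I1 _] := log_diff_integral x0.
rewrite (Rintegral_norm_EFin I1) (Rintegral_norm_EFin Isd) lee_fin.
have I2 := integrable_affine 0 x0 In.
have -> : \int[mu]_s `|log_diff x s| = \int[mu]_s (`|x| * `|second_diff psi x (x * s + 0)|).
  by apply: eq_Rintegral => s _; rewrite log_diffE// normrM normr_id.
rewrite RintegralZl// (Rintegral_affine 0 x0 In) mulrA divff ?mul1r//.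
by rewrite normr_eq0.
Qed.

Hypothesis IA : mu.-integrable setT (EFin \o (fun x => psi x / `|x|)).
Hypothesis IM : mu.-integrable setT (EFin \o (fun x => lg x * (psi x / `|x|))).

Let J := \int[mu]_x (psi x / `|x|).
Let M := \int[mu]_x (lg x * (psi x / `|x|)).

Let dilated c : c != 0 ->
  mu.-integrable setT (EFin \o (fun x => lg x * (psi (x * c) / `|x|))) /\
  \int[mu]_x (lg x * (psi (x * c) / `|x|)) = M - lg c * J.
Proof.
move=> c0; have cn : `|c| != 0 by rewrite normr_eq0.
have I0 := intgB IM (intgZ (lg c) IA).
have -> : (fun x => lg x * (psi (x * c) / `|x|)) =
    (fun x => `|c| * ((fun y => lg y * (psi y / `|y|) - lg c * (psi y / `|y|)) (c * x + 0))).
  apply/funext => x; rewrite addr0; have [->|x0] := eqVneq x 0.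
    by rewrite mulr0 mul0r normr0 invr0 !mulr0 subrr mulr0.
  have xn : `|x| != 0 by rewrite normr_eq0.
  rewrite -mulrBl lgM// addrAC subrr add0r normrM [c * x]mulrC.
  by field; rewrite xn cn.
have I1 := integrable_affine 0 c0 I0.
split; first exact: intgZ.
rewrite RintegralZl// (Rintegral_affine 0 c0 I0) mulrA divff// mul1r.
by rewrite RintegralB// ?RintegralZl//; exact: intgZ.
Qed.

Let psi_meas : measurable_fun [set: R] psi.
Proof. by apply: continuous_measurable_fun; exact: bump_continuous bpsi. Qed.

(** In the coordinates x and s the integral over x is elementary: a dilation by c
    changes the logarithmic moment by a multiple of lg c, so the second difference
    leaves a multiple of klog s, whose integral is 0. *)
Lemma hlap_lg_moment : \int[mu]_x (lg x * hlap psi x) = 0.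
Proof.
pose k (z : T1 * T1) : R := lg z.1 * log_diff z.1 z.2.
have m1 : measurable_fun [set: T1 * T1] (fst : T1 * T1 -> R) by exact: measurable_fst.
have m2 : measurable_fun [set: T1 * T1] (snd : T1 * T1 -> R) by exact: measurable_snd.
have mk : measurable_fun setT k.
  apply: measurable_funM; first exact: (measurableT_comp (@lg_measurable R) m1).
  apply: measurable_fun_div; last exact: measurableT_comp.
  apply: measurable_fun_div; last exact: measurable_funX.
  have mc : measurable_fun [set: T1 * T1] (fun=> 1 : R) by exact: measurable_cst.
  apply: measurable_funB.
    apply: measurable_funB.
      by apply: measurable_funM; [exact: measurable_cst|exact: (measurableT_comp psi_meas m1)].
    apply: (measurableT_comp psi_meas); apply: measurable_funM => //.
    exact: measurable_funD.
  apply: (measurableT_comp psi_meas); apply: measurable_funM => //.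
  exact: measurable_funB.
have Ik : mu2.-integrable setT (EFin \o k).
  apply: (@fubini_dom R k (fun x => sd_bound psi rho K * `|lg x * (1 + x ^+ 2)^-1|) mk).
    move=> x; rewrite /k /=; have [->|x0] := eqVneq x 0.
      under eq_integral do rewrite lg0 mul0r normr0.
      by rewrite integral0 lg0 mul0r normr0 mulr0.
    have W0 : 0 <= (1 + x ^+ 2)^-1 by rewrite invr_ge0 addr_ge0// sqr_ge0.
    under eq_integral do rewrite normrM EFinM.
    rewrite ge0_integralZl//; last first.
      have [I1 _] := log_diff_integral x0.
      by apply/measurable_EFinP; apply: measurableT_comp => //; exact: measurable_intg I1.
    rewrite normrM (ger0_norm W0) mulrCA EFinM lee_wpmul2l ?lee_fin//.
    exact: log_diff_norm.
  exact: intgZ (intg_norm (@lg_inv1D_integrable R)).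
have [] := @fubini_val R k (fun x => lg x * hlap psi x) (fun s => J * klog s) Ik.
- by apply: measurable_funM; [exact: measurable_line (@lg_measurable R)|exact: hlap_measurable bpsi].
- by apply: measurable_funM; [exact: measurable_cst|exact: measurable_line (@klog_measurable R)].
- apply: aeW => x /=; rewrite /k /=; have [->|x0] := eqVneq x 0.
    under eq_integral do rewrite lg0 mul0r.
    by rewrite integral0 lg0 mul0r.
  have [I1 E1] := log_diff_integral x0.
  by rewrite (intg_EFin (intgZ (lg x) I1)) RintegralZl// E1.
- have FF := ae_filter_ringOfSetsType mu.
  apply: filterS (@ae_neq1 R) => s [s1 s2] /=; rewrite /k /=.
  have [I1 E1] := dilated s1; have [I2 E2] := dilated s2.
  have -> : (fun x => (lg x * log_diff x s)%:E) = EFin \o (fun x => (s ^+ 2)^-1 *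
      (2 * (lg x * (psi x / `|x|)) - lg x * (psi (x * (1 + s)) / `|x|)
       - lg x * (psi (x * (1 - s)) / `|x|))).
    by apply/funext => x /=; congr (_%:E); rewrite /log_diff; ring.
  have I3 := intgB (intgZ 2 IM) I1; have I4 := intgB I3 I2.
  rewrite (intg_EFin (intgZ _ I4)) RintegralZl// RintegralB// RintegralB//; last exact: intgZ.
  rewrite RintegralZl// -/M E1 E2 /klog; congr (_%:E).
  by move: M J => m j; ring.
- by move=> _ _ ->; rewrite RintegralZl// ?(@klog_integral R) ?mulr0//; exact: klog_integrable.
Qed.

(** The constant function 1 is the exponential of frequency 0. *)
Lemma hlap_integral0 : \int[mu]_x hlap psi x = 0.
Proof.
have E (h : R) : (2 - 2 * 1) / h ^+ 2 = 0 by rewrite mulr1 subrr mul0r.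
have Z : (fun h : R => (2 - 2 * 1) / h ^+ 2) = cst 0 by apply/funext => h; exact: E.
transitivity (\int[mu]_x (1 * hlap psi x)).
  by apply: eq_Rintegral => x _; rewrite mul1r.
rewrite (@hlap_multiplier R psi rho K bpsi (fun=> 1) (fun=> 1) 0) ?mul0r//.
- by move=> x; rewrite normr1.
- by move=> x h; rewrite !mulr1.
- by rewrite Z; exact: integrable0.
- by rewrite Z /Rintegral integral0.
Qed.

End LogCoordinates.

Section HlapBregman.
Context {R : realType}.
Notation mu := (@lebesgue_measure R).

Variables (psi : R -> R) (rho K : R).
Hypothesis bpsi : bump psi rho K.
Variables (a B a' B' : R) (F f b F' f' b' : R -> R).
Hypotheses (rF : ramp a B F f b) (rF' : ramp a' B' F' f' b').
Hypothesis psiE : forall x, x != 0 -> psi x = F' (lg x) - F (lg x).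

(** The first order part of the expansion at lg x is a multiple of klog. *)
Lemma hlap_bregman x : x != 0 -> hlap psi x = bregP F f x - bregP F' f' x.
Proof.
move=> x0; have [I0 <-] := log_diff_integral bpsi x0.
have I1 := bregq_integrable rF (lg x); have I2 := bregq_integrable rF' (lg x).
have I3 := intgB I1 I2; have I4 := intgZ (f' (lg x) - f (lg x)) (@klog_integrable R).
have I5 := intgB I3 I4.
have [] := @Rintegral_ae _ _ _ mu _ (log_diff psi x) (intgZ `|x|^-1 I5).
- exact: measurable_intg I0.
- have FF := ae_filter_ringOfSetsType mu.
  apply: filterS (@ae_neq1 R) => s [s1 s2].
  rewrite /log_diff !psiE ?mulf_neq0// !lgM// /bregq /breg /klog; ring.
move=> _ ->; rewrite RintegralZl// RintegralB// RintegralB// RintegralZl//.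
  by rewrite klog_integral mulr0 subr0 /bregP; ring.
exact: klog_integrable.
Qed.

End HlapBregman.

(** * Nonexistence on the line *)

Section LineLogcomp.
Context {R : realType}.
Notation mu := (@lebesgue_measure R).

Lemma logcomp_sqn (phi : R -> R) (x : R) : x != 0 ->
  (logcomp phi \o sqn) x = phi (lg x).
Proof.
move=> x0; have -> : (logcomp phi \o sqn) x = logcomp phi (x ^+ 2) by rewrite expr2.
by rewrite /logcomp exprn_even_gt0//= x0.
Qed.

Lemma expR_half_lg (x : R) : x != 0 -> expR (2^-1 * lg x) = `|x|.
Proof.
move=> x0; have -> : lg x = lg `|x| by rewrite /lg real_normK ?num_real.
by rewrite lg_ln ?normr_gt0// mulrA mulVf// mul1r lnK// posrE normr_gt0.
Qed.

Lemma logcomp_sqn_integrable (M : R) (phi : R -> R) : continuous phi ->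
  (forall t, M <= `|t| -> phi t = 0) ->
  mu.-integrable setT (EFin \o (logcomp phi \o sqn)).
Proof.
move=> cphi phi0; have [K K0 HK] := logcomp_bounded cphi phi0.
apply: (integrable_dom _ _ (intgZ (K * (1 + expR M)) (@inv1D_integrable R))).
  apply: measurable_line; apply: measurableT_comp.
    by apply: logcomp_measurable; exact: continuous_measurable_fun.
  by apply: continuous_measurable_fun => x; exact: CkOn_cont (@sqn_smooth R 0%N) I.
move=> x; have x2 := sqr_ge0 x.
rewrite ler_pdivlMr; last by lra.
have [xM|xM] := lerP (expR M) (x ^+ 2).
  have -> : (logcomp phi \o sqn) x = 0.
    by rewrite /= /sqn -expr2; exact: logcomp_large phi0 _ xM.
  by rewrite normr0 mul0r mulr_ge0// addr_ge0// expR_ge0.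
apply: ler_pM => //; first by lra.
  by have [] := HK (sqn x).
by rewrite lerD2l ltW.
Qed.

End LineLogcomp.

Section LineSolution.
Context {R : realType}.
Notation mu := (@lebesgue_measure R).

Lemma no_solution1 : ~ exists u : R -> R, is_solution1 u.
Proof.
move=> [u [[[mu0 _ _] Lu] IE Hu]].
have mes_u : measurable_fun [set: R] u by [].
have [B [F [f [b [B0 rF]]]]] := @exists_ramp R.
pose FL (L t : R) : R := L * F (t / L); pose fL (L t : R) : R := f (t / L).
have rFL L : 0 < L -> ramp (1 * L) (B / L) (FL L) (fL L) (fun t => b (t / L) / L).
  by move=> L0; exact: ramp_scale.
pose P L := bregP (FL L) (fL L).
pose N := bregP F f.
have Iu : mu.-integrable setT (EFin \o (fun x => u x * (1 + x ^+ 2)^-1)).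
  apply/integrableP; split.
    apply/measurable_EFinP; apply: measurable_funM; first exact: measurable_line.
    exact: measurable_line (@inv1D_measurable R).
  apply: le_lt_trans Lu; rewrite le_eqVlt; apply/orP; left; apply/eqP.
  apply: eq_integral => x _ /=; congr (_%:E).
  rewrite normrM real_normK ?num_real// (@ger0_norm _ (_^-1))//.
  by rewrite invr_ge0 addr_ge0// sqr_ge0.
have I1 : mu.-integrable setT (EFin \o (fun x : R => 1 * (1 + x ^+ 2)^-1)).
  by under [X in EFin \o X]eq_fun do rewrite mul1r; exact: inv1D_integrable.
have Ilg := @lg_inv1D_integrable R.
have PI a' B' (F' f' b' : R -> R) : 1 <= a' -> ramp a' B' F' f' b' ->
    [/\ mu.-integrable setT (EFin \o bregP F' f'),
        mu.-integrable setT (EFin \o (fun x => u x * bregP F' f' x)) &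
        mu.-integrable setT (EFin \o (fun x => lg x * bregP F' f' x))].
  move=> a1 rF'; split.
  - have := bregP_integrable a1 rF' (@measurable_cst _ _ _ _ setT (1 : R)) I1.
    by under [X in EFin \o X]eq_fun do rewrite mul1r.
  - exact (bregP_integrable a1 rF' mes_u Iu).
  - exact (bregP_integrable a1 rF' (@lg_measurable R) Ilg).
have PIN := PI _ _ _ _ _ (lexx 1) rF.
have PIL L : 1 <= L -> [/\ mu.-integrable setT (EFin \o P L),
        mu.-integrable setT (EFin \o (fun x => u x * P L x)) &
        mu.-integrable setT (EFin \o (fun x => lg x * P L x))].
  move=> L1; have L0 : 0 < L by exact: lt_le_trans L1.
  by apply: (PI (1 * L) (B / L) (FL L) (fL L) _ _ (rFL L L0)); rewrite mul1r.
pose V x := u x + 2^-1 * lg x.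
have VE (G : R -> R) : mu.-integrable setT (EFin \o (fun x => u x * G x)) ->
    mu.-integrable setT (EFin \o (fun x => lg x * G x)) ->
    mu.-integrable setT (EFin \o (fun x => V x * G x)) /\
    \int[mu]_x (V x * G x) = \int[mu]_x (u x * G x) + 2^-1 * \int[mu]_x (lg x * G x).
  move=> Iu' Il'; have -> : (fun x => V x * G x) =
      (fun x => u x * G x + 2^-1 * (lg x * G x)).
    by apply/funext => x; rewrite /V; ring.
  split; first by apply: intgD => //; exact: intgZ.
  by rewrite RintegralD//; [rewrite RintegralZl|exact: intgZ].
pose psi L := logcomp (tent F L) \o @sqn R.
have bump_psi L : 1 <= L -> exists r K, bump (psi L) r K.
  move=> L1; have L0 : 0 < L by exact: lt_le_trans L1.
  apply: (@smooth_bump R (psi L) (1 + expR L)).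
    move=> k; apply: (@CkOn_comp _ _ setT setT k (@sqn R) (logcomp (tent F L)));
      [exact: openT|exact: openT|by []|exact: sqn_smooth|].
    exact: logcomp_smooth (tent_out rF L1) _ (tent_smooth rF L1 k).
  move=> x xL; apply: (logcomp_large (tent_out rF L1)).
  rewrite /sqn -expr2 -real_normK ?num_real// expr2.
  by have := expR_ge0 L; nra.
have ctent L : 1 <= L -> continuous (tent F L).
  by move=> L1 t; exact: is_derive_continuous (is_derive_tent rF L1 t).
(* Division by |x| multiplies the profile by exp (- t / 2), and lg x by t. *)
have IA L : 1 <= L -> mu.-integrable setT (EFin \o (fun x => psi L x / `|x|)) /\
    mu.-integrable setT (EFin \o (fun x => lg x * (psi L x / `|x|))).
  move=> L1.
  have cg : continuous (fun t : R => tent F L t * expR (- (2^-1 * t))).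
    move=> t; apply: cvgM; first exact: ctent.
    apply: (@continuous_comp _ _ _ (fun t : R => - (2^-1 * t)) (@expR R)); last exact: continuous_expR.
    by apply: cvgN; apply: cvgM; [exact: cvg_cst|exact: cvg_id].
  have E x : psi L x / `|x| =
      (logcomp (fun t => tent F L t * expR (- (2^-1 * t))) \o @sqn R) x.
    have [->|x0] := eqVneq x 0.
      by rewrite normr0 invr0 mulr0 /= /logcomp /sqn mul0r ltxx.
    rewrite /psi !logcomp_sqn//; congr (_ * _).
    by rewrite expRN expR_half_lg.
  have E2 x : lg x * (psi L x / `|x|) =
      (logcomp (fun t => t * (tent F L t * expR (- (2^-1 * t)))) \o @sqn R) x.
    rewrite E; have [->|x0] := eqVneq x 0.
      by rewrite lg0 mul0r /= /logcomp /sqn mul0r ltxx.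
    by rewrite !logcomp_sqn.
  split.
    rewrite (funext E).
    apply: (@logcomp_sqn_integrable R L) => // t tL.
    by rewrite (tent_out rF L1 tL) mul0r.
  rewrite (funext E2).
  apply: (@logcomp_sqn_integrable R L) => [t|t tL].
    by apply: cvgM; [exact: cvg_id|exact: cg].
  by rewrite (tent_out rF L1 tL) mul0r mulr0.
have hE L x : 1 <= L -> x != 0 -> hlap (psi L) x = N x - P L x.
  move=> L1; have L0 : 0 < L by exact: lt_le_trans L1.
  have [r [K bp]] := bump_psi L L1.
  by apply: (hlap_bregman bp rF (rFL L L0)) => y y0; rewrite /psi logcomp_sqn.
(* The representation fails at most at 0, hence can be integrated. *)
have hw L (w : R -> R) : 1 <= L -> measurable_fun [set: R] w ->
    mu.-integrable setT (EFin \o (fun x => w x * N x)) ->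
    mu.-integrable setT (EFin \o (fun x => w x * P L x)) ->
    mu.-integrable setT (EFin \o (fun x => w x * hlap (psi L) x)) /\
    \int[mu]_x (w x * hlap (psi L) x) = \int[mu]_x (w x * N x) - \int[mu]_x (w x * P L x).
  move=> L1 mw IN IP; have [r [K bp]] := bump_psi L L1.
  rewrite -RintegralB//.
  apply: (@Rintegral_ae _ _ _ mu (fun x => w x * N x - w x * P L x)
    (fun x => w x * hlap (psi L) x) (intgB IN IP)).
    by apply: measurable_funM; [exact: measurable_line|exact: hlap_measurable bp].
  have FF := ae_filter_ringOfSetsType mu.
  by apply: filterS (@ae_neq R 0) => x x0; rewrite hE// mulrBr.
have mass L : 1 <= L -> \int[mu]_x P L x = \int[mu]_x N x.
  move=> L1; have [r [K bp]] := bump_psi L L1.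
  have [IP _ _] := PIL L L1; have [IN _ _] := PIN.
  have FF := ae_filter_ringOfSetsType mu.
  have ae_h : {ae mu, forall x, N x - P L x = hlap (psi L) x}.
    by apply: filterS (@ae_neq R 0) => x x0; rewrite hE.
  have [_ E] := Rintegral_ae (intgB IN IP) (hlap_measurable bp) ae_h.
  apply/esym/eqP; rewrite -subr_eq0 -RintegralB//; apply/eqP.
  exact: etrans (esym E) (hlap_integral0 bp).
have moment L : 1 <= L -> \int[mu]_x (lg x * P L x) = \int[mu]_x (lg x * N x).
  move=> L1; have [r [K bp]] := bump_psi L L1.
  have [_ _ IP] := PIL L L1; have [_ _ IN] := PIN.
  have [_ E] := hw L lg L1 (@lg_measurable R) IN IP; have [IA1 IA2] := IA L L1.
  apply/esym/eqP; rewrite -subr_eq0; apply/eqP.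
  exact: etrans (esym E) (hlap_lg_moment bp IA1 IA2).
pose Q := \int[mu]_s @ksq R s.
have Q0 : 0 <= Q by apply: Rintegral_ge0 => s _; exact: ksq_ge0.
apply: (@log_blowup R _ _ mu V (fun x => expR (u x)) N P (B * Q) (\int[mu]_x N x)).
- exact: bregP_mass_gt0 (lexx 1) rF.
- by rewrite mulr_ge0// ltW.
- exact: IE.
- move=> L L1; have L0 : 0 < L by exact: lt_le_trans L1.
  have [IP IuP IlP] := PIL L L1.
  split.
  + exact: bregP_ge0 (rFL L L0).
  + exact: IP.
  + exact: (VE _ IuP IlP).1.
  + exact: mass.
  + move=> x; have [->|x0] := eqVneq x 0.
      rewrite /P /bregP normr0 invr0 !mulr0 mulr_ge0 ?expR_ge0//.
      by rewrite divr_ge0 ?mulr_ge0 ?(ltW B0)// ltW.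
    rewrite /V expRD expR_half_lg// -mulrA [leRHS]mulrC ler_pM2l ?expR_gt0//.
    by rewrite mulrAC; exact: bregP_le (rFL L L0) x.
- move=> L L1; have L0 : 0 < L by exact: lt_le_trans L1.
  have [r [K bp]] := bump_psi L L1.
  have [IP IuP IlP] := PIL L L1; have [IN IuN IlN] := PIN.
  rewrite (VE _ IuP IlP).2 (VE _ IuN IlN).2 (moment L L1) lerD2r.
  have [Iuh Euh] := hw L u L1 mes_u IuN IuP.
  have T := @test_function_radial R L (tent F L) (tent_out rF L1) _ (@sqn R)
    (tent_smooth rF L1) (@sqn_smooth R) _ (@compact_sqn R).
  have {}T := T ltac:(by rewrite /sqn mul0r).
  have := Hu _ _ T (is_half_laplacian_hlap bp).
  have -> : \int[mu]_x (u x * ((@cosconst R)^-1 * hlap (psi L) x)) =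
      (@cosconst R)^-1 * \int[mu]_x (u x * hlap (psi L) x).
    by rewrite -RintegralZl//; apply: eq_Rintegral => x _; rewrite mulrCA.
  have : 0 <= \int[mu]_x (expR (u x) * (logcomp (tent F L) \o @sqn R) x).
    apply: Rintegral_ge0 => x _; rewrite mulr_ge0 ?expR_ge0//=.
    by apply: logcomp_ge0 => t; exact (tent_ge0 rF L1 t).
  have c0 : 0 < (@cosconst R)^-1 by rewrite invr_gt0; exact: cosconst_gt0.
  move=> p0 E; rewrite -subr_le0 -Euh -(pmulr_rle0 _ c0) E oppr_le0.
  exact: p0.
Qed.

End LineSolution.

Theorem theorem1p2 (R : realType) :
  (~ exists u : R -> R, is_solution1 u) /\
  (~ exists u : R * R -> R, is_solution2 u).
Proof. by split; [exact: no_solution1|exact: no_solution2]. Qed.
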